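(* Let $M\geq 0$ be a real number. There exists a (small) $\theta_0>0$, not depending on $t$ or $y$, such that for all real $\theta$ with $0<\theta\le\frac\pi2$ and $\frac \pi 2 - \theta_0 \leq \theta \leq \frac \pi 2$, all $r\in\mathbb{R}$ with $|r|\leq M$, and $y>0$ real, with $t = y \sin \theta$ and $\nu=r+it$, one has, as $y\to\infty$, $$\begin{aligned} K_\nu(y) =&\ \frac {\pi \sqrt 2}{y^{1/3}}\, e^{-y \frac \pi 2 \sin \theta + i r \frac \pi 2} \cos\left(r \theta - r \tfrac \pi 2\right) \left(\frac \zeta {\cos^2 \theta} \right)^{1/4} \operatorname{Ai}\left( y^{2/3} \zeta \right) \\ & - \frac{i \pi \sqrt 2}{y^{2/3}}\, e^{-y \frac \pi 2 \sin \theta + i r \frac \pi 2} \sin\left(r \theta - r \tfrac \pi 2\right)\zeta^{-1/2} \left(\frac \zeta {\cos^2 \theta} \right)^{1/4} \operatorname{Ai}'\left( y^{2/3} \zeta \right) \\ &+ O\left(\frac{\operatorname{Ai}\left( y^{2/3} \zeta \right) e^{-y \frac \pi 2 \sin \theta }}{y^{4/3}}\right) + O\left(\frac{\operatorname{Ai}'\left( y^{2/3} \zeta \right)e^{-y \frac \pi 2 \sin \theta}}{y^{5/3}}\right), \end{aligned}$$ where $\zeta = \left[\frac 3 2 \left(\theta \sin \theta + \cos \theta - \frac \pi 2 \sin \theta \right) \right]^{2/3}$ is a nonnegative real number, and the implied constants depend on $\theta_0$ and $M$ (so the estimate is uniform in such $\theta$ and $r$).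
   Context: $K_\nu$ denotes the $K$-Bessel function (modified Bessel function of the second kind), for $y>0$ and $\nu\in\mathbb{C}$ given by $K_\nu(y)=\frac12\int_{-\infty}^{\infty} e^{-y\cosh R+\nu R}\,dR$. $\operatorname{Ai}$ is the Airy function and $\operatorname{Ai}'$ its derivative. At $\theta=\frac\pi2$ (where $\zeta=0$ and $\cos\theta=0$) the coefficient expressions $\left(\zeta/\cos^2\theta\right)^{1/4}$ and $\sin(r\theta-r\frac\pi2)\,\zeta^{-1/2}$ are understood as their limits as $\theta\to\frac\pi2^-$. *)

(* Defs.v *)
From Stdlib Require Export Reals.
From Coquelicot Require Export Coquelicot.

Open Scope R_scope.

Definition Cexp (z : C) : C := (exp (Re z) * cos (Im z), exp (Re z) * sin (Im z)).

(** Real powers of nonnegative reals.  [Rpower 0 a = 1] because of the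
    convention [ln 0 = 0]; here [0 ^ a = 0], the right value for [a > 0]. *)
Definition rpow (x a : R) : R := if Rlt_dec 0 x then Rpower x a else 0.

Definition BesselK (nu : C) (y : R) : C :=
  (RtoC (/ 2) *
   RInt_gen (V := C_R_CompleteNormedModule)
     (fun s : R => Cexp (RtoC (- (y * cosh s)) + nu * RtoC s))
     (Rbar_locally m_infty) (Rbar_locally p_infty))%C.

(** The integral is only conditionally convergent: [RInt_gen] is its improper
    Riemann value. *)
Definition Airy (x : R) : R :=
  / PI * RInt_gen (fun s : R => cos (s ^ 3 / 3 + x * s))
           (at_point 0) (Rbar_locally p_infty).

Definition Airy' (x : R) : R := Derive Airy x.

Definition zeta_base (theta : R) : R :=
  3 / 2 * (theta * sin theta + cos theta - PI / 2 * sin theta).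

Definition zeta (theta : R) : R := rpow (zeta_base theta) (2 / 3).

(** [f], with its value at [a] replaced by the limit of [f] from the left. *)
Definition extend_left (a : R) (f : R -> R) (x : R) : R :=
  if Req_EM_T x a then lim (T := R_CompleteSpace) (filtermap f (at_left a))
  else f x.

(** [(zeta / cos^2 theta)^(1/4)] *)
Definition coefA : R -> R :=
  extend_left (PI / 2) (fun theta => rpow (zeta theta / cos theta ^ 2) (1 / 4)).

(** [sin (r theta - r pi/2) zeta^(-1/2)] *)
Definition coefB (r : R) : R -> R :=
  extend_left (PI / 2)
    (fun theta => sin (r * theta - r * (PI / 2)) * rpow (zeta theta) (- (1 / 2))).

(* Main.v *)
Require Import Defs.
From Stdlib Require Import Reals Lra Psatz.
From Coquelicot Require Import Coquelicot.

(** With [al = PI / 2 - theta], shifting the contour to [Im R = PI / 2 - al b] turns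
    [K_nu(y)] into the integral of [exp (- i y (sinh u - u cos al)) e^(r u)] over the line
    [u = al (x - i b)], where the modulus of the integrand has a Gaussian profile.  The saddle
    points are [+- i al].

    [e^(r u) = cos (r al) + (sin (r al) / al) u] modulo
    [cosh u - cos al], and a multiple of [cosh u - cos al], being a multiple of the derivative
    of the phase, gains a factor [1 / y] by an integration by parts.  This leaves the integrals
    with amplitudes [1] and [u].

    These are compared with the Airy integrals by deforming [al] to [0] while [y] varies so that
    the value [xi = y (sin al - al cos al)] of the phase at the saddle point stays fixed.  Along
    this path the integrals satisfy a scalar linear differential equation up to a relative error
    [1 / y] (again by parts), whose solutions are explicit, and in the limit the rescaled phase
    becomes the cubic of the Airy function.  All estimates are relative to [e^(- xi)] because
    the whole argument takes place on one line; [b] exceeds [1] only if the saddle points are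
    closer to each other than [y^(-1/3)].

    Since [|Ai'(x)| <= C (1 + sqrt x) Ai(x)] and [x = O(y^(2/3))], the error term with [Airy']
    is absorbed in the one with [Airy].  The case [theta = PI / 2] follows by continuity. *)

(** In the coordinate [w = u / al] the saddle points are [+- i] for every [al], and the exponent
    there is [+- xi]. With [xi] constant, the derivative of the exponent along the path at fixed [w]
    vanishes at both saddle points. It is therefore divisible by [cosh u - cos al], and an
    integration by parts removes its large factor [y]. By parity the amplitudes [1] and [u] do not
    mix, which is why the resulting equation is scalar.

    The obstacle is uniformity while the two zeros of [cosh u - cos al] merge. Quotients by this
    function are therefore built as integrals of derivatives along segments, inside families whose
    bounds do not depend on [al].

    All errors come out as multiples of [exp (- xi) / (y sqrt (xi b))] and have to be compared with
    [Ai] itself. This takes a lower bound for [|Ai|] on the half line: the integral over the line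
    through the saddle point gives it for large arguments, the monotonicity of [Ai^2] for the
    others. *)

Ltac real_ring := match goal with |- @eq _ ?a ?b => change (@eq R a b) end; ring.

(** * Complex exponential and derivatives *)

Lemma RtoC_neq_0 (a : R) : a <> 0 -> RtoC a <> 0.
Proof. intros Ha H. apply (f_equal fst) in H. now apply Ha. Qed.

Lemma Cexp_plus (z w : C) : Cexp (z + w)%C = (Cexp z * Cexp w)%C.
Proof.
  destruct z as [a b], w as [c d]. unfold Cexp; simpl.
  apply injective_projections; simpl;
    rewrite exp_plus, ?cos_plus, ?sin_plus; ring.
Qed.

Lemma Cexp_0 : Cexp 0 = 1%C.
Proof.
  unfold Cexp; simpl; rewrite exp_0, cos_0, sin_0.
  apply injective_projections; simpl; ring.
Qed.

Lemma Cmod_Cexp (z : C) : Cmod (Cexp z) = exp (Re z).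
Proof.
  unfold Cexp, Cmod; simpl.
  replace (_ + _) with (exp (Re z) ^ 2).
  - replace (exp (Re z) ^ 2) with (Rsqr (exp (Re z))) by (unfold Rsqr; ring).
    apply sqrt_Rsqr, Rlt_le, exp_pos.
  - pose proof (sin2_cos2 (Im z)) as H; unfold Rsqr in H.
    transitivity (exp (Re z) ^ 2 * (sin (Im z) * sin (Im z) + cos (Im z) * cos (Im z)));
      [rewrite H|]; ring.
Qed.

Lemma exp_le_compat (a b : R) : a <= b -> exp a <= exp b.
Proof. intros [H| ->]; [apply Rlt_le, exp_increasing, H|lra]. Qed.

Lemma Cmod_le_plus (z w : C) (a b : R) :
  Cmod z <= a -> Cmod w <= b -> Cmod (z + w)%C <= a + b.
Proof. intros; eapply Rle_trans; [apply Cmod_triangle|lra]. Qed.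

Lemma Cmod_le_minus (z w : C) (a b : R) :
  Cmod z <= a -> Cmod w <= b -> Cmod (z - w)%C <= a + b.
Proof. intros; unfold Cminus; apply Cmod_le_plus; [|rewrite Cmod_opp]; assumption. Qed.

Lemma Cmod_le_mult (z w : C) (a b : R) :
  Cmod z <= a -> Cmod w <= b -> Cmod (z * w)%C <= a * b.
Proof.
  intros; rewrite Cmod_mult.
  apply Rmult_le_compat; try apply Cmod_ge_0; assumption.
Qed.

Lemma im_le_Cmod (z : C) : Rabs (Im z) <= Cmod z.
Proof. eapply Rle_trans; [|apply Rmax_Cmod]. apply Rmax_r. Qed.

Lemma Cmod_le_re_im (z : C) : Cmod z <= Rabs (Re z) + Rabs (Im z).
Proof.
  destruct z as [a b]; simpl.
  replace (a, b) with (RtoC a + Ci * RtoC b)%C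
    by (apply injective_projections; simpl; ring).
  apply Cmod_le_plus; [rewrite Cmod_R; lra|].
  rewrite Cmod_mult, Cmod_Ci, Cmod_R; lra.
Qed.

(** * Differentiation along real and complex variables *)

Definition rder (f : R -> C) (x : R) (l : C) : Prop :=
  is_derive (fun t => Re (f t)) x (Re l) /\ is_derive (fun t => Im (f t)) x (Im l).

Lemma rder_eq (f : R -> C) (x : R) (l m : C) : rder f x l -> l = m -> rder f x m.
Proof. now intros H <-. Qed.

Lemma rder_const (c : C) (x : R) : rder (fun _ => c) x 0.
Proof. split; apply @is_derive_const. Qed.

Lemma rder_RtoC (f : R -> R) (x l : R) :
  is_derive f x l -> rder (fun t => RtoC (f t)) x (RtoC l).
Proof. intros H; split; simpl; [exact H|apply @is_derive_const]. Qed.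

Lemma rder_plus (f g : R -> C) (x : R) (l m : C) :
  rder f x l -> rder g x m -> rder (fun t => f t + g t)%C x (l + m)%C.
Proof. intros [H1 H2] [H3 H4]; split; simpl; now apply @is_derive_plus. Qed.

Lemma rder_opp (f : R -> C) (x : R) (l : C) :
  rder f x l -> rder (fun t => - f t)%C x (- l)%C.
Proof. intros [H1 H2]; split; simpl; now apply @is_derive_opp. Qed.

Lemma rder_minus (f g : R -> C) (x : R) (l m : C) :
  rder f x l -> rder g x m -> rder (fun t => f t - g t)%C x (l - m)%C.
Proof. intros; apply rder_plus; [|apply rder_opp]; assumption. Qed.

Lemma rder_mult (f g : R -> C) (x : R) (l m : C) :
  rder f x l -> rder g x m -> rder (fun t => f t * g t)%C x (l * g x + f x * m)%C.
Proof.
  intros [H1 H2] [H3 H4]; split; simpl.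
  - evar_last. 
    { apply @is_derive_minus; apply @is_derive_mult; eauto; intros; apply Rmult_comm. }
    unfold minus, plus, opp, mult; simpl; unfold Re, Im; real_ring.
  - evar_last.
    { apply @is_derive_plus; apply @is_derive_mult; eauto; intros; apply Rmult_comm. }
    unfold minus, plus, opp, mult; simpl; unfold Re, Im; real_ring.
Qed.

Lemma rder_Cexp (f : R -> C) (x : R) (l : C) :
  rder f x l -> rder (fun t => Cexp (f t)) x (l * Cexp (f x))%C.
Proof.
  intros [H1 H2].
  assert (E1 : is_derive (fun t => exp (Re (f t))) x (Re l * exp (Re (f x)))).
  { apply (is_derive_comp exp (fun t => Re (f t))); [apply is_derive_exp|exact H1]. }
  assert (E2 : is_derive (fun t => cos (Im (f t))) x (Im l * - sin (Im (f x)))).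
  { apply (is_derive_comp cos (fun t => Im (f t))); [apply is_derive_cos|exact H2]. }
  assert (E3 : is_derive (fun t => sin (Im (f t))) x (Im l * cos (Im (f x)))).
  { apply (is_derive_comp sin (fun t => Im (f t))); [apply is_derive_sin|exact H2]. }
  split; simpl.
  - evar_last.
    { apply @is_derive_mult; [exact E1|exact E2|intros; apply Rmult_comm]. }
    unfold plus, mult; simpl; unfold Re, Im; real_ring.
  - evar_last.
    { apply @is_derive_mult; [exact E1|exact E3|intros; apply Rmult_comm]. }
    unfold plus, mult; simpl; unfold Re, Im; real_ring.
Qed.

Lemma rder_unique (f : R -> C) (x : R) (l m : C) : rder f x l -> rder f x m -> l = m.
Proof.
  intros [H1 H2] [H3 H4]. apply injective_projections.
  - apply is_derive_unique in H1, H3. unfold Re in *; congruence.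
  - apply is_derive_unique in H2, H4. unfold Im in *; congruence.
Qed.

(* Test against the direction of the increment to reduce to the real mean value theorem. *)
Lemma rder_bound (f df : R -> C) (a b K : R) :
  a <= b -> (forall t, a <= t <= b -> rder f t (df t)) ->
  (forall t, a <= t <= b -> Cmod (df t) <= K) ->
  Cmod (f b - f a)%C <= K * (b - a).
Proof.
  intros Hab Hd HK.
  set (z := (f b - f a)%C).
  destruct (Req_dec (Cmod z) 0) as [Hz|Hz].
  { rewrite Hz. apply Rmult_le_pos; [|lra].
    eapply Rle_trans; [apply Cmod_ge_0|apply (HK a); lra]. }
  assert (Hz0 : 0 < Cmod z) by (pose proof (Cmod_ge_0 z); lra).
  pose (g := fun t => Re z * Re (f t) + Im z * Im (f t)).
  pose (dg := fun t => Re z * Re (df t) + Im z * Im (df t)).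
  destruct (MVT_gen g a b dg) as [c [Hc Hg]].
  - rewrite Rmin_left, Rmax_right by lra. intros t Ht.
    destruct (Hd t ltac:(lra)) as [H1 H2].
    unfold g, dg. apply @is_derive_plus; now apply is_derive_scal.
  - rewrite Rmin_left, Rmax_right by lra. intros t Ht.
    destruct (Hd t ltac:(lra)) as [H1 H2].
    apply continuity_pt_filterlim. apply @ex_derive_continuous.
    exists (dg t). unfold g, dg. apply @is_derive_plus; now apply is_derive_scal.
  - rewrite Rmin_left, Rmax_right in Hc by lra.
    assert (Hsq : Cmod z ^ 2 = g b - g a).
    { rewrite Cmod2_alt. unfold g, z; simpl. unfold Re, Im. ring. }
    assert (Hdg : dg c <= Cmod z * K).
    { unfold dg.
      replace (Re z * Re (df c) + Im z * Im (df c)) with (Re (Cconj z * df c)%C)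
        by (simpl; unfold Re, Im; ring).
      eapply Rle_trans; [apply Rle_abs|]. eapply Rle_trans; [apply re_le_Cmod|].
      rewrite Cmod_mult, Cmod_conj. apply Rmult_le_compat_l; [lra|].
      apply HK; lra. }
    assert (Cmod z ^ 2 <= Cmod z * K * (b - a)).
    { rewrite Hsq, Hg. apply Rmult_le_compat_r; lra. }
    apply Rmult_le_reg_l with (Cmod z); [lra|]. nra.
Qed.

(** For holomorphic functions this is equivalent to differentiability, and it makes the
    rules of differentiation purely algebraic. *)
Definition cder (f : C -> C) (u l : C) : Prop :=
  exists d K, 0 < d /\ 0 <= K /\
  forall h, Cmod h < d -> Cmod (f (u + h) - f u - l * h)%C <= K * Cmod h ^ 2.

Lemma cder_eq (f : C -> C) (u l m : C) : cder f u l -> l = m -> cder f u m.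
Proof. now intros H <-. Qed.

Lemma cder_ext_loc (f g : C -> C) (u l : C) (d : R) :
  0 < d -> (forall h, Cmod h < d -> f (u + h)%C = g (u + h)%C) -> cder f u l -> cder g u l.
Proof.
  intros Hd He (d' & K & Hd' & HK & H).
  exists (Rmin d d'), K; split; [now apply Rmin_glb_lt|split; [exact HK|]].
  intros h Hh.
  rewrite <- He by (eapply Rlt_le_trans; [exact Hh|apply Rmin_l]).
  assert (E : f u = g u).
  { specialize (He 0%C). rewrite Cplus_0_r in He. apply He. now rewrite Cmod_0. }
  rewrite <- E. apply H. eapply Rlt_le_trans; [exact Hh|apply Rmin_r].
Qed.

Lemma cder_const (c u : C) : cder (fun _ => c) u 0.
Proof.
  exists 1, 0; repeat split; try lra. intros h _.
  replace (c - c - 0 * h)%C with (RtoC 0) by ring. rewrite Cmod_0; lra.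
Qed.

Lemma cder_id (u : C) : cder (fun v => v) u 1.
Proof.
  exists 1, 0; repeat split; try lra. intros h _.
  replace (u + h - u - 1 * h)%C with (RtoC 0) by ring. rewrite Cmod_0; lra.
Qed.

Lemma cder_plus (f g : C -> C) (u l m : C) :
  cder f u l -> cder g u m -> cder (fun v => f v + g v)%C u (l + m)%C.
Proof.
  intros (d & K & Hd & HK & H) (d' & K' & Hd' & HK' & H').
  exists (Rmin d d'), (K + K'); split; [now apply Rmin_glb_lt|split; [lra|]].
  intros h Hh.
  replace (_ - _ - _)%C with ((f (u + h) - f u - l * h) + (g (u + h) - g u - m * h))%C by ring.
  rewrite Rmult_plus_distr_r. apply Cmod_le_plus; [apply H|apply H'];
    eapply Rlt_le_trans; try exact Hh; [apply Rmin_l|apply Rmin_r].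
Qed.

Lemma cder_lip (f : C -> C) (u l : C) : cder f u l ->
  exists d K, 0 < d /\ 0 <= K /\ forall h, Cmod h < d -> Cmod (f (u + h) - f u)%C <= K * Cmod h.
Proof.
  intros (d & K & Hd & HK & H).
  exists d, (K * d + Cmod l); pose proof (Cmod_ge_0 l).
  split; [exact Hd|split; [nra|]].
  intros h Hh.
  replace (f (u + h) - f u)%C with ((f (u + h) - f u - l * h) + l * h)%C by ring.
  eapply Rle_trans; [apply Cmod_le_plus; [now apply H|apply Rle_refl]|].
  rewrite Cmod_mult. pose proof (Cmod_ge_0 h).
  assert (K * (Cmod h * Cmod h) <= K * (d * Cmod h)) by (apply Rmult_le_compat_l; nra).
  simpl; nra.
Qed.

Lemma cder_mult (f g : C -> C) (u l m : C) :
  cder f u l -> cder g u m -> cder (fun v => f v * g v)%C u (l * g u + f u * m)%C.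
Proof.
  intros Hf Hg.
  destruct (cder_lip _ _ _ Hf) as (d1 & K1 & Hd1 & HK1 & H1).
  destruct (cder_lip _ _ _ Hg) as (d2 & K2 & Hd2 & HK2 & H2).
  destruct Hf as (d & K & Hd & HK & H), Hg as (d' & K' & Hd' & HK' & H').
  pose proof (Cmod_ge_0 (f u)); pose proof (Cmod_ge_0 (g u)).
  exists (Rmin (Rmin d d') (Rmin d1 d2)), (K * Cmod (g u) + Cmod (f u) * K' + K1 * K2).
  split; [repeat apply Rmin_glb_lt; assumption|split; [nra|]].
  intros h Hh.
  assert (Hh1 := Rlt_le_trans _ _ _ Hh (Rmin_l _ _)).
  assert (Hh2 := Rlt_le_trans _ _ _ Hh (Rmin_r _ _)).
  assert (h1 := Rlt_le_trans _ _ _ Hh1 (Rmin_l _ _)).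
  assert (h2 := Rlt_le_trans _ _ _ Hh1 (Rmin_r _ _)).
  assert (h3 := Rlt_le_trans _ _ _ Hh2 (Rmin_l _ _)).
  assert (h4 := Rlt_le_trans _ _ _ Hh2 (Rmin_r _ _)).
  replace (_ - _ - _)%C with ((f (u + h) - f u - l * h) * g u
     + f u * (g (u + h) - g u - m * h)
     + (f (u + h) - f u) * (g (u + h) - g u))%C by ring.
  replace (_ * _ ^ 2) with (K * Cmod h ^ 2 * Cmod (g u) + Cmod (f u) * (K' * Cmod h ^ 2)
     + (K1 * Cmod h) * (K2 * Cmod h)) by ring.
  repeat apply Cmod_le_plus; apply Cmod_le_mult; auto; apply Rle_refl.
Qed.

Lemma cder_opp (f : C -> C) (u l : C) : cder f u l -> cder (fun v => - f v)%C u (- l)%C.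
Proof.
  intros (d & K & Hd & HK & H). exists d, K; repeat split; auto. intros h Hh.
  replace (_ - _ - _)%C with (- (f (u + h) - f u - l * h))%C by ring.
  rewrite Cmod_opp; auto.
Qed.

Lemma cder_minus (f g : C -> C) (u l m : C) :
  cder f u l -> cder g u m -> cder (fun v => f v - g v)%C u (l - m)%C.
Proof. intros; apply cder_plus; [|apply cder_opp]; assumption. Qed.

Lemma cder_scal (c : C) (f : C -> C) (u l : C) :
  cder f u l -> cder (fun v => c * f v)%C u (c * l)%C.
Proof.
  intros H; eapply cder_eq; [apply cder_mult; [apply cder_const|exact H]|cbv beta; ring].
Qed.

Lemma cder_comp (f g : C -> C) (u l m : C) :
  cder f (g u) l -> cder g u m -> cder (fun v => f (g v)) u (l * m)%C.
Proof.
  intros (d & K & Hd & HK & H) Hg.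
  destruct (cder_lip _ _ _ Hg) as (d2 & K2 & Hd2 & HK2 & H2).
  destruct Hg as (d' & K' & Hd' & HK' & H').
  pose proof (Cmod_ge_0 l).
  exists (Rmin d' (Rmin d2 (d / (K2 + 1)))), (K * K2 ^ 2 + Cmod l * K').
  split; [repeat apply Rmin_glb_lt; try assumption; apply Rdiv_lt_0_compat; lra
         |split; [nra|]].
  intros h Hh.
  assert (h1 := Rlt_le_trans _ _ _ Hh (Rmin_l _ _)).
  assert (Hh2 := Rlt_le_trans _ _ _ Hh (Rmin_r _ _)).
  assert (h2 := Rlt_le_trans _ _ _ Hh2 (Rmin_l _ _)).
  assert (h3 := Rlt_le_trans _ _ _ Hh2 (Rmin_r _ _)).
  specialize (H2 h h2). specialize (H' h h1).
  pose proof (Cmod_ge_0 h).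
  set (k := (g (u + h) - g u)%C) in *.
  assert (Hk : Cmod k < d).
  { eapply Rle_lt_trans; [exact H2|].
    apply Rle_lt_trans with ((K2 + 1) * Cmod h); [nra|].
    apply (Rmult_lt_compat_l (K2 + 1)) in h3; [|lra].
    replace ((K2 + 1) * (d / (K2 + 1))) with d in h3 by (field; lra). exact h3. }
  specialize (H k Hk).
  replace (g u + k)%C with (g (u + h)%C) in H by (unfold k; ring).
  replace (_ - _ - _)%C with
    ((f (g (u + h)) - f (g u) - l * k) + l * (k - m * h))%C by (unfold k; ring).
  replace (_ * _ ^ 2) with (K * (K2 * Cmod h) ^ 2 + Cmod l * (K' * Cmod h ^ 2)) by ring.
  apply Cmod_le_plus.
  - eapply Rle_trans; [exact H|]. apply Rmult_le_compat_l; [exact HK|].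
    apply pow_incr; split; [apply Cmod_ge_0|exact H2].
  - apply Cmod_le_mult; [lra|exact H'].
Qed.

(** The curve is merely differentiable, with remainder [o (t - x)], whereas that of [f] is
    quadratic. The two are combined in an epsilon-delta estimate in the complex modulus ([Hmain]),
    which is projected to real and imaginary parts only at the end. *)
Lemma rder_cder (f : C -> C) (g : R -> C) (x : R) (l m : C) :
  cder f (g x) l -> rder g x m -> rder (fun t => f (g t)) x (l * m)%C.
Proof.
  intros (d & K & Hd & HK & H) [Hg1 Hg2].
  set (L := Cmod m + 2).
  assert (HL : 0 < L) by (unfold L; pose proof (Cmod_ge_0 m); lra).
  assert (Hg : forall eps, 0 < eps -> exists de, 0 < de /\ forall t, Rabs (t - x) < de ->
     Cmod (g t - g x - m * RtoC (t - x))%C <= eps * Rabs (t - x)).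
  { intros eps He.
    destruct Hg1 as [_ Hg1], Hg2 as [_ Hg2].
    assert (He2 : 0 < eps / 2) by lra.
    specialize (Hg1 x (fun P HP => HP) (mkposreal _ He2)).
    specialize (Hg2 x (fun P HP => HP) (mkposreal _ He2)).
    destruct Hg1 as [d1 Hg1], Hg2 as [d2 Hg2].
    exists (Rmin d1 d2); split; [apply Rmin_glb_lt; [apply d1|apply d2]|].
    intros t Ht.
    specialize (Hg1 t (Rlt_le_trans _ _ _ Ht (Rmin_l _ _))).
    specialize (Hg2 t (Rlt_le_trans _ _ _ Ht (Rmin_r _ _))).
    unfold norm, minus, plus, opp, scal in Hg1, Hg2; simpl in Hg1, Hg2.
    unfold mult in Hg1, Hg2; simpl in Hg1, Hg2. unfold abs in Hg1, Hg2; simpl in Hg1, Hg2.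
    eapply Rle_trans; [apply Cmod_le_re_im|].
    replace (eps * Rabs (t - x)) with (eps / 2 * Rabs (t + - x) + eps / 2 * Rabs (t + - x))
      by (unfold Rminus; field).
    apply Rplus_le_compat.
    - replace (Re _) with (Re (g t) + - Re (g x) + - ((t + - x) * Re m)); [exact Hg1|].
      simpl; unfold Re, Im; ring.
    - replace (Im _) with (Im (g t) + - Im (g x) + - ((t + - x) * Im m)); [exact Hg2|].
      simpl; unfold Re, Im; ring. }
  assert (Hmain : forall eps, 0 < eps -> exists de, 0 < de /\ forall t, Rabs (t - x) < de ->
     Cmod (f (g t) - f (g x) - (l * m) * RtoC (t - x))%C <= eps * Rabs (t - x)).
  { intros eps He.
    pose proof (Cmod_ge_0 l) as Hl.
    (* The bound [1] makes [g] Lipschitz at [x] with constant [L]; the other bound keeps the term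
       multiplied by [l] below half of [eps]. *)
    assert (He1 : 0 < Rmin 1 (eps / (2 * (Cmod l + 1)))).
    { apply Rmin_glb_lt; [lra|]. apply Rdiv_lt_0_compat; lra. }
    destruct (Hg _ He1) as (de & Hde & Hgt).
    exists (Rmin de (Rmin (d / L) (eps / (2 * (K + 1) * L ^ 2)))).
    split. { repeat apply Rmin_glb_lt; try assumption; apply Rdiv_lt_0_compat; try nra. }
    intros t Ht.
    assert (h1 := Rlt_le_trans _ _ _ Ht (Rmin_l _ _)).
    assert (Hh2 := Rlt_le_trans _ _ _ Ht (Rmin_r _ _)).
    assert (h2 := Rlt_le_trans _ _ _ Hh2 (Rmin_l _ _)).
    assert (h3 := Rlt_le_trans _ _ _ Hh2 (Rmin_r _ _)).
    specialize (Hgt t h1).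
    pose proof (Rmin_l 1 (eps / (2 * (Cmod l + 1)))) as m1.
    pose proof (Rmin_r 1 (eps / (2 * (Cmod l + 1)))) as m2.
    set (e1 := Rmin 1 (eps / (2 * (Cmod l + 1)))) in *.
    pose proof (Rabs_pos (t - x)) as Hx.
    set (k := (g t - g x)%C) in *.
    assert (Hk : Cmod k <= L * Rabs (t - x)).
    { replace k with ((k - m * RtoC (t - x)) + m * RtoC (t - x))%C by ring.
      eapply Rle_trans; [apply Cmod_le_plus; [exact Hgt|apply Rle_refl]|].
      rewrite Cmod_mult, Cmod_R. unfold L. nra. }
    assert (Hkd : Cmod k < d).
    { eapply Rle_lt_trans; [exact Hk|].
      apply (Rmult_lt_compat_l L) in h2; [|lra].
      replace (L * (d / L)) with d in h2 by (field; lra). exact h2. }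
    specialize (H k Hkd).
    replace (g x + k)%C with (g t) in H by (unfold k; ring).
    replace (_ - _ - _)%C with ((f (g t) - f (g x) - l * k) + l * (k - m * RtoC (t - x)))%C
      by ring.
    replace (eps * Rabs (t - x)) with (eps / 2 * Rabs (t - x) + eps / 2 * Rabs (t - x)) by field.
    apply Cmod_le_plus.
    - eapply Rle_trans; [exact H|].
      apply Rle_trans with (K * (L * Rabs (t - x)) ^ 2).
      + apply Rmult_le_compat_l; [exact HK|]. apply pow_incr; split; [apply Cmod_ge_0|exact Hk].
      + assert (Hq : (K + 1) * L ^ 2 * Rabs (t - x) <= eps / 2).
        { apply Rlt_le. apply (Rmult_lt_compat_l ((K + 1) * L ^ 2)) in h3; [|nra].
          replace ((K + 1) * L ^ 2 * (eps / (2 * (K + 1) * L ^ 2))) with (eps / 2) in h3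
            by (field; split; lra). exact h3. }
        assert (0 <= L ^ 2) by nra.
        assert (K * L ^ 2 * Rabs (t - x) <= eps / 2) by nra.
        nra.
    - rewrite Cmod_mult.
      assert (Cmod l * e1 <= eps / 2).
      { apply Rle_trans with ((Cmod l + 1) * (eps / (2 * (Cmod l + 1)))).
        - apply Rmult_le_compat; try lra.
        - apply Req_le; field; lra. }
      apply Rle_trans with (Cmod l * (e1 * Rabs (t - x))).
      + now apply Rmult_le_compat_l.
      + nra. }
  split; (split; [apply is_linear_scal_l|]); intros y Hy;
    rewrite <- (is_filter_lim_locally_unique (V := R_NormedModule) x y Hy); intros [eps He]; simpl;
    destruct (Hmain eps He) as (de & Hde & Ht); exists (mkposreal _ Hde); intros t Hb;
    specialize (Ht t Hb);
    unfold norm, minus, plus, opp, scal; simpl; unfold mult; simpl; unfold abs; simpl.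
  - eapply Rle_trans; [|exact Ht]. eapply Rle_trans; [|apply re_le_Cmod].
    apply Req_le; f_equal. simpl; unfold Re, Im; ring.
  - eapply Rle_trans; [|exact Ht]. eapply Rle_trans; [|apply im_le_Cmod].
    apply Req_le; f_equal. simpl; unfold Re, Im; ring.
Qed.

Lemma rder_id : forall x, rder RtoC x 1.
Proof. intros; apply (rder_RtoC (fun t => t)), @is_derive_id. Qed.

Lemma cder_unique (f : C -> C) (u l m : C) : cder f u l -> cder f u m -> l = m.
Proof.
  intros H1 H2.
  assert (Hg : rder (fun t => u + RtoC t)%C 0 1).
  { eapply rder_eq; [apply rder_plus; [apply rder_const|apply rder_id]|ring]. }
  assert (E : forall l, cder f u l -> rder (fun t => f (u + RtoC t)%C) 0 l).
  { intros k Hk. eapply rder_eq; [apply rder_cder; [|exact Hg]|].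
    - rewrite Cplus_0_r; exact Hk.
    - ring. }
  eapply rder_unique; apply E; eassumption.
Qed.

(** The mean value bound is applied twice along the segment from [0] to [z]; the constant [3] bounds
    [exp 1]. *)
Lemma Cexp_quad (z : C) : Cmod z <= 1 -> Cmod (Cexp z - 1 - z)%C <= 3 * Cmod z ^ 2.
Proof.
  intros Hz.
  assert (Hlin : forall s, rder (fun t => RtoC t * z)%C s z).
  { intros s. eapply rder_eq; [apply rder_mult; [apply rder_id|apply rder_const]|cbv beta; ring]. }
  assert (Hb : forall s, 0 <= s <= 1 -> Cmod (Cexp (RtoC s * z))%C <= 3).
  { intros s Hs. rewrite Cmod_Cexp. apply Rle_trans with (exp 1); [|apply exp_le_3].
    apply exp_le_compat. eapply Rle_trans; [apply Rle_abs|].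
    eapply Rle_trans; [apply re_le_Cmod|]. rewrite Cmod_mult, Cmod_R, Rabs_right by lra.
    pose proof (Cmod_ge_0 z); nra. }
  assert (H1 : forall s, 0 <= s <= 1 -> Cmod (Cexp (RtoC s * z) - 1)%C <= 3 * Cmod z).
  { intros s Hs.
    pose proof (rder_bound (fun t => Cexp (RtoC t * z))%C
      (fun t => z * Cexp (RtoC t * z))%C 0 s (3 * Cmod z) ltac:(lra)) as B.
    cbv beta in B. rewrite Cmult_0_l, Cexp_0 in B.
    eapply Rle_trans; [apply B|].
    - intros t _. apply rder_Cexp, Hlin.
    - intros t Ht. rewrite Cmod_mult, Rmult_comm. apply Rmult_le_compat_r; [apply Cmod_ge_0|].
      apply Hb; lra.
    - pose proof (Cmod_ge_0 z); nra. }
  pose proof (rder_bound (fun t => Cexp (RtoC t * z) - RtoC t * z)%C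
      (fun t => z * Cexp (RtoC t * z) - z)%C 0 1 (3 * Cmod z ^ 2) ltac:(lra)) as B.
  cbv beta in B. rewrite Cmult_0_l, Cexp_0 in B.
  replace (Cexp z - 1 - z)%C with (Cexp (1 * z) - 1 * z - (1 - 0))%C
    by (rewrite Cmult_1_l; ring).
  eapply Rle_trans; [apply B|lra].
  - intros t _. apply rder_minus; [apply rder_Cexp, Hlin|apply Hlin].
  - intros t Ht. replace (_ - _)%C with (z * (Cexp (RtoC t * z) - 1))%C by ring.
    rewrite Cmod_mult. specialize (H1 t Ht). pose proof (Cmod_ge_0 z); nra.
Qed.

Lemma cder_Cexp (u : C) : cder Cexp u (Cexp u).
Proof.
  exists 1, (3 * Cmod (Cexp u)).
  pose proof (Cmod_ge_0 (Cexp u)).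
  repeat split; try lra. intros h Hh.
  rewrite Cexp_plus.
  replace (_ - _ - _)%C with (Cexp u * (Cexp h - 1 - h))%C by ring.
  rewrite Cmod_mult. pose proof (Cexp_quad h ltac:(lra)); nra.
Qed.

Lemma cder_inv (f : C -> C) (u l : C) : f u <> 0 ->
  cder f u l -> cder (fun v => / f v)%C u (- (l * (/ f u) * (/ f u)))%C.
Proof.
  intros Hf0 Hf.
  assert (P : cder (fun v => / v)%C (f u) (- (/ f u * / f u))%C).
  { set (w := f u) in *.
    assert (Hw : 0 < Cmod w) by now apply Cmod_gt_0.
    (* The remainder of the inverse is exactly [h^2 / ((w + h) w^2)], and [|w + h| >= |w| / 2] in
       this disc. *)
    exists (Cmod w / 2), (2 / Cmod w ^ 3).
    split; [lra|split; [apply Rlt_le, Rdiv_lt_0_compat; [lra|apply pow_lt; lra]|]].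
    intros h Hh.
    assert (Hwh : Cmod w / 2 <= Cmod (w + h)%C).
    { assert (T := Cmod_triangle (w + h)%C (- h)%C).
      replace (w + h + - h)%C with w in T by ring. rewrite Cmod_opp in T. lra. }
    assert (N : (w + h)%C <> 0) by (apply Cmod_gt_0; lra).
    replace (/ (w + h) - / w - - (/ w * / w) * h)%C with (h * h / ((w + h) * (w * w)))%C
      by (field; split; [exact Hf0 | exact N]).
    rewrite Cmod_div, !Cmod_mult by (repeat apply Cmult_neq_0; assumption).
    apply Rle_trans with (Cmod h * Cmod h / (Cmod w / 2 * (Cmod w * Cmod w))).
    - apply Rmult_le_compat_l; [pose proof (Cmod_ge_0 h); nra|].
      apply Rinv_le_contravar; [repeat apply Rmult_lt_0_compat; lra|].
      apply Rmult_le_compat_r; nra.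
    - apply Req_le; field; lra. }
  eapply cder_eq; [apply (cder_comp (fun v => / v)%C f); eassumption|ring].
Qed.

(** * Integrals of complex-valued functions *)

Definition ccont (f : R -> C) (x : R) : Prop :=
  continuous (fun t => Re (f t)) x /\ continuous (fun t => Im (f t)) x.

Definition CInt (f : R -> C) (a b : R) : C :=
  (RInt (fun t => Re (f t)) a b, RInt (fun t => Im (f t)) a b).

Lemma rder_ccont (f : R -> C) (x : R) (l : C) : rder f x l -> ccont f x.
Proof. intros [H1 H2]; split; apply @ex_derive_continuous; eexists; eassumption. Qed.

Section Interval.
Context (f g : R -> C) (a b : R).
Context (Hab : a <= b) (Hf : forall x, a <= x <= b -> ccont f x).

Lemma ccont_ex_RInt_re : ex_RInt (fun t => Re (f t)) a b.
Proof.
  apply (ex_RInt_continuous (V := R_CompleteNormedModule)).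
  rewrite Rmin_left, Rmax_right by lra. intros; now apply Hf.
Qed.

Lemma ccont_ex_RInt_im : ex_RInt (fun t => Im (f t)) a b.
Proof.
  apply (ex_RInt_continuous (V := R_CompleteNormedModule)).
  rewrite Rmin_left, Rmax_right by lra. intros; now apply Hf.
Qed.

Lemma CInt_ext : (forall x, a <= x <= b -> f x = g x) -> CInt f a b = CInt g a b.
Proof.
  intros H; unfold CInt; f_equal; apply RInt_ext;
    rewrite Rmin_left, Rmax_right by lra; intros; rewrite H; auto; lra.
Qed.

Lemma CInt_scal (c : C) : CInt (fun t => c * f t)%C a b = (c * CInt f a b)%C.
Proof.
  pose proof ccont_ex_RInt_re as E1; pose proof ccont_ex_RInt_im as E2.
  unfold CInt; apply injective_projections; simpl.
  - transitivity (RInt (fun t => minus (scal (Re c) (Re (f t))) (scal (Im c) (Im (f t)))) a b).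
    { reflexivity. }
    rewrite (RInt_minus (V := R_CompleteNormedModule)); [|now apply @ex_RInt_scal..].
    rewrite !(RInt_scal (V := R_CompleteNormedModule)) by assumption. reflexivity.
  - transitivity (RInt (fun t => plus (scal (Re c) (Im (f t))) (scal (Im c) (Re (f t)))) a b).
    { reflexivity. }
    rewrite (RInt_plus (V := R_CompleteNormedModule)); [|now apply @ex_RInt_scal..].
    rewrite !(RInt_scal (V := R_CompleteNormedModule)) by assumption. reflexivity.
Qed.

(** Pairing with the conjugate of the value of the integral reduces the claim to one real
    inequality, without the loss of a factor that separate bounds of the two components would
    cause. *)
Lemma CInt_bound (h : R -> R) (lh : R) :
  (forall x, a <= x <= b -> Cmod (f x) <= h x) -> is_RInt h a b lh ->
  Cmod (CInt f a b) <= lh.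
Proof.
  intros Hh Ih.
  pose proof ccont_ex_RInt_re as E1; pose proof ccont_ex_RInt_im as E2.
  set (z := CInt f a b).
  assert (Hsq : Cmod z ^ 2 <= Cmod z * lh).
  { rewrite Cmod2_alt.
    apply (is_RInt_le (fun t => plus (scal (Re z) (Re (f t))) (scal (Im z) (Im (f t))))
             (fun t => scal (Cmod z) (h t)) a b); [exact Hab| | |].
    - replace (Re z ^ 2 + Im z ^ 2) with (plus (scal (Re z) (Re z)) (scal (Im z) (Im z)))
        by (unfold plus, scal; simpl; unfold mult; simpl; ring).
      apply @is_RInt_plus; apply @is_RInt_scal;
        apply (RInt_correct (V := R_CompleteNormedModule)); assumption.
    - apply @is_RInt_scal; exact Ih.
    - intros x Hx.
      replace (plus _ _) with (Re (Cconj z * f x)%C)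
        by (unfold plus, scal, Re, Im; simpl; unfold mult; simpl; unfold Re, Im; ring).
      eapply Rle_trans; [apply Rle_abs|]. eapply Rle_trans; [apply re_le_Cmod|].
      rewrite Cmod_mult, Cmod_conj. apply Rmult_le_compat_l; [apply Cmod_ge_0|apply Hh; lra]. }
  pose proof (Cmod_ge_0 z) as Hz.
  destruct (Req_dec (Cmod z) 0) as [H0|H0].
  - rewrite H0.
    assert (Hc : is_RInt (fun _ => 0) a b (scal (b - a) 0)) by apply (is_RInt_const (V := R_NormedModule)).
    replace (scal (b - a) 0) with 0 in Hc by (unfold scal; simpl; unfold mult; simpl; ring).
    eapply is_RInt_le; [exact Hab|exact Hc|exact Ih|].
    intros x Hx; cbv beta. eapply Rle_trans; [apply Cmod_ge_0|apply Hh; lra].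
  - apply Rmult_le_reg_l with (Cmod z); [lra|]. lra.
Qed.

Lemma CInt_FTC : (forall x, a <= x <= b -> rder g x (f x)) -> CInt f a b = (g b - g a)%C.
Proof.
  intros Hg. unfold CInt; apply injective_projections; simpl;
    apply (is_RInt_unique (V := R_CompleteNormedModule)).
  - apply (is_RInt_derive (fun t => Re (g t)) (fun t => Re (f t)));
      rewrite Rmin_left, Rmax_right by lra; intros; [now apply Hg|now apply Hf].
  - apply (is_RInt_derive (fun t => Im (g t)) (fun t => Im (f t)));
      rewrite Rmin_left, Rmax_right by lra; intros; [now apply Hg|now apply Hf].
Qed.

Lemma CInt_is_RInt : is_RInt (V := C_R_NormedModule) f a b (CInt f a b).
Proof.
  apply (is_RInt_fct_extend_pair (U := R_NormedModule) (V := R_NormedModule));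
    apply (RInt_correct (V := R_CompleteNormedModule));
    [apply ccont_ex_RInt_re|apply ccont_ex_RInt_im].
Qed.

End Interval.

Lemma CInt_plus (f g : R -> C) (a b : R) : a <= b ->
  (forall x, a <= x <= b -> ccont f x) -> (forall x, a <= x <= b -> ccont g x) ->
  CInt (fun t => f t + g t)%C a b = (CInt f a b + CInt g a b)%C.
Proof.
  intros Hab Hf Hg. unfold CInt; apply injective_projections; simpl.
  - apply (RInt_plus (V := R_CompleteNormedModule)); now apply ccont_ex_RInt_re.
  - apply (RInt_plus (V := R_CompleteNormedModule)); now apply ccont_ex_RInt_im.
Qed.

Lemma CInt_Chasles (f : R -> C) (a b c : R) : a <= b -> b <= c ->
  (forall x, a <= x <= c -> ccont f x) ->
  (CInt f a b + CInt f b c)%C = CInt f a c.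
Proof.
  intros Hab Hbc Hf. unfold CInt; apply injective_projections; simpl;
    apply (RInt_Chasles (V := R_CompleteNormedModule)).
  - apply ccont_ex_RInt_re; [lra|intros; apply Hf; lra].
  - apply ccont_ex_RInt_re; [lra|intros; apply Hf; lra].
  - apply ccont_ex_RInt_im; [lra|intros; apply Hf; lra].
  - apply ccont_ex_RInt_im; [lra|intros; apply Hf; lra].
Qed.

Lemma ccont_const (c : C) (x : R) : ccont (fun _ => c) x.
Proof. eapply rder_ccont, rder_const. Qed.

Lemma ccont_plus (f g : R -> C) (x : R) :
  ccont f x -> ccont g x -> ccont (fun t => f t + g t)%C x.
Proof.
  intros [H1 H2] [H3 H4]; split; simpl;
    now apply (continuous_plus (V := R_NormedModule)).
Qed.

Lemma ccont_mult (f g : R -> C) (x : R) :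
  ccont f x -> ccont g x -> ccont (fun t => f t * g t)%C x.
Proof.
  intros [H1 H2] [H3 H4]; split; simpl.
  - apply (continuous_minus (V := R_NormedModule)); now apply (continuous_mult (K := R_AbsRing)).
  - apply (continuous_plus (V := R_NormedModule)); now apply (continuous_mult (K := R_AbsRing)).
Qed.

Lemma ccont_opp (f : R -> C) (x : R) : ccont f x -> ccont (fun t => - f t)%C x.
Proof. intros [H1 H2]; split; simpl; now apply (continuous_opp (V := R_NormedModule)). Qed.

Lemma ccont_minus (f g : R -> C) (x : R) :
  ccont f x -> ccont g x -> ccont (fun t => f t - g t)%C x.
Proof. intros; apply ccont_plus; [|apply ccont_opp]; assumption. Qed.

Ltac ccont_tac := repeat match goal with
  | H : forall x, ccont ?f x |- ccont ?g ?y => first [constr_eq f g | constr_eq (fun x : R => f x) g]; exact (H y)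
  | |- ccont (fun _ => ?c) _ => exact (ccont_const c _)
  | |- ccont (fun x => Cplus (@?f x) (@?g x)) ?y => apply (ccont_plus f g y)
  | |- ccont (fun x => Cminus (@?f x) (@?g x)) ?y => apply (ccont_minus f g y)
  | |- ccont (fun x => Copp (@?f x)) ?y => apply (ccont_opp f y)
  | |- ccont (fun x => Cmult (@?f x) (@?g x)) ?y => apply (ccont_mult f g y)
  end.

(** * Joint continuity, differentiation under the integral sign, Cauchy's theorem *)

Definition cc2 (f : R -> R -> C) (x y : R) : Prop :=
  continuity_2d_pt (fun u v => Re (f u v)) x y /\ continuity_2d_pt (fun u v => Im (f u v)) x y.

Lemma cc2_const (c : C) (x y : R) : cc2 (fun _ _ => c) x y.
Proof. split; apply continuity_2d_pt_const. Qed.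

Lemma cc2_plus (f g : R -> R -> C) (x y : R) :
  cc2 f x y -> cc2 g x y -> cc2 (fun u v => f u v + g u v)%C x y.
Proof. intros [H1 H2] [H3 H4]; split; simpl; now apply continuity_2d_pt_plus. Qed.

Lemma cc2_opp (f : R -> R -> C) (x y : R) : cc2 f x y -> cc2 (fun u v => - f u v)%C x y.
Proof. intros [H1 H2]; split; simpl; now apply continuity_2d_pt_opp. Qed.

Lemma cc2_minus (f g : R -> R -> C) (x y : R) :
  cc2 f x y -> cc2 g x y -> cc2 (fun u v => f u v - g u v)%C x y.
Proof. intros; apply cc2_plus; [|apply cc2_opp]; assumption. Qed.

Lemma cc2_mult (f g : R -> R -> C) (x y : R) :
  cc2 f x y -> cc2 g x y -> cc2 (fun u v => f u v * g u v)%C x y.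
Proof.
  intros [H1 H2] [H3 H4]; split; simpl.
  - apply continuity_2d_pt_minus; now apply continuity_2d_pt_mult.
  - apply continuity_2d_pt_plus; now apply continuity_2d_pt_mult.
Qed.

Lemma cc2_fst (f : R -> R) (x y l : R) : is_derive f x l -> cc2 (fun u _ => RtoC (f u)) x y.
Proof.
  intros H; split; simpl; [|apply continuity_2d_pt_const].
  apply (continuity_1d_2d_pt_comp f (fun u _ => u)); [|apply continuity_2d_pt_id1].
  apply continuity_pt_filterlim, @ex_derive_continuous; eexists; exact H.
Qed.

Lemma cc2_snd (x y : R) : cc2 (fun _ v => RtoC v) x y.
Proof. split; simpl; [apply continuity_2d_pt_id2|apply continuity_2d_pt_const]. Qed.

Lemma cc2_cder (F : C -> C) (g : R -> R -> C) (x y : R) (l : C) :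
  cder F (g x y) l -> cc2 g x y -> cc2 (fun u v => F (g u v)) x y.
Proof.
  intros HF [H1 H2]. destruct (cder_lip _ _ _ HF) as (d & K & Hd & HK & H).
  assert (Q : forall eps : posreal, exists de : posreal, forall u v,
    Rabs (u - x) < de -> Rabs (v - y) < de -> Cmod (F (g u v) - F (g x y))%C < eps).
  { intros eps.
    set (e := Rmin (d / 2) (eps / (2 * (K + 1)))).
    assert (He : 0 < e).
    { apply Rmin_glb_lt; [lra|]. apply Rdiv_lt_0_compat; [apply eps|lra]. }
    assert (He2 : 0 < e / 2) by lra.
    destruct (H1 (mkposreal _ He2)) as [d1 h1], (H2 (mkposreal _ He2)) as [d2 h2].
    assert (Hm : 0 < Rmin d1 d2) by (apply Rmin_glb_lt; [apply d1|apply d2]).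
    exists (mkposreal _ Hm). simpl. intros u v Hu Hv.
    specialize (h1 u v (Rlt_le_trans _ _ _ Hu (Rmin_l _ _)) (Rlt_le_trans _ _ _ Hv (Rmin_l _ _))).
    specialize (h2 u v (Rlt_le_trans _ _ _ Hu (Rmin_r _ _)) (Rlt_le_trans _ _ _ Hv (Rmin_r _ _))).
    simpl in h1, h2.
    assert (Hk : Cmod (g u v - g x y)%C < e).
    { eapply Rle_lt_trans; [apply Cmod_le_re_im|].
      simpl; unfold Re, Im in *; unfold Rminus in *; lra. }
    assert (e <= d / 2) by apply Rmin_l.
    assert (E2 : e <= eps / (2 * (K + 1))) by apply Rmin_r.
    specialize (H (g u v - g x y)%C ltac:(lra)).
    replace (g x y + (g u v - g x y))%C with (g u v) in H by ring.
    eapply Rle_lt_trans; [exact H|].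
    apply Rle_lt_trans with ((K + 1) * (eps / (2 * (K + 1)))).
    - apply Rmult_le_compat; try lra; apply Cmod_ge_0.
    - replace ((K + 1) * (eps / (2 * (K + 1)))) with (eps / 2) by (field; lra).
      pose proof (cond_pos eps); lra. }
  split; intros eps; destruct (Q eps) as [de Hde]; exists de; intros u v Hu Hv;
    specialize (Hde u v Hu Hv); eapply Rle_lt_trans; try exact Hde.
  - apply (re_le_Cmod (F (g u v) - F (g x y))%C).
  - apply (im_le_Cmod (F (g u v) - F (g x y))%C).
Qed.

Lemma CInt_param (f df : R -> R -> C) (a b x0 d : R) : a <= b -> 0 < d ->
  (forall x t, Rabs (x - x0) < d -> rder (fun x => f x t) x (df x t)) ->
  (forall x t, Rabs (x - x0) < d -> ccont (f x) t) ->
  (forall t, cc2 df x0 t) ->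
  rder (fun x => CInt (f x) a b) x0 (CInt (df x0) a b).
Proof.
  intros Hab Hd Hder Hc H2.
  assert (Gen : forall pr : C -> R,
    (forall x t, Rabs (x - x0) < d -> is_derive (fun x => pr (f x t)) x (pr (df x t))) ->
    (forall x t, Rabs (x - x0) < d -> continuous (fun t => pr (f x t)) t) ->
    (forall t, continuity_2d_pt (fun u v => pr (df u v)) x0 t) ->
    is_derive (fun x => RInt (fun t => pr (f x t)) a b) x0 (RInt (fun t => pr (df x0 t)) a b)).
  { intros pr G1 G2 G3.
    evar_last.
    - apply is_derive_RInt_param.
      + exists (mkposreal _ Hd). intros x Hx t _. eexists; apply G1; exact Hx.
      + intros t _.
        apply (continuity_2d_pt_ext_loc (fun u v => pr (df u v))); [|apply G3].
        exists (mkposreal _ Hd). intros u v Hu Hv. symmetry. apply is_derive_unique, G1, Hu.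
      + exists (mkposreal _ Hd). intros x Hx.
        apply (ex_RInt_continuous (V := R_CompleteNormedModule)). intros t _. now apply G2.
    - apply RInt_ext. intros t _. apply is_derive_unique, G1.
      rewrite Rminus_diag, Rabs_R0; exact Hd. }
  split; simpl.
  - apply (Gen Re); intros; [now apply Hder|now apply Hc|apply H2].
  - apply (Gen Im); intros; [now apply Hder|now apply Hc|apply H2].
Qed.

Lemma ccont_cder_line (G : C -> C) (c : C) (x : R) (l : C) :
  cder G (RtoC x + c)%C l -> ccont (fun t => G (RtoC t + c)%C) x.
Proof.
  intros H. eapply rder_ccont, (rder_cder G (fun t => RtoC t + c)%C); [exact H|].
  apply rder_plus; [apply rder_id|apply rder_const].
Qed.

(* Cauchy's theorem on a rectangle: the derivative of the integral with respect to the
   height [h] of the line consists of the two end point values of [G]. *)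
Lemma rectangle (G G' : C -> C) (N h0 h1 lg : R) (g : R -> R) :
  0 < N -> h0 <= h1 ->
  (forall z, cder G z (G' z)) -> (forall z, exists l, cder G' z l) ->
  (forall h, h0 <= h <= h1 ->
     Cmod (G (RtoC N + Ci * RtoC h)%C) <= g h /\ Cmod (G (RtoC (- N) + Ci * RtoC h)%C) <= g h) ->
  is_RInt g h0 h1 lg ->
  Cmod (CInt (fun t => G (RtoC t + Ci * RtoC h1)%C) (- N) N -
        CInt (fun t => G (RtoC t + Ci * RtoC h0)%C) (- N) N)%C <= 2 * lg.
Proof.
  intros HN Hh HG HG' Hg Ig.
  set (J := fun h => CInt (fun t => G (RtoC t + Ci * RtoC h)%C) (- N) N).
  assert (Hv : forall (z : C) (h : R), rder (fun h => G (z + Ci * RtoC h)%C) h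
                 (G' (z + Ci * RtoC h) * Ci)%C).
  { intros z h. apply (rder_cder G (fun h => z + Ci * RtoC h)%C); [apply HG|].
    eapply rder_eq; [apply rder_plus; [apply rder_const|
      apply rder_mult; [apply rder_const|apply rder_id]]|cbv beta; ring]. }
  assert (HJ : forall h, rder J h
     (Ci * (G (RtoC N + Ci * RtoC h) - G (RtoC (- N) + Ci * RtoC h)))%C).
  { intros h.
    pose proof (CInt_param (fun h t => G (RtoC t + Ci * RtoC h)%C)
      (fun h t => G' (RtoC t + Ci * RtoC h) * Ci)%C (- N) N h 1 ltac:(lra) ltac:(lra)) as P.
    eapply rder_eq; [apply P|].
    - intros; apply Hv.
    - intros x t _. eapply ccont_cder_line, HG.
    - intros t. apply cc2_mult; [|apply cc2_const].
      destruct (HG' (RtoC t + Ci * RtoC h)%C) as [l Hl].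
      apply (cc2_cder G' (fun h t => RtoC t + Ci * RtoC h)%C _ _ l Hl).
      apply cc2_plus; [apply cc2_snd|apply cc2_mult; [apply cc2_const|]].
      apply (cc2_fst (fun u => u) _ _ 1), @is_derive_id.
    - rewrite (CInt_FTC _ (fun t => Ci * G (RtoC t + Ci * RtoC h))%C); [ring|lra| |].
      + intros t _. apply ccont_mult; [|apply ccont_const].
        destruct (HG' (RtoC t + Ci * RtoC h)%C) as [l Hl].
        eapply ccont_cder_line, Hl.
      + intros t _. eapply rder_eq.
        * apply rder_mult; [apply rder_const|].
          apply (rder_cder G (fun t => RtoC t + Ci * RtoC h)%C); [apply HG|].
          apply rder_plus; [apply rder_id|apply rder_const].
        * cbv beta; ring. }
  fold (J h1); fold (J h0).
  assert (Hcont : forall h, ccont (fun h =>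
     Ci * (G (RtoC N + Ci * RtoC h) - G (RtoC (- N) + Ci * RtoC h)))%C h).
  { intros h. apply ccont_mult; [apply ccont_const|].
    apply ccont_minus; eapply rder_ccont, Hv. }
  rewrite <- (CInt_FTC _ J h0 h1 Hh (fun h _ => Hcont h)) by (intros; apply HJ).
  eapply (CInt_bound _ h0 h1 Hh (fun h _ => Hcont h) (fun h => scal 2 (g h))).
  - intros h Hh'. destruct (Hg h Hh') as [B1 B2].
    rewrite Cmod_mult, Cmod_Ci, Rmult_1_l.
    eapply Rle_trans; [apply Cmod_le_minus; eassumption|].
    unfold scal; simpl; unfold mult; simpl; lra.
  - apply (is_RInt_scal (V := R_NormedModule)); exact Ig.
Qed.

(** Symmetric truncation leaves one parameter [N] for following end-point terms, and it covers
    integrands that are not absolutely integrable, such as that of [Ai] on the real line. The link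
    to [RInt_gen] is made in [dominated_clim] and [airy_rep]. *)
Definition clim (f : R -> C) (L : C) : Prop :=
  forall eps, 0 < eps -> exists N0, forall N, N0 <= N -> Cmod (CInt f (- N) N - L)%C <= eps.

Lemma Cmod_eq_of_small (z w : C) : (forall eps, 0 < eps -> Cmod (z - w)%C <= eps) -> z = w.
Proof.
  intros H.
  assert (E : (z - w)%C = 0).
  { apply Cmod_eq_0. pose proof (Cmod_ge_0 (z - w)%C).
    destruct (Req_dec (Cmod (z - w)%C) 0) as [?|n]; [assumption|].
    specialize (H (Cmod (z - w)%C / 2) ltac:(lra)). lra. }
  replace z with (z - w + w)%C by ring. rewrite E; ring.
Qed.

Lemma clim_unique (f : R -> C) (L L' : C) : clim f L -> clim f L' -> L = L'.
Proof.
  intros H H'. apply Cmod_eq_of_small. intros eps He.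
  destruct (H (eps / 2) ltac:(lra)) as [N1 h1], (H' (eps / 2) ltac:(lra)) as [N2 h2].
  specialize (h1 (Rmax N1 N2) (Rmax_l _ _)). specialize (h2 (Rmax N1 N2) (Rmax_r _ _)).
  set (I := CInt f _ _) in *.
  replace (L - L')%C with ((I - L') - (I - L))%C by ring.
  replace eps with (eps / 2 + eps / 2) by field. now apply Cmod_le_minus.
Qed.

Lemma clim_bound (f : R -> C) (L : C) (K : R) : clim f L ->
  (forall N, 0 < N -> Cmod (CInt f (- N) N) <= K) -> Cmod L <= K.
Proof.
  intros H HK. apply le_epsilon. intros eps He.
  destruct (H eps He) as [N0 h].
  specialize (h (Rmax N0 1) (Rmax_l _ _)).
  specialize (HK (Rmax N0 1) ltac:(pose proof (Rmax_r N0 1); lra)).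
  set (I := CInt f _ _) in *.
  replace L with (I - (I - L))%C by ring. now apply Cmod_le_minus.
Qed.

Lemma clim_scal (f : R -> C) (c L : C) : (forall x, ccont f x) ->
  clim f L -> clim (fun t => c * f t)%C (c * L)%C.
Proof.
  intros Hc H eps He.
  assert (Hp : 0 < Cmod c + 1) by (pose proof (Cmod_ge_0 c); lra).
  destruct (H (eps / (Cmod c + 1))) as [N0 h]; [now apply Rdiv_lt_0_compat|].
  exists (Rmax N0 0). intros N HN.
  pose proof (Rmax_l N0 0); pose proof (Rmax_r N0 0).
  rewrite CInt_scal by (lra || auto).
  replace (_ - _)%C with (c * (CInt f (- N) N - L))%C by ring.
  rewrite Cmod_mult.
  apply Rle_trans with ((Cmod c + 1) * (eps / (Cmod c + 1))).
  - apply Rmult_le_compat; try apply Cmod_ge_0; [lra|apply h; lra].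
  - apply Req_le; field; lra.
Qed.

Lemma clim_plus (f g : R -> C) (L M : C) :
  (forall x, ccont f x) -> (forall x, ccont g x) ->
  clim f L -> clim g M -> clim (fun t => f t + g t)%C (L + M)%C.
Proof.
  intros Hf Hg H H' eps He.
  destruct (H (eps / 2) ltac:(lra)) as [N1 h1], (H' (eps / 2) ltac:(lra)) as [N2 h2].
  exists (Rmax (Rmax N1 N2) 0). intros N HN.
  pose proof (Rmax_l (Rmax N1 N2) 0); pose proof (Rmax_r (Rmax N1 N2) 0).
  pose proof (Rmax_l N1 N2); pose proof (Rmax_r N1 N2).
  rewrite CInt_plus by (lra || auto).
  replace (_ - _)%C with ((CInt f (- N) N - L) + (CInt g (- N) N - M))%C by ring.
  replace eps with (eps / 2 + eps / 2) by field.
  apply Cmod_le_plus; [apply h1|apply h2]; lra.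
Qed.

Lemma clim_ext (f g : R -> C) (L : C) : (forall x, f x = g x) -> clim f L -> clim g L.
Proof.
  intros He H eps Hp. destruct (H eps Hp) as [N0 h]. exists N0. intros N HN.
  replace (CInt g (- N) N) with (CInt f (- N) N); [now apply h|].
  unfold CInt; f_equal; apply RInt_ext; intros; now rewrite He.
Qed.

(** Serves whenever two truncated integrals differ by end-point contributions only: the vertical
    sides of a rectangle when a contour is shifted, or the end values of a primitive. *)
Lemma clim_close (f g : R -> C) (L : C) (K N1 : R) : 0 <= K ->
  (forall N, N1 <= N -> Cmod (CInt g (- N) N - CInt f (- N) N)%C <= K / N) ->
  clim f L -> clim g L.
Proof.
  intros HK Hc H eps He. destruct (H (eps / 2) ltac:(lra)) as [N0 h].
  exists (Rmax (Rmax N0 N1) (2 * (K + 1) / eps)). intros N HN.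
  pose proof (Rmax_l (Rmax N0 N1) (2 * (K + 1) / eps));
  pose proof (Rmax_r (Rmax N0 N1) (2 * (K + 1) / eps)).
  pose proof (Rmax_l N0 N1); pose proof (Rmax_r N0 N1).
  assert (Hp : 0 < 2 * (K + 1) / eps) by (apply Rdiv_lt_0_compat; lra).
  replace (_ - _)%C with ((CInt g (- N) N - CInt f (- N) N) + (CInt f (- N) N - L))%C by ring.
  replace eps with (eps / 2 + eps / 2) by field.
  apply Cmod_le_plus; [|apply h; lra].
  eapply Rle_trans; [apply Hc; lra|].
  apply Rle_div_l; [lra|].
  apply Rle_trans with (eps / 2 * (2 * (K + 1) / eps)); [|apply Rmult_le_compat_l; lra].
  replace (eps / 2 * (2 * (K + 1) / eps)) with (K + 1) by (field; lra). lra.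
Qed.

(** Gaussian majorants are weakened to this profile throughout: its primitive is an arctangent, and
    the factor [1 / sqrt A] has the same order as the integral of [exp (- A x^2)]. *)
Lemma is_RInt_lorentz (A B N : R) : 0 < A -> 0 <= B -> 0 < N ->
  exists l, is_RInt (fun x => B / (1 + A * x ^ 2)) (- N) N l /\ l <= B * PI / sqrt A.
Proof.
  intros HA HB HN.
  assert (Hs : 0 < sqrt A) by now apply sqrt_lt_R0.
  assert (Hss : sqrt A * sqrt A = A) by (apply sqrt_sqrt; lra).
  eexists; split.
  - apply (is_RInt_derive (fun x => B / sqrt A * atan (sqrt A * x))).
    + intros x _. auto_derive; [exact I|].
      replace (1 + sqrt A * x * (sqrt A * x * 1)) with (1 + A * x ^ 2)
        by (rewrite <- Hss at 1; ring).
      field. split; nra.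
    + intros x _. apply @ex_derive_continuous. auto_derive. nra.
  - unfold minus, plus, opp; simpl.
    pose proof (atan_bound (sqrt A * N)); pose proof (atan_bound (sqrt A * - N)).
    replace (B * PI / sqrt A) with (B / sqrt A * PI) by (field; lra).
    assert (0 <= B / sqrt A) by (apply Rmult_le_pos; [lra|apply Rlt_le, Rinv_0_lt_compat; lra]).
    nra.
Qed.

Lemma CInt_lorentz (f : R -> C) (A B N : R) : 0 < A -> 0 < N ->
  (forall x, ccont f x) -> (forall x, Cmod (f x) <= B / (1 + A * x ^ 2)) ->
  Cmod (CInt f (- N) N) <= B * PI / sqrt A.
Proof.
  intros HA HN Hc Hb.
  assert (HB : 0 <= B).
  { specialize (Hb 0). pose proof (Cmod_ge_0 (f 0)).
    replace (B / (1 + A * 0 ^ 2)) with B in Hb by field. lra. }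
  destruct (is_RInt_lorentz A B N HA HB HN) as (l & Hl & Hle).
  eapply Rle_trans; [|exact Hle].
  eapply CInt_bound; [lra|intros; apply Hc|intros; apply Hb|exact Hl].
Qed.

Lemma CInt_tail (f : R -> C) (B x y : R) : (forall t, ccont f t) ->
  (forall t, Cmod (f t) <= B / (1 + t ^ 2)) -> x <= y -> 0 < x \/ y < 0 ->
  Cmod (CInt f x y) <= B * (/ x - / y).
Proof.
  intros Hc Hb Hxy H0.
  assert (HB : 0 <= B).
  { specialize (Hb 0). pose proof (Cmod_ge_0 (f 0)).
    replace (B / (1 + 0 ^ 2)) with B in Hb by field. lra. }
  eapply (CInt_bound f x y Hxy (fun t _ => Hc t) (fun t => B / t ^ 2)).
  - intros t Ht. eapply Rle_trans; [apply Hb|].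
    apply Rmult_le_compat_l; [exact HB|]. apply Rinv_le_contravar; nra.
  - replace (B * (/ x - / y)) with (minus (- (B / y)) (- (B / x)))
      by (unfold minus, plus, opp; simpl; unfold Rdiv; ring).
    apply (is_RInt_derive (fun t => - (B / t))); rewrite Rmin_left, Rmax_right by lra.
    + intros t Ht. auto_derive; [lra|]. field; lra.
    + intros t Ht. apply @ex_derive_continuous. auto_derive. nra.
Qed.

(** The symmetric limit serves the estimates; the two-sided improper integral, with the same value,
    identifies [BesselK]. *)
Lemma dominated_clim (f : R -> C) (B : R) : (forall t, ccont f t) ->
  (forall t, Cmod (f t) <= B / (1 + t ^ 2)) ->
  exists L, clim f L /\
    is_RInt_gen (V := C_R_NormedModule) f (Rbar_locally m_infty) (Rbar_locally p_infty) L.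
Proof.
  intros Hc Hb.
  assert (HB : 0 <= B).
  { specialize (Hb 0). pose proof (Cmod_ge_0 (f 0)).
    replace (B / (1 + 0 ^ 2)) with B in Hb by field. lra. }
  assert (Hdiff : forall N a b, 0 < N -> a <= - N -> N <= b ->
            Cmod (CInt f a b - CInt f (- N) N)%C <= 2 * B / N).
  { intros N a b HN Ha Hbb.
    rewrite <- (CInt_Chasles f a (- N) b), <- (CInt_Chasles f (- N) N b) by (lra || auto).
    replace (_ - _)%C with (CInt f a (- N) + CInt f N b)%C by ring.
    replace (2 * B / N) with (B / N + B / N) by (field; lra).
    apply Cmod_le_plus.
    - eapply Rle_trans; [apply (CInt_tail f B); auto; lra|].
      assert (0 <= / (- a)) by (apply Rlt_le, Rinv_0_lt_compat; lra).
      replace (/ a - / - N) with (/ N - / (- a)) by (field; lra).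
      unfold Rdiv; nra.
    - eapply Rle_trans; [apply (CInt_tail f B); auto; lra|].
      assert (0 <= / b) by (apply Rlt_le, Rinv_0_lt_compat; lra).
      unfold Rdiv; nra. }
  assert (Hlim : forall pr : C -> R, (forall z w, pr z - pr w = pr (z - w)%C) ->
    (forall z, Rabs (pr z) <= Cmod z) ->
    exists l, filterlim (fun N => pr (CInt f (- N) N)) (Rbar_locally p_infty) (locally l)).
  { intros pr Hlin Hle. apply (filterlim_locally_cauchy (U := R_CompleteSpace)).
    intros eps. pose proof (cond_pos eps) as He.
    set (N0 := (2 * (2 * B + 1) / eps)).
    assert (HN0 : 0 < N0) by (apply Rdiv_lt_0_compat; lra).
    exists (fun N => N0 < N). split; [now exists N0|].
    assert (Hs : 2 * B / N0 < eps / 2).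
    { apply Rlt_div_l; [lra|]. unfold N0. replace (eps / 2 * _) with (2 * B + 1) by (field; lra). lra. }
    intros u v Hu Hv.
    change (Rabs (pr (CInt f (- v) v) - pr (CInt f (- u) u)) < eps).
    rewrite Hlin. eapply Rle_lt_trans; [apply Hle|].
    pose proof (Hdiff N0 (- u) u HN0 ltac:(lra) ltac:(lra)).
    pose proof (Hdiff N0 (- v) v HN0 ltac:(lra) ltac:(lra)).
    replace (CInt f (- v) v - CInt f (- u) u)%C with ((CInt f (- v) v - CInt f (- N0) N0)
       - (CInt f (- u) u - CInt f (- N0) N0))%C by ring.
    eapply Rle_lt_trans; [apply Cmod_le_minus; eassumption|]. lra. }
  destruct (Hlim Re) as [l1 H1]; [reflexivity|apply re_le_Cmod|].
  destruct (Hlim Im) as [l2 H2]; [reflexivity|apply im_le_Cmod|].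
  assert (HL : clim f (l1, l2)).
  { intros eps He. assert (He2 : 0 < eps / 2) by lra.
    destruct (proj1 (filterlim_locally _ _) H1 (mkposreal _ He2)) as [M1 h1].
    destruct (proj1 (filterlim_locally _ _) H2 (mkposreal _ He2)) as [M2 h2].
    exists (Rmax M1 M2 + 1). intros N HN.
    pose proof (Rmax_l M1 M2); pose proof (Rmax_r M1 M2).
    specialize (h1 N ltac:(lra)). specialize (h2 N ltac:(lra)).
    eapply Rle_trans; [apply Cmod_le_re_im|].
    replace eps with (eps / 2 + eps / 2) by field.
    apply Rplus_le_compat; apply Rlt_le; [exact h1|exact h2]. }
  exists (l1, l2); split; [exact HL|].
  intros P [eps HP]. pose proof (cond_pos eps) as He.
  destruct (HL (eps / 4) ltac:(lra)) as [N0 h0].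
  set (N := Rmax (Rmax N0 1) (8 * (B + 1) / eps)).
  assert (HN1 : N0 <= N) by (eapply Rle_trans; [apply Rmax_l|apply Rmax_l]).
  assert (HN2 : 1 <= N) by (eapply Rle_trans; [apply Rmax_r|apply Rmax_l]).
  assert (HN3 : 8 * (B + 1) / eps <= N) by apply Rmax_r.
  assert (Hs : 2 * B / N < eps / 2).
  { apply Rlt_div_l; [lra|].
    apply Rlt_le_trans with (eps / 2 * (8 * (B + 1) / eps)); [|apply Rmult_le_compat_l; lra].
    replace (eps / 2 * (8 * (B + 1) / eps)) with (4 * (B + 1)) by (field; lra). lra. }
  exists (fun a => a < - N) (fun b => N < b); [now exists (- N)|now exists N|].
  intros a b Ha Hbb. exists (CInt f a b); split.
  - apply CInt_is_RInt; [simpl; lra|auto].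
  - apply HP.
    assert (Hd := Hdiff N a b ltac:(lra) ltac:(lra) ltac:(lra)).
    specialize (h0 N HN1).
    assert (T : Cmod (CInt f a b - (l1, l2))%C < eps).
    { replace (_ - _)%C with ((CInt f a b - CInt f (- N) N) + (CInt f (- N) N - (l1, l2)))%C by ring.
      eapply Rle_lt_trans; [apply Cmod_le_plus; eassumption|]. lra. }
    split.
    + eapply Rle_lt_trans; [|exact T]. apply (re_le_Cmod (CInt f a b - (l1, l2))%C).
    + eapply Rle_lt_trans; [|exact T]. apply (im_le_Cmod (CInt f a b - (l1, l2))%C).
Qed.

(** * Holomorphic families on a strip *)

(** Families, indexed by [p] with [dom p], of functions that are [n] times
    complex differentiable on the strip [|Im u| < 1], all these derivatives being
    bounded by [K * exp (K * |Re u|)] with [K] independent of [p]. *)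
Fixpoint nice {P : Type} (dom : P -> Prop) (n : nat) (f : P -> C -> C) : Prop :=
  (exists K, 0 <= K /\ forall p u, dom p -> Rabs (Im u) < 1 ->
     Cmod (f p u) <= K * exp (K * Rabs (Re u))) /\
  match n with
  | O => True
  | S m => exists f', (forall p u, dom p -> Rabs (Im u) < 1 -> cder (f p) u (f' p u)) /\
                      nice dom m f'
  end.

Lemma exp_bound_le (K L x : R) : 0 <= K <= L -> 0 <= x -> K * exp (K * x) <= L * exp (L * x).
Proof.
  intros HK Hx. pose proof (exp_pos (K * x)).
  apply Rmult_le_compat; try lra. apply exp_le_compat; nra.
Qed.

Lemma strip_ball (u h : C) : Cmod h < 1 - Rabs (Im u) -> Rabs (Im (u + h)%C) < 1.
Proof.
  intros Hh. pose proof (im_le_Cmod h). simpl.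
  eapply Rle_lt_trans; [apply Rabs_triang|]. unfold Im in *. lra.
Qed.

Section Nice.
Context {P : Type} (dom : P -> Prop).

Lemma nice_bound (n : nat) (f : P -> C -> C) : nice dom n f ->
  exists K, 0 <= K /\ forall p u, dom p -> Rabs (Im u) < 1 ->
     Cmod (f p u) <= K * exp (K * Rabs (Re u)).
Proof. now destruct n; intros [H _]. Qed.

Lemma nice_le (n : nat) : forall f, nice dom (S n) f -> nice dom n f.
Proof.
  induction n as [|n IH]; intros f [Hb (f' & Hd & Hn)].
  - now split.
  - split; [exact Hb|]. exists f'; split; [exact Hd|now apply IH].
Qed.

Lemma nice_ext (n : nat) (f g : P -> C -> C) :
  (forall p u, dom p -> Rabs (Im u) < 1 -> f p u = g p u) -> nice dom n f -> nice dom n g.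
Proof.
  intros He Hf. destruct n as [|n]; destruct Hf as [(K & HK & Hb) Hd].
  - split; [|exact I]. exists K; split; [exact HK|].
    intros p u Hp Hu; rewrite <- He by assumption; auto.
  - split.
    + exists K; split; [exact HK|].
      intros p u Hp Hu; rewrite <- He by assumption; auto.
    + destruct Hd as (f' & Hd & Hn). exists f'; split; [|exact Hn].
      intros p u Hp Hu. apply (cder_ext_loc (f p) (g p) u _ (1 - Rabs (Im u))).
      * lra.
      * intros h Hh. apply He; [exact Hp|now apply strip_ball].
      * now apply Hd.
Qed.

Lemma nice_const (n : nat) : forall (c : P -> C) (K : R),
  (forall p, dom p -> Cmod (c p) <= K) -> nice dom n (fun p _ => c p).
Proof.
  induction n as [|n IH]; intros c K H; (split; [|]).
  1, 3: exists (Rmax 0 K); split; [apply Rmax_l|]; intros p u Hp _;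
    apply Rle_trans with (Rmax 0 K);
    [eapply Rle_trans; [now apply H|apply Rmax_r]|];
    pose proof (Rmax_l 0 K); pose proof (Rabs_pos (Re u));
    rewrite <- (Rmult_1_r (Rmax 0 K)) at 1; apply Rmult_le_compat_l; [lra|];
    rewrite <- exp_0 at 1; apply exp_le_compat; nra.
  - exact I.
  - exists (fun _ _ => RtoC 0); split.
    + intros; apply cder_const.
    + apply (IH (fun _ => RtoC 0) 0). intros; rewrite Cmod_0; lra.
Qed.

Lemma nice_id (n : nat) : nice dom n (fun _ u => u).
Proof.
  assert (B : exists K, 0 <= K /\ forall (p : P) u, dom p -> Rabs (Im u) < 1 ->
     Cmod u <= K * exp (K * Rabs (Re u))).
  { exists 1; split; [lra|]. intros _ u _ Hu.
    eapply Rle_trans; [apply Cmod_le_re_im|].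
    pose proof (exp_ineq1_le (1 * Rabs (Re u))). lra. }
  destruct n as [|n]; (split; [exact B|]); [exact I|].
  exists (fun _ _ => RtoC 1); split; [intros; apply cder_id|].
  apply (nice_const n (fun _ => RtoC 1) 1). intros; rewrite Cmod_1; lra.
Qed.

Lemma nice_plus (n : nat) : forall f g, nice dom n f -> nice dom n g ->
  nice dom n (fun p u => f p u + g p u)%C.
Proof.
  induction n as [|n IH]; intros f g Hf Hg;
    destruct (nice_bound _ _ Hf) as (K & HK & Bf), (nice_bound _ _ Hg) as (L & HL & Bg);
    (split; [exists (K + L); split; [lra|]; intros p u Hp Hu|]).
  1, 3: pose proof (Rabs_pos (Re u));
    rewrite (Rmult_plus_distr_r K L (exp _));
    apply Cmod_le_plus;
    [eapply Rle_trans; [now apply Bf|]|eapply Rle_trans; [now apply Bg|]];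
    apply Rmult_le_compat_l; try lra; apply exp_le_compat; nra.
  - exact I.
  - destruct Hf as [_ (f' & Df & Nf)], Hg as [_ (g' & Dg & Ng)].
    exists (fun p u => f' p u + g' p u)%C; split; [|now apply IH].
    intros; apply cder_plus; auto.
Qed.

Lemma nice_mult (n : nat) : forall f g, nice dom n f -> nice dom n g ->
  nice dom n (fun p u => f p u * g p u)%C.
Proof.
  induction n as [|n IH]; intros f g Hf Hg;
    destruct (nice_bound _ _ Hf) as (K & HK & Bf), (nice_bound _ _ Hg) as (L & HL & Bg);
    (split; [exists (K * L + K + L); split; [nra|]; intros p u Hp Hu|]).
  1, 3: pose proof (Rabs_pos (Re u));
    eapply Rle_trans; [apply Cmod_le_mult; [now apply Bf|now apply Bg]|];
    replace (K * exp (K * Rabs (Re u)) * (L * exp (L * Rabs (Re u))))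
      with (K * L * exp ((K + L) * Rabs (Re u)))
      by (rewrite Rmult_plus_distr_r, exp_plus; ring);
    apply Rmult_le_compat; try nra; [apply Rlt_le, exp_pos|apply exp_le_compat, Rmult_le_compat_r; nra].
  - exact I.
  - pose proof (nice_le _ _ Hf) as Hf'; pose proof (nice_le _ _ Hg) as Hg'.
    destruct Hf as [_ (f' & Df & Nf)], Hg as [_ (g' & Dg & Ng)].
    exists (fun p u => f' p u * g p u + f p u * g' p u)%C; split.
    + intros; apply cder_mult; auto.
    + apply nice_plus; apply IH; assumption.
Qed.

Lemma nice_opp (n : nat) (f : P -> C -> C) : nice dom n f -> nice dom n (fun p u => - f p u)%C.
Proof.
  intros Hf. apply (nice_ext n (fun p u => RtoC (-1) * f p u)%C).
  - intros; replace (RtoC (-1)) with (- (1))%C by (apply injective_projections; simpl; ring); ring.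
  - apply nice_mult; [|exact Hf].
    apply (nice_const n (fun _ => RtoC (-1)) 1). intros; rewrite Cmod_R, Rabs_left; lra.
Qed.

Lemma nice_minus (n : nat) (f g : P -> C -> C) : nice dom n f -> nice dom n g ->
  nice dom n (fun p u => f p u - g p u)%C.
Proof. intros; apply nice_plus; [|apply nice_opp]; assumption. Qed.

Lemma nice_inv (n : nat) : forall (c : R) f, 0 < c ->
  (forall p u, dom p -> Rabs (Im u) < 1 -> c <= Cmod (f p u)) ->
  nice dom n f -> nice dom n (fun p u => / f p u)%C.
Proof.
  induction n as [|n IH]; intros c f Hc Hlow Hf.
  all: assert (B : exists K, 0 <= K /\ forall p u, dom p -> Rabs (Im u) < 1 ->
     Cmod (/ f p u)%C <= K * exp (K * Rabs (Re u))).
  1, 3: exists (/ c); pose proof (Rinv_0_lt_compat c Hc);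
    split; [lra|]; intros p u Hp Hu; specialize (Hlow p u Hp Hu);
    rewrite Cmod_inv by (apply Cmod_gt_0; lra);
    apply Rle_trans with (/ c); [now apply Rinv_le_contravar|];
    pose proof (Rabs_pos (Re u));
    rewrite <- (Rmult_1_r (/ c)) at 1; apply Rmult_le_compat_l; [lra|];
    rewrite <- exp_0 at 1; apply exp_le_compat; nra.
  - now split.
  - split; [exact B|].
    pose proof (nice_le _ _ Hf) as Hf'.
    destruct Hf as [_ (f' & Df & Nf)].
    exists (fun p u => - (f' p u * (/ f p u) * (/ f p u)))%C; split.
    + intros p u Hp Hu. apply cder_inv; [|auto].
      apply Cmod_gt_0. specialize (Hlow p u Hp Hu); lra.
    + apply nice_opp, nice_mult; [apply nice_mult; [exact Nf|]|]; now apply (IH c).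
Qed.

Lemma nice_exp (n : nat) (r : P -> R) (M : R) : (forall p, dom p -> Rabs (r p) <= M) ->
  nice dom n (fun p u => Cexp (RtoC (r p) * u)).
Proof.
  intros Hr.
  assert (B : exists K, 0 <= K /\ forall p u, dom p -> Rabs (Im u) < 1 ->
     Cmod (Cexp (RtoC (r p) * u)) <= K * exp (K * Rabs (Re u))).
  { exists (Rmax 1 M); pose proof (Rmax_l 1 M); pose proof (Rmax_r 1 M).
    split; [lra|]. intros p u Hp _.
    rewrite Cmod_Cexp. rewrite <- (Rmult_1_l (exp (Re _))).
    apply Rmult_le_compat; try lra; [apply Rlt_le, exp_pos|]. apply exp_le_compat.
    replace (Re (RtoC (r p) * u)%C) with (r p * Re u) by (simpl; unfold Re, Im; ring).
    eapply Rle_trans; [apply Rle_abs|]. rewrite Rabs_mult.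
    specialize (Hr p Hp). apply Rmult_le_compat; try apply Rabs_pos; lra. }
  induction n as [|n IH]; (split; [exact B|]); [exact I|].
  exists (fun p u => RtoC (r p) * Cexp (RtoC (r p) * u))%C; split.
  - intros p u _ _. eapply cder_eq.
    + apply (cder_comp Cexp (fun u => RtoC (r p) * u)%C); [apply cder_Cexp|].
      apply (cder_scal (RtoC (r p)) (fun u => u)), cder_id.
    + ring.
  - apply nice_mult; [|exact IH]. apply (nice_const n (fun p => RtoC (r p)) M).
    intros p Hp; rewrite Cmod_R; auto.
Qed.

(** All hypotheses are confined to the segment from [v] to [v + k], so that the estimate applies to
    functions controlled only in the strip. *)
Lemma cder_taylor (f f' f'' : C -> C) (v k : C) (B : R) :
  (forall s, 0 <= s <= 1 -> cder f (v + RtoC s * k)%C (f' (v + RtoC s * k)%C)) ->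
  (forall s, 0 <= s <= 1 -> cder f' (v + RtoC s * k)%C (f'' (v + RtoC s * k)%C)) ->
  (forall s, 0 <= s <= 1 -> Cmod (f'' (v + RtoC s * k)%C) <= B) ->
  Cmod (f (v + k) - f v - f' v * k)%C <= B * Cmod k ^ 2.
Proof.
  intros H1 H2 HB.
  assert (L : forall s, rder (fun s => v + RtoC s * k)%C s k).
  { intros s. eapply rder_eq; [apply rder_plus; [apply rder_const|
      apply rder_mult; [apply rder_id|apply rder_const]]|cbv beta; ring]. }
  assert (E0 : (v + RtoC 0 * k = v)%C) by ring.
  assert (E1 : (v + RtoC 1 * k = v + k)%C) by ring.
  assert (HB0 : 0 <= B).
  { eapply Rle_trans; [apply Cmod_ge_0|apply (HB 0); lra]. }
  pose proof (Cmod_ge_0 k) as Hk.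
  assert (Q : forall s, 0 <= s <= 1 -> Cmod (f' (v + RtoC s * k) - f' v)%C <= B * Cmod k).
  { intros s Hs.
    pose proof (rder_bound (fun s => f' (v + RtoC s * k))%C
      (fun s => f'' (v + RtoC s * k) * k)%C 0 s (B * Cmod k) ltac:(lra)) as T.
    cbv beta in T. rewrite E0 in T. eapply Rle_trans; [apply T|].
    - intros t Ht. apply rder_cder; [apply H2; lra|apply L].
    - intros t Ht. apply Cmod_le_mult; [apply HB; lra|lra].
    - assert (0 <= B * Cmod k) by nra. nra. }
  pose proof (rder_bound (fun s => f (v + RtoC s * k) - RtoC s * (f' v * k))%C
      (fun s => f' (v + RtoC s * k) * k - f' v * k)%C 0 1 (B * Cmod k ^ 2) ltac:(lra)) as T.
  cbv beta in T. rewrite E0, E1 in T.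
  replace (f (v + k) - f v - f' v * k)%C
    with (f (v + k) - 1 * (f' v * k) - (f v - 0 * (f' v * k)))%C by ring.
  eapply Rle_trans; [apply T|lra].
  - intros t Ht. apply rder_minus; [apply rder_cder; [now apply H1|apply L]|].
    eapply rder_eq; [apply rder_mult; [apply rder_id|apply rder_const]|cbv beta; ring].
  - intros t Ht. replace (_ - _)%C with ((f' (v + RtoC t * k) - f' v) * k)%C by ring.
    replace (B * Cmod k ^ 2) with (B * Cmod k * Cmod k) by ring.
    apply Cmod_le_mult; [now apply Q|lra].
Qed.

Context (a : P -> C) (Ha : forall p, dom p -> Re (a p) = 0 /\ Rabs (Im (a p)) < 1).

(* [(f u - f a) / (u - a)] is [segT 0 f'], and [segT j f] has the derivative [segT (S j) f']. *)
Definition segT (j : nat) (f : P -> C -> C) (p : P) (u : C) : C :=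
  CInt (fun s => RtoC (s ^ j) * f p (a p + RtoC s * (u - a p)))%C 0 1.

Lemma seg_strip (p : P) (u : C) (s : R) : dom p -> 0 <= s <= 1 ->
  Rabs (Im (a p + RtoC s * (u - a p))%C) <= Rmax (Rabs (Im (a p))) (Rabs (Im u)) /\
  Rabs (Re (a p + RtoC s * (u - a p))%C) <= Rabs (Re u).
Proof.
  intros Hp Hs. destruct (Ha p Hp) as [H0 _]. split.
  - replace (Im _) with ((1 - s) * Im (a p) + s * Im u) by (simpl; unfold Re, Im; ring).
    pose proof (Rmax_l (Rabs (Im (a p))) (Rabs (Im u))).
    pose proof (Rmax_r (Rabs (Im (a p))) (Rabs (Im u))).
    eapply Rle_trans; [apply Rabs_triang|]. rewrite !Rabs_mult.
    rewrite (Rabs_right s), (Rabs_right (1 - s)) by lra. nra.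
  - replace (Re _) with ((1 - s) * Re (a p) + s * Re u) by (simpl; unfold Re, Im; ring).
    rewrite H0, Rmult_0_r, Rplus_0_l, Rabs_mult, (Rabs_right s) by lra.
    pose proof (Rabs_pos (Re u)); nra.
Qed.

Lemma seg_rder (p : P) (u : C) (s : R) :
  rder (fun s => a p + RtoC s * (u - a p))%C s (u - a p)%C.
Proof.
  eapply rder_eq; [apply rder_plus; [apply rder_const|
    apply rder_mult; [apply rder_id|apply rder_const]]|cbv beta; ring].
Qed.

Lemma seg_ccont (j : nat) (f f' : P -> C -> C) (p : P) (u : C) (s : R) :
  (forall p u, dom p -> Rabs (Im u) < 1 -> cder (f p) u (f' p u)) ->
  dom p -> Rabs (Im u) < 1 -> 0 <= s <= 1 ->
  ccont (fun s => RtoC (s ^ j) * f p (a p + RtoC s * (u - a p)))%C s.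
Proof.
  intros Hd Hp Hu Hs. apply ccont_mult.
  - eapply rder_ccont. apply (rder_RtoC (fun s => s ^ j)). auto_derive; [exact I|reflexivity].
  - eapply rder_ccont, (rder_cder (f p) (fun s => a p + RtoC s * (u - a p))%C).
    + apply Hd; [exact Hp|]. eapply Rle_lt_trans; [apply seg_strip; assumption|].
      apply Rmax_lub_lt; [now apply Ha|exact Hu].
    + apply seg_rder.
Qed.

Lemma pow_unit (s : R) (j : nat) : 0 <= s <= 1 -> Cmod (RtoC (s ^ j)) <= 1.
Proof.
  intros Hs. rewrite Cmod_R, Rabs_right; [|apply Rle_ge, pow_le; lra].
  rewrite <- (pow1 j). now apply pow_incr.
Qed.

Lemma is_RInt_const_01 (K : R) : is_RInt (fun _ => K) 0 1 K.
Proof.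
  assert (E : scal (1 - 0) K = K) by (unfold scal; simpl; unfold mult; simpl; ring).
  evar_last; [apply (is_RInt_const (V := R_NormedModule))|exact E].
Qed.

(** Since [a p] is imaginary, [|Re|] on the segment never exceeds [|Re u|], so the exponential bound
    is inherited unchanged. The derivative is justified by a Taylor remainder under the integral,
    whose control by [f''] is what costs an order. *)
Lemma nice_segT (n : nat) : forall (j : nat) (f : P -> C -> C),
  nice dom (S n) f -> nice dom n (segT j f).
Proof.
  induction n as [|n IH]; intros j f Hf.
  all: assert (B : exists K, 0 <= K /\ forall p u, dom p -> Rabs (Im u) < 1 ->
         Cmod (segT j f p u) <= K * exp (K * Rabs (Re u))).
  1, 3: destruct Hf as [(K & HK & Bf) (f' & Df & _)]; exists K; split; [exact HK|];
    intros p u Hp Hu;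
    apply (CInt_bound _ 0 1 Rle_0_1) with (h := fun _ => K * exp (K * Rabs (Re u)));
    [intros s Hs; eapply seg_ccont; eauto| |apply is_RInt_const_01];
    intros s Hs; destruct (seg_strip p u s Hp Hs) as [S1 S2];
    rewrite <- (Rmult_1_l (K * _)); apply Cmod_le_mult; [now apply pow_unit|];
    eapply Rle_trans;
    [apply Bf; [exact Hp|eapply Rle_lt_trans; [exact S1|apply Rmax_lub_lt; [now apply Ha|exact Hu]]]|];
    apply Rmult_le_compat_l; [exact HK|]; apply exp_le_compat; now apply Rmult_le_compat_l.
  - now split.
  - split; [exact B|].
    destruct Hf as [_ (f' & Df & Nf)]. exists (segT (S j) f'); split; [|now apply IH].
    destruct Nf as [_ (f'' & Df' & Nf'')].
    destruct (nice_bound _ _ Nf'') as (K & HK & Bf'').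
    intros p u Hp Hu.
    (* Every point of the segment from [a p] to [u], moved by less than [d], stays in the strip. *)
    set (d := 1 - Rmax (Rabs (Im (a p))) (Rabs (Im u))).
    assert (Hd : 0 < d).
    { unfold d. assert (Rmax (Rabs (Im (a p))) (Rabs (Im u)) < 1); [|lra].
      apply Rmax_lub_lt; [now apply Ha|exact Hu]. }
    set (Bd := K * exp (K * (Rabs (Re u) + d))).
    assert (HBd : 0 <= Bd) by (apply Rmult_le_pos; [exact HK|apply Rlt_le, exp_pos]).
    exists d, Bd; repeat split; auto. intros h Hh.
    assert (Huh : Rabs (Im (u + h)%C) < 1).
    { apply strip_ball. eapply Rlt_le_trans; [exact Hh|]. unfold d.
      pose proof (Rmax_r (Rabs (Im (a p))) (Rabs (Im u))). lra. }
    assert (E : (segT j f p (u + h) - segT j f p u - segT (S j) f' p u * h)%C =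
      CInt (fun s => RtoC (s ^ j) * f p (a p + RtoC s * (u + h - a p))
         + (-1) * (RtoC (s ^ j) * f p (a p + RtoC s * (u - a p)))
         + (- h) * (RtoC (s ^ S j) * f' p (a p + RtoC s * (u - a p))))%C 0 1).
    { rewrite (CInt_plus (fun s => _ + _)%C); [|lra| |];
        [rewrite CInt_plus; [|lra| |]| |].
      - rewrite !CInt_scal; [unfold segT; ring|lra| |lra|].
        + intros s Hs. eapply seg_ccont; eauto.
        + intros s Hs. eapply seg_ccont; eauto.
      - intros s Hs. eapply seg_ccont; eauto.
      - intros s Hs. apply ccont_mult; [apply ccont_const|]. eapply seg_ccont; eauto.
      - intros s Hs. apply ccont_plus; [|apply ccont_mult; [apply ccont_const|]];
          eapply seg_ccont; eauto.
      - intros s Hs. apply ccont_mult; [apply ccont_const|]. eapply seg_ccont; eauto. }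
    rewrite E.
    apply (CInt_bound _ 0 1 Rle_0_1) with (h := fun _ => Bd * Cmod h ^ 2);
      [|intros s Hs|apply is_RInt_const_01].
    { intros s Hs. apply ccont_plus; [apply ccont_plus; [apply ccont_mult|]|].
      3, 4: apply ccont_mult; [apply ccont_const|eapply seg_ccont; eauto].
      - eapply rder_ccont. apply (rder_RtoC (fun s => s ^ j)). auto_derive; [exact I|reflexivity].
      - eapply rder_ccont, (rder_cder (f p) (fun s => a p + RtoC s * (u + h - a p))%C).
        + apply Df; [exact Hp|]. eapply Rle_lt_trans; [apply seg_strip; assumption|].
          apply Rmax_lub_lt; [now apply Ha|exact Huh].
        + apply seg_rder. }
    destruct (seg_strip p u s Hp Hs) as [S1 S2].
    set (v := (a p + RtoC s * (u - a p))%C) in *.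
    replace (a p + RtoC s * (u + h - a p))%C with (v + RtoC s * h)%C by (unfold v; ring).
    replace (_ + _ + _)%C with
      (RtoC (s ^ j) * (f p (v + RtoC s * h) - f p v - f' p v * (RtoC s * h)))%C
      by (simpl pow; rewrite RtoC_mult; ring).
    rewrite <- (Rmult_1_l (Bd * _)). apply Cmod_le_mult; [now apply pow_unit|].
    assert (Hsh : Cmod (RtoC s * h)%C <= Cmod h).
    { rewrite Cmod_mult, Cmod_R, Rabs_right by lra. pose proof (Cmod_ge_0 h); nra. }
    assert (Hin : forall t, 0 <= t <= 1 -> Rabs (Im (v + RtoC t * (RtoC s * h))%C) < 1 /\
       Rabs (Re (v + RtoC t * (RtoC s * h))%C) <= Rabs (Re u) + d).
    { intros t Ht.
      assert (Hq : Cmod (RtoC t * (RtoC s * h))%C < d).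
      { rewrite Cmod_mult, Cmod_R, Rabs_right by lra.
        pose proof (Cmod_ge_0 (RtoC s * h)%C); nra. }
      split.
      - apply strip_ball. eapply Rlt_le_trans; [exact Hq|]. unfold d. lra.
      - pose proof (re_le_Cmod (RtoC t * (RtoC s * h))%C) as Q.
        change (Re (v + RtoC t * (RtoC s * h))%C)
          with (Re v + Re (RtoC t * (RtoC s * h))%C).
        eapply Rle_trans; [apply Rabs_triang|]. lra. }
    apply Rle_trans with (Bd * Cmod (RtoC s * h)%C ^ 2).
    + apply (cder_taylor (f p) (f' p) (f'' p)).
      * intros t Ht. apply Df; [exact Hp|now apply Hin].
      * intros t Ht. apply Df'; [exact Hp|now apply Hin].
      * intros t Ht. eapply Rle_trans; [apply Bf''; [exact Hp|now apply Hin]|].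
        apply Rmult_le_compat_l; [exact HK|]. apply exp_le_compat.
        apply Rmult_le_compat_l; [exact HK|now apply Hin].
    + apply Rmult_le_compat_l; [exact HBd|]. apply pow_incr; split; [apply Cmod_ge_0|exact Hsh].
Qed.

(** The quotient is the mean of the derivative over the segment from [a p] to [u]. No division takes
    place, so its bounds do not deteriorate near [a p], wherever [a p] lies. *)
Lemma nice_quotient (n : nat) (f : P -> C -> C) : nice dom (S (S n)) f ->
  exists g, nice dom n g /\
    (forall p u, dom p -> Rabs (Im u) < 1 -> (f p u - f p (a p) = g p u * (u - a p))%C) /\
    (forall p, dom p -> cder (f p) (a p) (g p (a p))).
Proof.
  intros [_ (f' & Df & Nf)].
  exists (segT 0 f'); split; [now apply nice_segT|split].
  - intros p u Hp Hu. destruct Nf as [_ (f'' & Df' & _)].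
    unfold segT. rewrite Cmult_comm, <- CInt_scal; [|lra|intros s Hs; eapply seg_ccont; eauto].
    rewrite (CInt_FTC _ (fun s => f p (a p + RtoC s * (u - a p)))%C); [|lra| |].
    + f_equal; [f_equal; ring|f_equal; f_equal; ring].
    + intros s Hs. apply ccont_mult; [apply ccont_const|eapply seg_ccont; eauto].
    + intros s Hs. eapply rder_eq.
      * apply (rder_cder (f p) (fun s => a p + RtoC s * (u - a p))%C); [|apply seg_rder].
        apply Df; [exact Hp|]. eapply Rle_lt_trans; [apply seg_strip; assumption|].
        apply Rmax_lub_lt; [now apply Ha|exact Hu].
      * simpl pow. ring.
  - intros p Hp. eapply cder_eq; [apply Df; [exact Hp|now apply Ha]|].
    unfold segT. rewrite (CInt_FTC _ (fun s => RtoC s * f' p (a p))%C); [ring|lra| |].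
    + intros s _. apply (ccont_mult (fun s => RtoC (s ^ 0))).
      * apply ccont_const.
      * assert (E : forall s, f' p (a p) = f' p (a p + RtoC s * (a p - a p))%C)
          by (intros; f_equal; ring).
        split; (eapply (continuous_ext (fun _ => _));
          [intros t; rewrite <- (E t); reflexivity|apply continuous_const]).
    + intros s _. eapply rder_eq; [apply rder_mult; [apply rder_id|apply rder_const]|].
      cbv beta. simpl pow. replace (a p + RtoC s * (a p - a p))%C with (a p) by ring. ring.
Qed.

End Nice.

(** * Division by [cosh u - cos al] *)

(** Iterated from [1 - cos t >= 0], this produces the successive Taylor bounds of sine and cosine;
    the bound of [cosh] arises in the same way. *)
Lemma nonneg_of_derive (f f' : R -> R) (x : R) : 0 <= x -> f 0 = 0 ->
  (forall t, 0 <= t -> is_derive f t (f' t)) -> (forall t, 0 <= t -> 0 <= f' t) -> 0 <= f x.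
Proof.
  intros Hx H0 Hd Hp.
  destruct (MVT_gen f 0 x f') as [c [Hc E]].
  - rewrite Rmin_left, Rmax_right by lra. intros; apply Hd; lra.
  - rewrite Rmin_left, Rmax_right by lra. intros.
    apply continuity_pt_filterlim, @ex_derive_continuous; eexists; apply Hd; lra.
  - rewrite Rmin_left, Rmax_right in Hc by lra.
    assert (0 <= f' c) by (apply Hp; lra). nra.
Qed.

Lemma sin_le_id (x : R) : 0 <= x -> sin x <= x.
Proof.
  intros Hx. apply Rminus_le_0.
  apply (nonneg_of_derive (fun x => x - sin x) (fun x => 1 - cos x)); auto.
  - rewrite sin_0; ring.
  - intros; auto_derive; [exact I|ring].
  - intros t _; pose proof (COS_bound t); lra.
Qed.

Lemma cos_ge_quad (x : R) : 0 <= x -> 1 - x ^ 2 / 2 <= cos x.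
Proof.
  intros Hx. apply Rminus_le_0.
  apply (nonneg_of_derive (fun x => cos x - (1 - x ^ 2 / 2)) (fun x => x - sin x)); auto.
  - rewrite cos_0; field.
  - intros; auto_derive; [exact I|simpl; field].
  - intros t Ht; pose proof (sin_le_id t Ht); lra.
Qed.

Lemma sin_ge_cubic (x : R) : 0 <= x -> x - x ^ 3 / 6 <= sin x.
Proof.
  intros Hx. apply Rminus_le_0.
  apply (nonneg_of_derive (fun x => sin x - (x - x ^ 3 / 6)) (fun x => cos x - (1 - x ^ 2 / 2))); auto.
  - rewrite sin_0; field.
  - intros; auto_derive; [exact I|simpl; field].
  - intros t Ht; pose proof (cos_ge_quad t Ht); lra.
Qed.

Lemma cos_le_quartic (x : R) : 0 <= x -> cos x <= 1 - x ^ 2 / 2 + x ^ 4 / 24.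
Proof.
  intros Hx. apply Rminus_le_0.
  apply (nonneg_of_derive (fun x => 1 - x ^ 2 / 2 + x ^ 4 / 24 - cos x)
    (fun x => sin x - (x - x ^ 3 / 6))); auto.
  - rewrite cos_0; field.
  - intros; auto_derive; [exact I|simpl; field].
  - intros t Ht; pose proof (sin_ge_cubic t Ht); lra.
Qed.

Lemma cosh_ge_quad (x : R) : 1 + x ^ 2 / 2 <= cosh x.
Proof.
  assert (H : forall x, 0 <= x -> 1 + x ^ 2 / 2 <= cosh x).
  { clear x; intros x Hx. apply Rminus_le_0.
    apply (nonneg_of_derive (fun x => cosh x - (1 + x ^ 2 / 2)) (fun x => sinh x - x)); auto.
    - unfold cosh. rewrite Ropp_0, exp_0; field.
    - intros; unfold cosh, sinh; auto_derive; [exact I|simpl; field].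
    - intros t Ht. apply (nonneg_of_derive (fun x => sinh x - x) (fun x => cosh x - 1)); auto.
      + unfold sinh. rewrite Ropp_0, exp_0; field.
      + intros; unfold cosh, sinh; auto_derive; [exact I|simpl; field].
      + intros s Hs. apply (nonneg_of_derive (fun x => cosh x - 1) sinh); auto.
        * unfold cosh. rewrite Ropp_0, exp_0; field.
        * intros; unfold cosh, sinh; auto_derive; [exact I|simpl; field].
        * intros q Hq. unfold sinh.
          assert (exp (- q) <= exp q) by (apply exp_le_compat; lra). lra. }
  destruct (Rle_dec 0 x) as [Hx|Hx]; [now apply H|].
  replace (x ^ 2) with ((- x) ^ 2) by ring.
  replace (cosh x) with (cosh (- x)); [apply H; lra|].
  unfold cosh; rewrite Ropp_involutive; field.
Qed.

(** * Complex hyperbolic functions and the factors of the denominator *)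

Definition csinh (z : C) : C := ((Cexp z - Cexp (- z)) * / 2)%C.
Definition ccosh (z : C) : C := ((Cexp z + Cexp (- z)) * / 2)%C.

Lemma C2_neq_0 : (2 : C) <> 0.
Proof. intros H; apply (f_equal fst) in H; simpl in H; lra. Qed.

Lemma half_components (z : C) : Re (z * / 2)%C = Re z / 2 /\ Im (z * / 2)%C = Im z / 2.
Proof. destruct z; split; simpl; field. Qed.

Lemma cder_Cexp_opp (u : C) : cder (fun u => Cexp (- u)) u (- Cexp (- u))%C.
Proof.
  eapply cder_eq; [apply (cder_comp Cexp (fun u => - u)%C);
    [apply cder_Cexp|apply cder_opp, cder_id]|ring].
Qed.

Lemma cder_csinh (u : C) : cder csinh u (ccosh u).
Proof.
  eapply cder_eq.
  - apply cder_mult; [apply cder_minus; [apply cder_Cexp|apply cder_Cexp_opp]|apply cder_const].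
  - unfold ccosh; cbv beta; ring.
Qed.

Lemma cder_ccosh (u : C) : cder ccosh u (csinh u).
Proof.
  eapply cder_eq.
  - apply cder_mult; [apply cder_plus; [apply cder_Cexp|apply cder_Cexp_opp]|apply cder_const].
  - unfold csinh; cbv beta; ring.
Qed.

Lemma csinh_components (x y : R) :
  csinh (x, y) = (sinh x * cos y, cosh x * sin y).
Proof.
  unfold csinh, Cexp, sinh, cosh; apply injective_projections; simpl;
    rewrite ?cos_neg, ?sin_neg; field.
Qed.

Lemma ccosh_components (x y : R) :
  ccosh (x, y) = (cosh x * cos y, sinh x * sin y).
Proof.
  unfold ccosh, Cexp, sinh, cosh; apply injective_projections; simpl;
    rewrite ?cos_neg, ?sin_neg; field.
Qed.

Lemma csinh_i (a : R) : csinh (Ci * RtoC a)%C = (Ci * RtoC (sin a))%C.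
Proof.
  replace (Ci * RtoC a)%C with (0, a) by (apply injective_projections; simpl; ring).
  rewrite csinh_components. unfold sinh, cosh. rewrite Ropp_0, exp_0.
  apply injective_projections; simpl; field.
Qed.

Lemma ccosh_i (a : R) : ccosh (Ci * RtoC a)%C = RtoC (cos a).
Proof.
  replace (Ci * RtoC a)%C with (0, a) by (apply injective_projections; simpl; ring).
  rewrite ccosh_components. unfold sinh, cosh. rewrite Ropp_0, exp_0.
  apply injective_projections; simpl; field.
Qed.

(** By [|sinh (x + i y)|^2 = sinh^2 x + sin^2 y], where [sinh^2 x >= x^2], and [sin^2 y >= y^2 / 4]
    for [|y| <= 1]. *)
Lemma Cmod_csinh_ge (z : C) : Rabs (Im z) <= 1 -> Cmod z / 2 <= Cmod (csinh z).
Proof.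
  destruct z as [x y]; simpl; intros Hy.
  assert (Hs : y ^ 2 / 4 <= sin y ^ 2).
  { assert (P : forall t, 0 <= t <= 1 -> t ^ 2 / 4 <= sin t ^ 2).
    { intros t Ht. pose proof (sin_ge_cubic t ltac:(lra)).
      assert (t / 2 <= sin t) by nra. nra. }
    destruct (Rle_dec 0 y).
    - apply P. rewrite Rabs_right in Hy by lra. lra.
    - rewrite Rabs_left in Hy by lra. specialize (P (- y) ltac:(lra)).
      rewrite sin_neg in P. lra. }
  assert (Hc : cosh x ^ 2 = 1 + sinh x ^ 2).
  { unfold cosh, sinh. assert (E : exp x * exp (- x) = 1) by
      (rewrite <- exp_plus, Rplus_opp_r; apply exp_0). nra. }
  assert (Hsh : x ^ 2 <= sinh x ^ 2).
  { pose proof (cosh_ge_quad x). assert (1 + x ^ 2 <= cosh x ^ 2) by nra. lra. }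
  assert (Hcs : cos y ^ 2 = 1 - sin y ^ 2).
  { pose proof (sin2_cos2 y) as T; unfold Rsqr in T. lra. }
  apply Rsqr_incr_0_var; [|apply Cmod_ge_0].
  rewrite !Rsqr_pow2. replace ((Cmod (x, y) / 2) ^ 2) with (Cmod (x, y) ^ 2 / 4) by field.
  rewrite !Cmod2_alt, csinh_components; simpl Re; simpl Im.
  rewrite !Rpow_mult_distr, Hc, Hcs. nra.
Qed.

(** [p.1] is the angle [PI / 2 - theta], [p.2] is the real part [r] of the order. *)
Definition pdom (M : R) (p : R * R) : Prop := 0 < fst p <= 1 / 2 /\ Rabs (snd p) <= M.

Definition den (al : R) (u : C) : C := (ccosh u - RtoC (cos al))%C.

Definition ia (p : R * R) : C := (Ci * RtoC (fst p))%C.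

Lemma nice_csinh (M : R) (n : nat) : nice (pdom M) n (fun _ => csinh).
Proof.
  unfold csinh. apply nice_mult.
  - apply nice_minus.
    + apply (nice_ext _ _ (fun _ u => Cexp (RtoC 1 * u))).
      * intros; f_equal; ring.
      * apply (nice_exp _ _ (fun _ => 1) 1). intros; rewrite Rabs_R1; lra.
    + apply (nice_ext _ _ (fun _ u => Cexp (RtoC (-1) * u))).
      * intros; f_equal. replace (RtoC (-1)) with (- (1))%C
          by (apply injective_projections; simpl; ring). ring.
      * apply (nice_exp _ _ (fun _ => -1) 1). intros; rewrite Rabs_left; lra.
  - apply (nice_const _ _ (fun _ => / 2)%C (Cmod (/ 2)%C)). intros; lra.
Qed.

(* The half-angle factor [2 sinh((u - a)/2) / (u - a)] has no zero in the strip. *)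
Lemma nice_half_factor (M e : R) (n : nat) : e = 1 \/ e = -1 ->
  exists G, nice (pdom M) n G /\
    (forall p u, pdom M p -> Rabs (Im u) < 1 ->
       csinh ((u - RtoC e * ia p) * / 2) = (G p u * (u - RtoC e * ia p))%C) /\
    (forall p u, pdom M p -> Rabs (Im u) < 1 -> / 4 <= Cmod (G p u)).
Proof.
  intros He.
  set (a := fun p => (RtoC e * ia p)%C).
  assert (Ha : forall p, pdom M p -> Re (a p) = 0 /\ Rabs (Im (a p)) <= 1 / 2).
  { intros [al r] [H _]; simpl in H. unfold a, ia; simpl.
    split; [ring|].
    destruct He as [-> | ->]; [rewrite Rabs_right|rewrite Rabs_left]; lra. }
  set (F := fun p u => csinh ((u - a p) * / 2)%C).
  assert (HF : nice (pdom M) (S (S n)) F).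
  { unfold F, csinh.
    apply (nice_ext _ _ (fun p u => (Cexp (RtoC (/ 2) * u) * Cexp (- (a p * / 2))
       - Cexp (RtoC (- / 2) * u) * Cexp (a p * / 2)) * / 2)%C).
    - intros p u _ _. rewrite <- !Cexp_plus. f_equal; f_equal; [|f_equal]; f_equal.
      + replace (RtoC (/ 2)) with (/ 2)%C by (apply injective_projections; simpl; field).
        ring.
      + replace (RtoC (- / 2)) with (- / 2)%C by (apply injective_projections; simpl; field).
        ring.
    - assert (B : forall p, pdom M p -> Re (a p * / 2)%C = 0).
      { intros p Hp. destruct (Ha p Hp) as [H0 _].
        rewrite (proj1 (half_components _)), H0. field. }
      apply nice_mult; [apply nice_minus; apply nice_mult|].
      + apply (nice_exp _ _ (fun _ => / 2) 1). intros; rewrite Rabs_right; lra.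
      + apply (nice_const _ _ (fun p => Cexp (- (a p * / 2))%C) 1).
        intros p Hp; rewrite Cmod_Cexp.
        change (Re (- (a p * / 2))%C) with (- Re (a p * / 2)%C).
        rewrite (B p Hp), Ropp_0, exp_0; lra.
      + apply (nice_exp _ _ (fun _ => - / 2) 1). intros; rewrite Rabs_left; lra.
      + apply (nice_const _ _ (fun p => Cexp (a p * / 2)%C) 1).
        intros p Hp; rewrite Cmod_Cexp. rewrite (B p Hp), exp_0; lra.
      + apply (nice_const _ _ (fun _ => / 2)%C (Cmod (/ 2)%C)). intros; lra. }
  destruct (nice_quotient (pdom M) a) with (n := n) (f := F) as (G & NG & EG & DG).
  { intros p Hp; destruct (Ha p Hp); split; [assumption|lra]. }
  { exact HF. }
  assert (F0 : forall p, F p (a p) = 0).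
  { intros p. unfold F. replace ((a p - a p) * / 2)%C with (RtoC 0) by ring.
    unfold csinh. replace (- 0)%C with (RtoC 0) by ring. ring. }
  exists G; split; [exact NG|split].
  - intros p u Hp Hu. rewrite <- EG by assumption. rewrite F0. unfold F, a. ring.
  - intros p u Hp Hu.
    (* At the zero itself the factor is the derivative [1 / 2]; elsewhere [Cmod_csinh_ge] at half
       the argument yields [1 / 4]. *)
    destruct (Ceq_dec u (a p)) as [-> | Hne].
    + assert (E : G p (a p) = (/ 2)%C).
      { apply (cder_unique (F p) (a p)); [now apply DG|].
        eapply cder_eq.
        - apply (cder_comp csinh (fun u => (u - a p) * / 2)%C); [apply cder_csinh|].
          apply cder_mult; [apply cder_minus; [apply cder_id|apply cder_const]|apply cder_const].
        - cbv beta. replace ((a p - a p) * / 2)%C with (RtoC 0) by ring.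
          unfold ccosh. replace (- 0)%C with (RtoC 0) by ring. rewrite Cexp_0. field. }
      rewrite E, Cmod_inv, Cmod_R, Rabs_right by (lra || exact C2_neq_0). lra.
    + assert (Hq : 0 < Cmod (u - a p)%C).
      { apply Cmod_gt_0. intros H. apply Hne. replace u with (u - a p + a p)%C by ring.
        rewrite H; ring. }
      specialize (EG p u Hp Hu). rewrite F0 in EG.
      assert (L : Cmod ((u - a p) * / 2)%C / 2 <= Cmod (F p u)).
      { apply Cmod_csinh_ge. destruct (Ha p Hp) as [_ Hi].
        rewrite (proj2 (half_components _)).
        change (Im (u - a p)%C) with (Im u - Im (a p)).
        unfold Rdiv; rewrite Rabs_mult, (Rabs_right (/ 2)) by lra.
        pose proof (Rabs_triang (Im u) (- Im (a p))) as T. rewrite Rabs_Ropp in T.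
        unfold Rminus. lra. }
      replace (F p u) with (G p u * (u - a p))%C in L by (rewrite <- EG; ring).
      rewrite !Cmod_mult, Cmod_inv, Cmod_R, Rabs_right in L by (lra || exact C2_neq_0).
      apply Rmult_le_reg_r with (Cmod (u - a p)%C); [exact Hq|]. lra.
Qed.

(** With [A = (u - v) / 2] and [B = (u + v) / 2] for [v = i al], this is [cosh (A + B) - cosh (B -
    A) = 2 sinh A sinh B]. *)
Lemma den_factor (al : R) (u : C) :
  den al u = (2 * csinh ((u - RtoC 1 * (Ci * RtoC al)) * / 2)
                * csinh ((u - RtoC (-1) * (Ci * RtoC al)) * / 2))%C.
Proof.
  unfold den. rewrite <- (ccosh_i al). unfold csinh, ccosh.
  replace (RtoC (-1)) with (- (1))%C by (apply injective_projections; simpl; ring).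
  set (v := (Ci * RtoC al)%C).
  set (A := ((u - 1 * v) * / 2)%C). set (B := ((u - - (1) * v) * / 2)%C).
  replace u with (A + B)%C by (unfold A, B; field).
  replace (- (A + B))%C with (- A + - B)%C by ring.
  replace v with (B + - A)%C at 1 by (unfold A, B; field).
  replace (- v)%C with (A + - B)%C by (unfold A, B; field).
  rewrite !Cexp_plus. field.
Qed.

(** The two zeros are divided out one after the other as linear factors, two orders each. What [den]
    contains besides these linear factors is the product of the half-angle factors, bounded below by
    [1 / 4] each, so the bounds survive the merging of the zeros. *)
Lemma nice_div_den (M : R) (n : nat) (f : R * R -> C -> C) :
  nice (pdom M) (4 + n) f ->
  (forall p, pdom M p -> f p (ia p) = 0 /\ f p (- ia p)%C = 0) ->
  exists g, nice (pdom M) n g /\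
    forall p u, pdom M p -> Rabs (Im u) < 1 -> f p u = (den (fst p) u * g p u)%C.
Proof.
  intros Hf Hz.
  assert (Hia : forall p, pdom M p -> Re (ia p) = 0 /\ Rabs (Im (ia p)) < 1).
  { intros [al r] [H _]; simpl in H. unfold ia; simpl.
    split; [ring|]. rewrite Rabs_right; lra. }
  assert (Hma : forall p, pdom M p -> Re (- ia p)%C = 0 /\ Rabs (Im (- ia p)%C) < 1).
  { intros p Hp. destruct (Hia p Hp) as [H1 H2]. unfold Re, Im in *; simpl in *.
    rewrite Rabs_Ropp, H1; split; [ring|assumption]. }
  destruct (nice_quotient _ ia Hia (S (S n)) f Hf) as (g1 & N1 & E1 & _).
  destruct (nice_quotient _ (fun p => - ia p)%C Hma n g1 N1) as (g2 & N2 & E2 & _).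
  destruct (nice_half_factor M 1 n) as (G1 & NG1 & EG1 & LG1); [now left|].
  destruct (nice_half_factor M (-1) n) as (G2 & NG2 & EG2 & LG2); [now right|].
  exists (fun p u => (g2 p u * / 2) * (/ G1 p u * / G2 p u))%C; split.
  - apply nice_mult; apply nice_mult; auto.
    + apply (nice_const _ _ (fun _ => / 2)%C (Cmod (/ 2)%C)). intros; lra.
    + apply (nice_inv _ n (/ 4)); auto; lra.
    + apply (nice_inv _ n (/ 4)); auto; lra.
  - intros p u Hp Hu.
    assert (n1 : G1 p u <> 0) by (apply Cmod_gt_0; specialize (LG1 p u Hp Hu); lra).
    assert (n2 : G2 p u <> 0) by (apply Cmod_gt_0; specialize (LG2 p u Hp Hu); lra).
    rewrite den_factor. fold (ia p). rewrite (EG1 p u Hp Hu), (EG2 p u Hp Hu).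
    (* The second zero survives the first division because [al > 0] keeps the two zeros apart; the
       size of their distance does not enter the bounds. *)
    assert (Z : g1 p (- ia p)%C = 0).
    { destruct (Hz p Hp) as [Z1 Z2].
      pose proof (E1 p (- ia p)%C Hp (proj2 (Hma p Hp))) as E.
      rewrite Z1, Z2 in E.
      assert (Hnz : (- ia p - ia p)%C <> 0).
      { destruct Hp as [Hp _]. unfold ia; intros H. apply (f_equal snd) in H. simpl in H. lra. }
      replace (g1 p (- ia p)%C) with ((g1 p (- ia p) * (- ia p - ia p)) / (- ia p - ia p))%C
        by (field; exact Hnz).
      rewrite <- E. field; exact Hnz. }
    pose proof (E1 p u Hp Hu) as E. destruct (Hz p Hp) as [Z1 _]. rewrite Z1 in E.
    pose proof (E2 p u Hp Hu) as E'. rewrite Z in E'.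
    replace (f p u) with (g1 p u * (u - ia p))%C by (rewrite <- E; ring).
    replace (g1 p u) with (g2 p u * (u - - ia p))%C by (rewrite <- E'; ring).
    replace (RtoC (-1)) with (- (1))%C by (apply injective_projections; simpl; ring).
    field. repeat split; assumption.
Qed.

(** [gap al = 2 / 3 * zeta ^ (3 / 2)] at [theta = PI / 2 - al]. *)
Definition gap (al : R) : R := sin al - al * cos al.

Lemma gap_ge (al : R) : 0 <= al <= 1 / 2 -> al ^ 3 / 4 <= gap al.
Proof.
  intros H. unfold gap.
  pose proof (sin_ge_cubic al ltac:(lra)). pose proof (cos_le_quartic al ltac:(lra)).
  assert (al * cos al <= al * (1 - al ^ 2 / 2 + al ^ 4 / 24)) by (apply Rmult_le_compat_l; lra).
  assert (0 <= al ^ 3) by (apply pow_le; lra).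
  assert (al ^ 2 <= 1 / 4) by nra.
  assert (al ^ 5 = al ^ 3 * al ^ 2) by ring. nra.
Qed.

Lemma gap_le (al : R) : 0 <= al -> gap al <= al ^ 3 / 3.
Proof.
  intros H. apply Rminus_le_0.
  apply (nonneg_of_derive (fun x => x ^ 3 / 3 - gap x) (fun x => x * (x - sin x))); auto.
  - unfold gap. rewrite sin_0; field.
  - intros; unfold gap; auto_derive; [exact I|simpl; field].
  - intros t Ht; pose proof (sin_le_id t Ht); nra.
Qed.

Lemma sin_ge_lin (al : R) : 0 <= al <= 1 / 2 -> 9 / 10 * al <= sin al.
Proof. intros H. pose proof (sin_ge_cubic al ltac:(lra)). nra. Qed.

(** Values at the saddle points [u = +- i al] of [p'] ([j = false]) and of [(u p)' / u]
    ([j = true]), where [p = (sinh u - (sin al / al) u) / (cosh u - cos al)]. *)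
Definition sig0 (al : R) : R := (1 - cos al * gap al / (al * sin al ^ 2)) / 2.
Definition sig (j : bool) (al : R) : R :=
  if j then sig0 al + gap al / (al ^ 2 * sin al) else sig0 al.
Definition amp (j : bool) (u : C) : C := if j then u else RtoC 1.
Definition damp (j : bool) : C := if j then RtoC 1 else RtoC 0.

Lemma cder_amp (j : bool) (u : C) : cder (amp j) u (damp j).
Proof. destruct j; [exact (cder_id u)|exact (cder_const 1 u)]. Qed.

Lemma cder_den (al : R) (u : C) : cder (den al) u (csinh u).
Proof. eapply cder_eq; [apply cder_minus; [apply cder_ccosh|apply cder_const]|ring]. Qed.

Lemma sin_div_bound (al r : R) : 0 < al -> Rabs (sin (r * al) / al) <= Rabs r.
Proof.
  intros Ha. unfold Rdiv. rewrite Rabs_mult, (Rabs_right (/ al)) by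
    (apply Rle_ge, Rlt_le, Rinv_0_lt_compat; lra).
  apply Rle_div_l; [lra|].
  assert (P : forall t, Rabs (sin t) <= Rabs t).
  { assert (Q : forall t, 0 <= t -> Rabs (sin t) <= t).
    { intros t Ht. destruct (Rle_dec t 1) as [h|h].
      - pose proof (sin_le_id t Ht). pose proof (sin_ge_cubic t Ht).
        rewrite Rabs_right; nra.
      - pose proof (SIN_bound t). apply Rabs_le; lra. }
    intros t. destruct (Rle_dec 0 t).
    - rewrite (Rabs_right t) by lra. now apply Q.
    - rewrite (Rabs_left t) by lra. rewrite <- Rabs_Ropp, <- sin_neg. apply Q; lra. }
  eapply Rle_trans; [apply P|]. rewrite Rabs_mult, (Rabs_right al) by lra. lra.
Qed.

Lemma Cmult_cancel_l (z v w : C) : z <> 0 -> (z * v = z * w)%C -> v = w.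
Proof.
  intros Hz H. replace v with (/ z * (z * v))%C by (field; exact Hz).
  rewrite H. field. exact Hz.
Qed.

Definition strip_ok (al : R) (u : C) : Prop := 0 < al <= 1 / 2 /\ Rabs (Im u) < 1.

(** The affine function interpolates [exp (r u)] at [+- i al], so the difference has both zeros of
    [den]. Its coefficients are bounded by [1] and [M] for all [al], as the uniform division
    requires. *)
Lemma amplitude_order (M : R) : 0 <= M -> exists K Q Q', 0 <= K /\
  forall al r u, strip_ok al u -> Rabs r <= M ->
    Cexp (RtoC r * u) = (RtoC (cos (r * al)) + RtoC (sin (r * al) / al) * u
                          + den al u * Q al r u)%C /\
    cder (Q al r) u (Q' al r u) /\ (exists l, cder (Q' al r) u l) /\
    Cmod (Q al r u) <= K * exp (K * Rabs (Re u)) /\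
    Cmod (Q' al r u) <= K * exp (K * Rabs (Re u)).
Proof.
  intros HM.
  (* Two orders for the quotient: one for [Q'], one for the differentiability of [Q']. *)
  destruct (nice_div_den M 2 (fun p u => Cexp (RtoC (snd p) * u)
     - (RtoC (cos (snd p * fst p)) + RtoC (sin (snd p * fst p) / fst p) * u))%C)
    as (g & Ng & Eg).
  - apply nice_minus; [apply (nice_exp _ _ snd M); intros p Hp; apply Hp|].
    apply nice_plus; [|apply nice_mult; [|apply nice_id]].
    + apply (nice_const _ _ (fun p => RtoC (cos (snd p * fst p))) 1).
      intros p _. rewrite Cmod_R. apply Rabs_le, COS_bound.
    + apply (nice_const _ _ (fun p => RtoC (sin (snd p * fst p) / fst p)) M).
      intros p [Hp Hr]. rewrite Cmod_R. eapply Rle_trans; [apply sin_div_bound; lra|exact Hr].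
  - intros [al r] [Ha Hr]; simpl in *. unfold ia; simpl.
    assert (E : (RtoC (sin (r * al) / al) * (Ci * RtoC al) = Ci * RtoC (sin (r * al)))%C)
      by (apply injective_projections; simpl; field; lra).
    split.
    + rewrite E. unfold Cexp; apply injective_projections; simpl.
      * replace (r * _ - _) with 0 by ring. replace (r * (0 * 0 + 1 * al) + _) with (r * al) by ring.
        rewrite exp_0; ring.
      * replace (r * _ - _) with 0 by ring. replace (r * (0 * 0 + 1 * al) + _) with (r * al) by ring.
        rewrite exp_0; ring.
    + replace (RtoC (sin (r * al) / al) * - (Ci * RtoC al))%C
        with (- (Ci * RtoC (sin (r * al))))%C by (rewrite <- E; ring).
      unfold Cexp; apply injective_projections; simpl.
      * replace (r * - _ - _) with 0 by ring.
        replace (r * - (0 * 0 + 1 * al) + _) with (- (r * al)) by ring.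
        rewrite exp_0, cos_neg; ring.
      * replace (r * - _ - _) with 0 by ring.
        replace (r * - (0 * 0 + 1 * al) + _) with (- (r * al)) by ring.
        rewrite exp_0, sin_neg; ring.
  - destruct Ng as [(K & HK & Bg) (g' & Dg & Ng')].
    destruct Ng' as [(K' & HK' & Bg') (g'' & Dg' & _)].
    exists (Rmax K K'), (fun al r => g (al, r)), (fun al r => g' (al, r)).
    pose proof (Rmax_l K K'); pose proof (Rmax_r K K').
    split; [lra|]. intros al r u [Ha Hu] Hr.
    assert (Hp : pdom M (al, r)) by (split; assumption).
    specialize (Eg _ u Hp Hu); simpl in Eg.
    split; [|split; [|split; [|split]]].
    + rewrite <- Eg. ring.
    + now apply Dg.
    + eexists; now apply Dg'.
    + eapply Rle_trans; [now apply Bg|]. apply exp_bound_le; [lra|apply Rabs_pos].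
    + eapply Rle_trans; [now apply Bg'|]. apply exp_bound_le; [lra|apply Rabs_pos].
Qed.

(* Differentiating [den * p = csinh - (sin al / al) u] once and twice at the zeros of
   [den] gives the values of [p] and [p'] there. *)
Lemma saddle_values (al e : R) (f f1 f2 : C -> C) :
  0 < al <= 1 / 2 -> e = 1 \/ e = -1 ->
  (forall u, Rabs (Im u) < 1 -> (den al u * f u = csinh u - RtoC (sin al / al) * u)%C) ->
  (forall u, Rabs (Im u) < 1 -> cder f u (f1 u)) ->
  (forall u, Rabs (Im u) < 1 -> cder f1 u (f2 u)) ->
  let a := (RtoC e * (Ci * RtoC al))%C in
  f a = (a * RtoC (gap al / (al ^ 2 * sin al)))%C /\ f1 a = RtoC (sig0 al).
Proof.
  intros Hal He H0 H1 H2 a.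
  pose proof (sin_ge_lin al ltac:(lra)) as Hs.
  set (s := sin al) in *. set (c := cos al).
  assert (Loc : forall (g h : C -> C) (u l m : C), Rabs (Im u) < 1 ->
     (forall v, Rabs (Im v) < 1 -> g v = h v) -> cder g u l -> cder h u m -> l = m).
  { intros g h u l m Hu E Hg Hh. apply (cder_unique h u); [|exact Hh].
    apply (cder_ext_loc g h u l (1 - Rabs (Im u))); [lra| |exact Hg].
    intros k Hk. now apply E, strip_ball. }
  assert (E1 : forall u, Rabs (Im u) < 1 ->
     (csinh u * f u + den al u * f1 u = ccosh u - RtoC (s / al))%C).
  { intros u Hu.
    apply (Loc (fun u => den al u * f u)%C (fun u => csinh u - RtoC (s / al) * u)%C u); auto.
    - apply cder_mult; [apply cder_den|now apply H1].
    - eapply cder_eq; [apply cder_minus; [apply cder_csinh|apply cder_scal, cder_id]|ring]. }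
  assert (E2 : forall u, Rabs (Im u) < 1 ->
     (ccosh u * f u + csinh u * f1 u + (csinh u * f1 u + den al u * f2 u) = csinh u)%C).
  { intros u Hu.
    apply (Loc (fun u => csinh u * f u + den al u * f1 u)%C
               (fun u => ccosh u - RtoC (s / al))%C u); auto.
    - apply cder_plus; apply cder_mult; auto using cder_csinh, cder_den.
    - eapply cder_eq; [apply cder_minus; [apply cder_ccosh|apply cder_const]|ring]. }
  assert (Hsa : csinh a = (RtoC e * (Ci * RtoC s))%C /\ ccosh a = RtoC c).
  { unfold a. replace (RtoC e * (Ci * RtoC al))%C with (Ci * RtoC (e * al))%C
      by (rewrite RtoC_mult; ring).
    rewrite csinh_i, ccosh_i.
    destruct He as [-> | ->].
    - rewrite Rmult_1_l. split; [fold s; ring|reflexivity].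
    - replace (-1 * al) with (- al) by ring. rewrite sin_neg, cos_neg. split; [|reflexivity].
      apply injective_projections; simpl; fold s; ring. }
  destruct Hsa as [Sa Ca].
  assert (Da : den al a = 0) by (unfold den; rewrite Ca; unfold c; ring).
  assert (Ha : Rabs (Im a) < 1).
  { unfold a; simpl. destruct He as [-> | ->]; [rewrite Rabs_right|rewrite Rabs_left]; lra. }
  specialize (E1 a Ha). specialize (E2 a Ha). rewrite Da, Sa, Ca in E1, E2.
  assert (Hnz : (RtoC e * (Ci * RtoC s))%C <> 0).
  { intros H. apply (f_equal snd) in H; simpl in H. destruct He as [-> | ->]; lra. }
  assert (V0 : f a = (a * RtoC (gap al / (al ^ 2 * s)))%C).
  { apply (Cmult_cancel_l (RtoC e * (Ci * RtoC s))%C); [exact Hnz|].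
    transitivity (RtoC c - RtoC (s / al))%C; [rewrite <- E1; ring|].
    unfold a, gap; fold s c.
    apply injective_projections; simpl; destruct He as [-> | ->]; field; lra. }
  split; [exact V0|].
  apply (Cmult_cancel_l (RtoC e * (Ci * RtoC s))%C); [exact Hnz|].
  apply (Cmult_cancel_l 2); [exact C2_neq_0|].
  transitivity (RtoC e * (Ci * RtoC s) - RtoC c * f a)%C.
  { transitivity (RtoC c * f a + RtoC e * (Ci * RtoC s) * f1 a
      + (RtoC e * (Ci * RtoC s) * f1 a + 0 * f2 a) - RtoC c * f a)%C; [ring|].
    rewrite E2. reflexivity. }
  rewrite V0. unfold a, sig0; fold s c.
  apply injective_projections; simpl; field; lra.
Qed.

(** After division by [den], [p] carries the change of the phase along the path. An integration by
    parts differentiates [p * amp j], and this derivative is again reduced modulo [den], with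
    quotient [m]. One constant [sig j al] serves both saddle points because at them [p] behaves as
    an odd and [p'] as an even function. *)
Lemma amplitude_path : exists K p p', 0 <= K /\
  (forall al u, strip_ok al u ->
    (den al u * p al u = csinh u - RtoC (sin al / al) * u)%C /\
    cder (p al) u (p' al u) /\ (exists l, cder (p' al) u l) /\
    Cmod (p al u) <= K * exp (K * Rabs (Re u))) /\
  forall j, exists m m', forall al u, strip_ok al u ->
    (p' al u * amp j u + p al u * damp j = RtoC (sig j al) * amp j u + den al u * m al u)%C /\
    cder (m al) u (m' al u) /\ (exists l, cder (m' al) u l) /\
    Cmod (m al u) <= K * exp (K * Rabs (Re u)) /\
    Cmod (m' al u) <= K * exp (K * Rabs (Re u)).
Proof.
  (* Seven orders: one to form [p'], four for the second division by [den], two for [m] and [m']. *)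
  destruct (nice_div_den 0 7 (fun p u => csinh u - RtoC (sin (fst p) / fst p) * u)%C)
    as (g & Ng & Eg).
  { apply nice_minus; [apply nice_csinh|]. apply nice_mult; [|apply nice_id].
    apply (nice_const _ _ (fun p => RtoC (sin (fst p) / fst p)) 1).
    intros p [Hp _]. rewrite Cmod_R.
    pose proof (sin_div_bound (fst p) 1 ltac:(lra)) as B.
    rewrite Rmult_1_l, Rabs_R1 in B. exact B. }
  { intros [al r] [Ha _]; simpl in *. unfold ia; simpl.
    assert (E : (RtoC (sin al / al) * (Ci * RtoC al) = Ci * RtoC (sin al))%C)
      by (apply injective_projections; simpl; field; lra).
    split; [rewrite E, csinh_i; ring|].
    replace (- (Ci * RtoC al))%C with (Ci * RtoC (- al))%C by (rewrite RtoC_opp; ring).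
    rewrite csinh_i, sin_neg.
    replace (RtoC (sin al / al) * (Ci * RtoC (- al)))%C with (- (Ci * RtoC (sin al)))%C
      by (rewrite <- E, RtoC_opp; ring).
    rewrite RtoC_opp; ring. }
  pose proof Ng as Ng0. destruct Ng as [(K0 & HK0 & Bg) (g' & Dg & Ng')].
  pose proof Ng' as Ng1. destruct Ng1 as [(K1 & HK1 & Bg') (g'' & Dg' & _)].
  assert (Hdom : forall al u, strip_ok al u -> pdom 0 (al, 0)).
  { intros al u [Ha _]. split; [exact Ha|]. simpl. rewrite Rabs_R0; lra. }
  assert (Vals : forall al r e, pdom 0 (al, r) -> e = 1 \/ e = -1 ->
    g (al, r) (RtoC e * (Ci * RtoC al))%C
      = (RtoC e * (Ci * RtoC al) * RtoC (gap al / (al ^ 2 * sin al)))%C /\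
    g' (al, r) (RtoC e * (Ci * RtoC al))%C = RtoC (sig0 al)).
  { intros al r e Hp He. apply (saddle_values al e _ _ (g'' (al, r))); auto.
    - apply Hp.
    - intros u Hu. symmetry. apply (Eg (al, r) u Hp Hu). }
  (* The uniform bound of [p'] at the saddle point bounds [sig0], which spares an expansion of its
     formula at [al = 0]. *)
  assert (Bs0 : forall p, pdom 0 p -> Cmod (RtoC (sig0 (fst p))) <= K1).
  { intros [al r] Hp; simpl.
    rewrite <- (proj2 (Vals al r 1 Hp ltac:(now left))).
    assert (Hi : Rabs (Im (RtoC 1 * (Ci * RtoC al))%C) < 1).
    { destruct Hp as [Hp _]; simpl in *. rewrite Rabs_right; lra. }
    eapply Rle_trans; [now apply Bg'|].
    replace (Re (RtoC 1 * (Ci * RtoC al))%C) with 0 by (simpl; ring).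
    rewrite Rabs_R0, Rmult_0_r, exp_0; lra. }
  assert (Bs : forall j p, pdom 0 p -> Cmod (RtoC (sig j (fst p))) <= K1 + 1).
  { intros [] p Hp; unfold sig; [|specialize (Bs0 p Hp); lra].
    rewrite RtoC_plus. apply Cmod_le_plus; [auto|].
    destruct Hp as [Hp _]. rewrite Cmod_R.
    pose proof (gap_ge (fst p) ltac:(lra)). pose proof (gap_le (fst p) ltac:(lra)).
    pose proof (sin_ge_lin (fst p) ltac:(lra)).
    assert (0 < fst p ^ 3) by (apply pow_lt; lra).
    assert (0 < fst p ^ 2) by (apply pow_lt; lra).
    assert (Hq : fst p ^ 3 / 3 <= fst p ^ 2 * sin (fst p)).
    { replace (fst p ^ 3 / 3) with (fst p ^ 2 * (fst p / 3)) by field.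
      apply Rmult_le_compat_l; lra. }
    rewrite Rabs_right.
    - apply Rle_div_l; lra.
    - apply Rle_ge, Rmult_le_pos; [lra|]. apply Rlt_le, Rinv_0_lt_compat; lra. }
  assert (Hm : forall j, exists m, nice (pdom 0) 2 m /\
     forall p u, pdom 0 p -> Rabs (Im u) < 1 ->
       (g' p u * amp j u + g p u * damp j - RtoC (sig j (fst p)) * amp j u
          = den (fst p) u * m p u)%C).
  { intros j.
    assert (Na : nice (pdom 0) 6 (fun _ => amp j)).
    { destruct j; [apply nice_id|].
      apply (nice_const _ _ (fun _ => RtoC 1) 1). intros; rewrite Cmod_1; lra. }
    apply nice_div_den.
    - apply nice_minus; [apply nice_plus|]; apply nice_mult; auto.
      + exact (nice_le _ _ _ Ng0).
      + apply (nice_const _ _ (fun _ => damp j) 1).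
        intros; destruct j; simpl; rewrite ?Cmod_1, ?Cmod_0; lra.
      + apply (nice_const _ _ (fun p => RtoC (sig j (fst p))) (K1 + 1)); auto.
    - intros [al r] Hp.
      destruct (Vals al r 1 Hp ltac:(now left)) as [V1 V2].
      destruct (Vals al r (-1) Hp ltac:(now right)) as [V3 V4].
      unfold ia; simpl fst.
      replace (RtoC 1 * (Ci * RtoC al))%C with (Ci * RtoC al)%C in V1, V2 by ring.
      replace (RtoC (-1) * (Ci * RtoC al))%C with (- (Ci * RtoC al))%C in V3, V4
        by (apply injective_projections; simpl; ring).
      destruct j; cbn [amp damp sig fst]; rewrite ?V1, ?V2, ?V3, ?V4, ?RtoC_plus; split; ring. }
  destruct (Hm false) as (m0 & Nm0 & Em0), (Hm true) as (m1 & Nm1 & Em1).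
  destruct Nm0 as [(L0 & HL0 & Bm0) (m0' & Dm0 & Nm0')].
  destruct Nm0' as [(L0' & HL0' & Bm0') (m0'' & Dm0' & _)].
  destruct Nm1 as [(L1 & HL1 & Bm1) (m1' & Dm1 & Nm1')].
  destruct Nm1' as [(L1' & HL1' & Bm1') (m1'' & Dm1' & _)].
  exists (K0 + L0 + L0' + L1 + L1'), (fun al => g (al, 0)), (fun al => g' (al, 0)).
  split; [lra|split].
  - intros al u Hok. pose proof (Hdom al u Hok) as Hp. destruct Hok as [Ha Hu].
    split; [symmetry; apply (Eg (al, 0)); assumption|split; [now apply Dg|split]].
    + eexists; now apply Dg'.
    + eapply Rle_trans; [now apply Bg|]. apply exp_bound_le; [lra|apply Rabs_pos].
  - intros [].
    + exists (fun al => m1 (al, 0)), (fun al => m1' (al, 0)).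
      intros al u Hok. pose proof (Hdom al u Hok) as Hp. destruct Hok as [Ha Hu].
      split; [|split; [now apply Dm1|split; [eexists; now apply Dm1'|split]]].
      * specialize (Em1 _ u Hp Hu). simpl fst in Em1. rewrite <- Em1. ring.
      * eapply Rle_trans; [now apply Bm1|]. apply exp_bound_le; [lra|apply Rabs_pos].
      * eapply Rle_trans; [now apply Bm1'|]. apply exp_bound_le; [lra|apply Rabs_pos].
    + exists (fun al => m0 (al, 0)), (fun al => m0' (al, 0)).
      intros al u Hok. pose proof (Hdom al u Hok) as Hp. destruct Hok as [Ha Hu].
      split; [|split; [now apply Dm0|split; [eexists; now apply Dm0'|split]]].
      * specialize (Em0 _ u Hp Hu). simpl fst in Em0. rewrite <- Em0. ring.
      * eapply Rle_trans; [now apply Bm0|]. apply exp_bound_le; [lra|apply Rabs_pos].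
      * eapply Rle_trans; [now apply Bm0'|]. apply exp_bound_le; [lra|apply Rabs_pos].
Qed.

(** * The integral on the shifted line *)

Definition ker (y al : R) (u : C) : C :=
  Cexp (- Ci * RtoC y * (csinh u - RtoC (cos al) * u))%C.

(** A point of the line of integration divided by [al]; in this coordinate the saddle points are
    [+- i], whatever [al]. *)
Definition lineb (b x : R) : C := (RtoC x - Ci * RtoC b)%C.

Lemma rder_lineb (b x : R) : rder (lineb b) x 1.
Proof.
  eapply rder_eq; [apply rder_minus; [apply rder_id|apply rder_const]|ring].
Qed.

Lemma rder_scaled_line (al b x : R) : rder (fun x => RtoC al * lineb b x)%C x (RtoC al).
Proof.
  eapply rder_eq; [apply rder_mult; [apply rder_const|apply rder_lineb]|cbv beta; ring].
Qed.

Lemma cder_ker (y al : R) (u : C) :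
  cder (ker y al) u (- Ci * RtoC y * den al u * ker y al u)%C.
Proof.
  eapply cder_eq.
  - apply (cder_comp Cexp (fun u => - Ci * RtoC y * (csinh u - RtoC (cos al) * u))%C);
      [apply cder_Cexp|].
    apply cder_scal, cder_minus; [apply cder_csinh|apply cder_scal, cder_id].
  - fold (ker y al u). unfold den. ring.
Qed.

Lemma Cmod_ker (y al b x : R) : Cmod (ker y al (RtoC al * lineb b x)) =
  exp (- (y * (sin (al * b) * cosh (al * x) - al * b * cos al))).
Proof.
  unfold ker. rewrite Cmod_Cexp. f_equal.
  replace (RtoC al * lineb b x)%C with (al * x, - (al * b))
    by (unfold lineb; apply injective_projections; simpl; ring).
  rewrite csinh_components, cos_neg, sin_neg. simpl; unfold Re, Im; simpl. ring.
Qed.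

(** [b] is the height of the line of integration in units of [al]: the line passes
    through the saddle point unless the two saddle points are within the width
    [y ^ (-1/3)] of the peak. *)
Definition good (y al b : R) : Prop :=
  0 < al <= 1 / 2 /\ 0 < y /\ 1 <= b /\ al * b <= 1 / 2 /\
  ((b = 1 /\ 1 <= y * gap al) \/ (y * gap al <= 1 /\ b ^ 3 * (y * gap al) = 1)).

Lemma gap_pos (al : R) : 0 < al <= 1 / 2 -> 0 < gap al.
Proof.
  intros H. pose proof (gap_ge al ltac:(lra)). assert (0 < al ^ 3) by (apply pow_lt; lra). lra.
Qed.

(** The second inequality makes the Gaussian [exp (- xi b x^2)] at least as small as
    [exp (- (al x)^2)], so that it absorbs any [exp (K |al x|)] at bounded cost. If [b > 1] it
    amounts to [xi b = 1 / b^2] and [al b <= 1 / 2]. *)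
Lemma good_xi (y al b : R) : good y al b -> 0 < y * gap al * b /\ al ^ 2 <= y * gap al * b.
Proof.
  intros (Ha & Hy & Hb & Hab & H). pose proof (gap_pos al Ha).
  assert (0 < y * gap al) by nra. split; [nra|].
  destruct H as [[-> H] | [_ H]]; [nra|].
  assert (E : y * gap al * b * b ^ 2 = 1) by (rewrite <- H; ring).
  assert (0 < b ^ 2) by nra.
  apply Rmult_le_reg_r with (b ^ 2); [assumption|]. rewrite E.
  replace (al ^ 2 * b ^ 2) with ((al * b) ^ 2) by ring. assert (0 <= al * b) by nra. nra.
Qed.

(** With [sin (al b) >= 9/10 al b], [cosh t - 1 >= t^2 / 2] and [y al^3 >= 3 xi], the quadratic term
    gets the coefficient [3 * 9/20 = 27/20]. The additive [2] pays for the lines with [b > 1], where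
    [xi <= 1] and [y (al b)^3 <= 4]. *)
Lemma ker_gauss (y al b x : R) : good y al b ->
  Cmod (ker y al (RtoC al * lineb b x)) <=
    exp (2 - y * gap al - 27 / 20 * (y * gap al * b * x ^ 2)).
Proof.
  intros G.
  destruct G as (Ha & Hy & Hb & Hab & H).
  pose proof (gap_pos al Ha) as Hg.
  pose proof (gap_ge al ltac:(lra)) as Hg1. pose proof (gap_le al ltac:(lra)) as Hg2.
  set (xi := y * gap al) in *.
  assert (A3 : 0 < al ^ 3) by (apply pow_lt; lra).
  assert (Hya : 3 * xi <= y * al ^ 3 <= 4 * xi) by (unfold xi; nra).
  assert (Hbe : 0 < al * b) by nra.
  rewrite Cmod_ker.
  assert (S1 : 9 / 10 * (al * b) <= sin (al * b)) by (apply sin_ge_lin; lra).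
  assert (S2 : xi - 2 <= y * (sin (al * b) - al * b * cos al)).
  { destruct H as [[-> H] | [H1 H2]].
    - rewrite !Rmult_1_r. fold (gap al). fold xi. lra.
    - pose proof (sin_ge_cubic (al * b) ltac:(lra)) as S.
      assert (Hc : al * b * cos al <= al * b).
      { pose proof (COS_bound al). nra. }
      assert (Hb3 : y * (al * b) ^ 3 <= 4).
      { replace (y * (al * b) ^ 3) with (y * al ^ 3 * b ^ 3) by ring.
        assert (0 < b ^ 3) by (apply pow_lt; lra). nra. }
      assert (y * (- ((al * b) ^ 3 / 6)) <= y * (sin (al * b) - al * b * cos al)).
      { apply Rmult_le_compat_l; lra. }
      lra. }
  assert (S3 : 27 / 20 * (xi * b * x ^ 2) <= y * (sin (al * b) * (cosh (al * x) - 1))).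
  { pose proof (cosh_ge_quad (al * x)) as Hc.
    assert (Hx : 0 <= x ^ 2) by nra.
    assert (Q : 9 / 10 * (al * b) * ((al * x) ^ 2 / 2) <= sin (al * b) * (cosh (al * x) - 1)).
    { apply Rmult_le_compat; nra. }
    apply (Rmult_le_compat_l y) in Q; [|lra].
    replace (y * (9 / 10 * (al * b) * ((al * x) ^ 2 / 2)))
      with (9 / 20 * (y * al ^ 3) * (b * x ^ 2)) in Q by field.
    assert (0 <= b * x ^ 2) by nra.
    assert (3 * xi * (b * x ^ 2) <= y * al ^ 3 * (b * x ^ 2)) by (apply Rmult_le_compat_r; lra).
    lra. }
  apply exp_le_compat. lra.
Qed.

(** Of the coefficient [27/20], the part [7/20] absorbs [exp (K |al x|)] at the price [exp (K^2)];
    the part [1] becomes the Lorentz profile through [exp (- z) <= 1 / (1 + z)]. *)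
Lemma ker_bound (y al b x K : R) : good y al b -> 0 <= K ->
  Cmod (ker y al (RtoC al * lineb b x)) * exp (K * Rabs (al * x))
    <= exp (2 + K ^ 2) * exp (- (y * gap al)) / (1 + y * gap al * b * x ^ 2).
Proof.
  intros G HK. pose proof (good_xi y al b G) as [X1 X2].
  pose proof (ker_gauss y al b x G) as HG.
  set (xi := y * gap al) in *.
  assert (S4 : K * Rabs (al * x) <= K ^ 2 + 7 / 20 * (xi * b * x ^ 2)).
  { set (q := Rabs (al * x)).
    assert (Hq : q ^ 2 = al ^ 2 * x ^ 2).
    { unfold q. rewrite <- Rsqr_pow2, <- Rsqr_abs, Rsqr_pow2. ring. }
    assert (q ^ 2 <= xi * b * x ^ 2).
    { rewrite Hq. apply Rmult_le_compat_r; nra. }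
    pose proof (pow2_ge_0 (K - q / 2)). pose proof (pow2_ge_0 q). lra. }
  apply Rle_trans with (exp (2 + K ^ 2 + - xi + - (xi * b * x ^ 2))).
  - eapply Rle_trans; [apply Rmult_le_compat_r; [apply Rlt_le, exp_pos|exact HG]|].
    rewrite <- exp_plus. apply exp_le_compat. lra.
  - rewrite !exp_plus. unfold Rdiv. apply Rmult_le_compat_l.
    + apply Rmult_le_pos; [apply Rmult_le_pos|]; apply Rlt_le, exp_pos.
    + rewrite exp_Ropp. apply Rinv_le_contravar.
      * assert (0 <= x ^ 2) by nra. nra.
      * apply exp_ineq1_le.
Qed.

Lemma strip_line (y al b x : R) : good y al b ->
  strip_ok al (RtoC al * lineb b x)%C /\ Re (RtoC al * lineb b x)%C = al * x.
Proof.
  intros (Ha & _ & Hb & Hab & _). unfold strip_ok, lineb; simpl. unfold Re, Im; simpl.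
  split; [split; [exact Ha|]|ring].
  replace (al * _ + _) with (- (al * b)) by ring. rewrite Rabs_Ropp, Rabs_right; nra.
Qed.

Lemma ker_mult_bound (y al b x K B : R) (h : C) : good y al b -> 0 <= K -> 0 <= B ->
  Cmod h <= B * exp (K * Rabs (al * x)) ->
  Cmod (ker y al (RtoC al * lineb b x) * h)%C <=
    B * (exp (2 + K ^ 2) * exp (- (y * gap al))) / (1 + y * gap al * b * x ^ 2).
Proof.
  intros G HK HB Hh. rewrite Cmod_mult.
  pose proof (ker_bound y al b x K G HK) as T. pose proof (Cmod_ge_0 (ker y al (RtoC al * lineb b x))).
  apply Rle_trans with (Cmod (ker y al (RtoC al * lineb b x)) * (B * exp (K * Rabs (al * x)))).
  - now apply Rmult_le_compat_l.
  - unfold Rdiv in *. apply (Rmult_le_compat_l B) in T; [|exact HB]. lra.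
Qed.

Lemma ccont_holo_line (H : C -> C) (al b x : R) (l : C) :
  cder H (RtoC al * lineb b x)%C l -> ccont (fun x => H (RtoC al * lineb b x)%C) x.
Proof.
  intros D. eapply rder_ccont, (rder_cder H (fun x => RtoC al * lineb b x)%C);
    [exact D|apply rder_scaled_line].
Qed.

Lemma ccont_ker (y al b x : R) : ccont (fun x => ker y al (RtoC al * lineb b x)) x.
Proof. eapply ccont_holo_line, cder_ker. Qed.

(** The logarithmic derivative of [ker] is [- i y den], and [du = al dx], whence the factor
    [1 / (al y)]. The end-point terms are kept explicit; they fade as [N] grows. *)
Lemma ker_by_parts (y al b K : R) (H H' : C -> C) : good y al b -> 0 <= K ->
  (forall u, strip_ok al u -> cder H u (H' u) /\ (exists l, cder H' u l) /\
     Cmod (H u) <= K * exp (K * Rabs (Re u)) /\ Cmod (H' u) <= K * exp (K * Rabs (Re u))) ->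
  forall N, 0 < N ->
  Cmod (CInt (fun x => ker y al (RtoC al * lineb b x) *
           (den al (RtoC al * lineb b x) * H (RtoC al * lineb b x)))%C (- N) N)
  <= / (al * y) * (2 * (K * (exp (2 + K ^ 2) * exp (- (y * gap al))) / (1 + y * gap al * b * N ^ 2))
       + al * (K * (exp (2 + K ^ 2) * exp (- (y * gap al))) * PI / sqrt (y * gap al * b))).
Proof.
  intros G HK HH N HN. pose proof (good_xi y al b G) as [X1 _].
  pose proof G as (Ha & Hy & _).
  assert (Hs : forall x, strip_ok al (RtoC al * lineb b x)%C) by (intros x; apply (strip_line y al b x G)).
  assert (Hre : forall x, Re (RtoC al * lineb b x)%C = al * x) by (intros x; apply (strip_line y al b x G)).
  set (u := fun x => (RtoC al * lineb b x)%C) in *.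
  set (c := (Ci * RtoC (/ (al * y)))%C).
  assert (Bd : forall x, Cmod (ker y al (u x) * H (u x))%C <=
     K * (exp (2 + K ^ 2) * exp (- (y * gap al))) / (1 + y * gap al * b * x ^ 2)).
  { intros x. apply ker_mult_bound; auto. rewrite <- Hre. now apply HH. }
  assert (CH : forall x, ccont (fun x => H (u x)) x).
  { intros x. destruct (HH (u x) (Hs x)) as (D & _). eapply ccont_holo_line, D. }
  assert (CH' : forall x, ccont (fun x => H' (u x)) x).
  { intros x. destruct (HH (u x) (Hs x)) as (_ & [l D] & _). eapply ccont_holo_line, D. }
  assert (Cd : forall x, ccont (fun x => den al (u x)) x).
  { intros x. eapply ccont_holo_line, cder_den. }
  assert (Ck : forall x, ccont (fun x => ker y al (u x)) x) by (intros; apply ccont_ker).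
  assert (E : CInt (fun x => ker y al (u x) * (den al (u x) * H (u x)))%C (- N) N =
     (c * (ker y al (u N) * H (u N) - ker y al (u (- N)%R) * H (u (- N)%R))
      + (- c * RtoC al) * CInt (fun x => ker y al (u x) * H' (u x)) (- N)%R N)%C).
  { rewrite <- (CInt_FTC (fun x => RtoC al * (- Ci * RtoC y * den al (u x) * ker y al (u x) * H (u x)
        + ker y al (u x) * H' (u x)))%C (fun x => ker y al (u x) * H (u x))%C (- N) N); [|lra| |].
    - rewrite <- !CInt_scal.
      + rewrite <- CInt_plus.
        * apply CInt_ext; [lra|]. intros x _. unfold c.
          replace (RtoC (/ (al * y))) with (/ (RtoC al * RtoC y))%C
            by (rewrite RtoC_inv, RtoC_mult; [reflexivity|nra]).
          assert (RtoC al <> 0) by (apply RtoC_neq_0; lra).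
          assert (RtoC y <> 0) by (apply RtoC_neq_0; lra).
          assert (I2 : (Ci * Ci = - (1))%C) by (apply injective_projections; simpl; ring).
          transitivity (- (Ci * Ci) * (ker y al (u x) * (den al (u x) * H (u x))))%C;
            [rewrite I2; ring|field; split; assumption].
        * lra.
        * intros x _. ccont_tac.
        * intros x _. ccont_tac.
      + lra.
      + intros x _. ccont_tac.
      + lra.
      + intros x _. ccont_tac.
    - intros x _. ccont_tac.
    - intros x _. eapply rder_eq.
      + apply rder_mult.
        * apply (rder_cder (ker y al) u); [apply cder_ker|apply rder_scaled_line].
        * apply (rder_cder H u); [exact (proj1 (HH (u x) (Hs x)))|apply rder_scaled_line].
      + cbv beta; ring. }
  fold (u N). change (Cmod (CInt (fun x => ker y al (u x) * (den al (u x) * H (u x)))%C (- N) N)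
    <= / (al * y) * (2 * (K * (exp (2 + K ^ 2) * exp (- (y * gap al))) / (1 + y * gap al * b * N ^ 2))
       + al * (K * (exp (2 + K ^ 2) * exp (- (y * gap al))) * PI / sqrt (y * gap al * b)))).
  rewrite E.
  assert (Hc : Cmod c = / (al * y)).
  { unfold c. rewrite Cmod_mult, Cmod_Ci, Cmod_R, Rabs_right, Rmult_1_l; [reflexivity|].
    apply Rle_ge, Rlt_le, Rinv_0_lt_compat. nra. }
  rewrite Rmult_plus_distr_l. apply Cmod_le_plus.
  - apply Cmod_le_mult; [lra|].
    replace (2 * _) with (K * (exp (2 + K ^ 2) * exp (- (y * gap al))) / (1 + y * gap al * b * N ^ 2)
      + K * (exp (2 + K ^ 2) * exp (- (y * gap al))) / (1 + y * gap al * b * (- N) ^ 2))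
      by (replace ((- N) ^ 2) with (N ^ 2) by ring; ring).
    now apply Cmod_le_minus.
  - rewrite <- Rmult_assoc. apply Cmod_le_mult.
    + rewrite Cmod_mult, Cmod_opp, Hc, Cmod_R, Rabs_right; lra.
    + apply CInt_lorentz; auto.
      * intros x. apply ccont_mult; [apply ccont_ker|auto].
      * intros x. apply ker_mult_bound; auto. rewrite <- Hre. now apply HH.
Qed.

(** * The path of constant value at the saddle point *)

Lemma gap_pos_1 (al : R) : 0 < al <= 1 -> 0 < gap al.
Proof.
  intros H. unfold gap.
  pose proof (sin_ge_cubic al ltac:(lra)). pose proof (cos_le_quartic al ltac:(lra)).
  assert (al * cos al <= al * (1 - al ^ 2 / 2 + al ^ 4 / 24)) by (apply Rmult_le_compat_l; lra).
  assert (0 < al ^ 3) by (apply pow_lt; lra).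
  assert (al ^ 2 <= 1) by nra.
  assert (al ^ 5 = al ^ 3 * al ^ 2) by ring. nra.
Qed.

(** [nrm] is the integrating factor of the linear differential equation that the integral
    satisfies, up to a relative error [1 / y], along the path on which [y * gap al = xi]. *)
Definition scl (j : bool) (al : R) : R := if j then al else 1.
Definition nrm (xi al : R) : R := al * sqrt (xi * sin al / gap al).
(** The logarithmic derivative of [nrm xi]. The same [lam] serves both amplitudes: for [j = true]
    the derivative of [w^2], with [w = lineb b x], contributes [2 / al] instead of [1 / al], and the
    excess cancels against the additional term of [sig true]. *)
Definition lam (al : R) : R := / al - al * sin al / gap al * sig0 al.

Definition integrand (j : bool) (xi b al x : R) : C :=
  (ker (xi / gap al) al (RtoC al * lineb b x) * amp j (lineb b x))%C.

(** One [b] serves the whole path: the alternatives in [good] involve [y] and [al] only through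
    [y * gap al = xi], and [al b <= 1 / 2] improves as [al] decreases. *)
Lemma good_path (xi b al al1 : R) : 0 < al1 <= al -> good (xi / gap al) al b ->
  good (xi / gap al1) al1 b /\ xi / gap al1 * gap al1 = xi /\ 0 < xi.
Proof.
  intros H (Ha & Hy & Hb & Hab & Hc).
  pose proof (gap_pos al Ha). pose proof (gap_pos al1 ltac:(lra)).
  assert (E : xi / gap al * gap al = xi) by (field; lra).
  assert (E1 : xi / gap al1 * gap al1 = xi) by (field; lra).
  assert (Hxi : 0 < xi) by (rewrite <- E; nra).
  split; [|split; assumption].
  unfold good. rewrite E1. rewrite E in Hc.
  repeat split; try lra; try exact Hc; try nra.
Qed.

(** The square of [nrm] is [xi] times [al^2 sin al / gap al], a ratio close to [3] that the cubic
    bounds of [gap] place between [1] and [4]. *)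
Lemma nrm_bounds (xi al : R) : 0 < xi -> 0 < al <= 1 / 2 ->
  sqrt xi <= nrm xi al <= 2 * sqrt xi.
Proof.
  intros Hxi Ha.
  pose proof (gap_pos al Ha) as Hg. pose proof (gap_ge al ltac:(lra)) as Hg1.
  pose proof (gap_le al ltac:(lra)) as Hg2. pose proof (sin_ge_lin al ltac:(lra)) as Hs1.
  pose proof (sin_le_id al ltac:(lra)) as Hs2.
  assert (A3 : 0 < al ^ 3) by (apply pow_lt; lra).
  assert (A2 : 0 < al ^ 2) by (apply pow_lt; lra).
  assert (E : nrm xi al = sqrt (al ^ 2 * (xi * sin al / gap al))).
  { rewrite sqrt_mult; [rewrite sqrt_pow2 by lra; reflexivity|lra|].
    apply Rmult_le_pos; [nra|apply Rlt_le, Rinv_0_lt_compat; lra]. }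
  rewrite E.
  assert (E2 : 2 * sqrt xi = sqrt (2 ^ 2 * xi)).
  { rewrite sqrt_mult, sqrt_pow2 by lra. reflexivity. }
  assert (E3 : al ^ 2 * (xi * sin al / gap al) = xi * (al ^ 2 * sin al / gap al)) by (field; lra).
  rewrite E2, E3. split; apply sqrt_le_1_alt.
  - rewrite <- (Rmult_1_r xi) at 1. apply Rmult_le_compat_l; [lra|].
    apply Rle_div_r; [lra|]. nra.
  - rewrite (Rmult_comm (2 ^ 2)). apply Rmult_le_compat_l; [lra|].
    apply Rle_div_l; [lra|]. nra.
Qed.

Lemma nrm_derive (xi al : R) : 0 < xi -> 0 < al <= 1 / 2 ->
  is_derive (nrm xi) al (nrm xi al * lam al).
Proof.
  intros Hxi Ha.
  pose proof (gap_pos al Ha) as Hg. pose proof (sin_ge_lin al ltac:(lra)) as Hs.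
  assert (Hh : 0 < xi * sin al / gap al) by (apply Rdiv_lt_0_compat; nra).
  pose proof (sqrt_lt_R0 _ Hh) as Hq. pose proof (sqrt_sqrt _ (Rlt_le _ _ Hh)) as Hqq.
  assert (D1 : is_derive (fun al => xi * sin al / gap al) al
     (xi * (cos al * gap al - sin al * (al * sin al)) / gap al ^ 2)).
  { unfold gap in *. auto_derive; [lra|]. field. lra. }
  assert (D2 := is_derive_sqrt _ _ _ D1 Hh).
  evar_last.
  { apply (is_derive_mult (fun al => al) _ al _ _ (is_derive_id al) D2).
    intros; apply Rmult_comm. }
  unfold plus, mult, one, scal; simpl; unfold mult; simpl.
  unfold nrm, lam, sig0. set (q := sqrt (xi * sin al / gap al)) in *.
  match goal with |- ?a = ?b => change (@eq R a b) end.
  (* After multiplication by the square root only its square occurs, which is rational in the other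
     quantities. *)
  apply Rmult_eq_reg_r with q; [|lra].
  set (s := sin al) in *. set (c := cos al) in *.
  set (g := gap al) in *.
  field_simplify_eq; [|repeat split; lra].
  replace (q ^ 2) with (xi * s / g) by (rewrite <- Hqq; ring).
  field. repeat split; lra.
Qed.

Lemma cc2_fst_ex (f : R -> R) (x y : R) : ex_derive f x -> cc2 (fun u _ => RtoC (f u)) x y.
Proof. intros [l H]; exact (cc2_fst f x y l H). Qed.

Lemma cc2_lineb (b x y : R) : cc2 (fun _ v => lineb b v) x y.
Proof. apply cc2_minus; [apply cc2_snd|apply cc2_const]. Qed.

Lemma cc2_ccont (f : R -> R -> C) (x y : R) : cc2 f x y -> ccont (f x) y.
Proof.
  assert (H : forall g : R -> R -> R, continuity_2d_pt g x y -> continuous (g x) y).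
  { intros g Hg. apply continuity_pt_filterlim. intros eps He.
    destruct (Hg (mkposreal eps He)) as [d Hd].
    exists d; split; [apply d|]. intros z [_ Hz].
    apply (Hd x z); [rewrite Rminus_diag, Rabs_R0; apply d|exact Hz]. }
  intros [H1 H2]; split; [exact (H _ H1)|exact (H _ H2)].
Qed.

Definition dscale (xi al : R) : R := - (xi / gap al) * (al * sin al / gap al).

Lemma scale_derive (xi al : R) : 0 < gap al ->
  is_derive (fun al => xi / gap al) al (dscale xi al).
Proof. intros H. unfold dscale, gap in *. auto_derive; [lra|]. field. lra. Qed.

Definition dker (xi al : R) (w : C) : C :=
  (- Ci * (RtoC (dscale xi al) * (csinh (RtoC al * w) - RtoC (cos al) * (RtoC al * w))
     + RtoC (xi / gap al) * (ccosh (RtoC al * w) * w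
         - (RtoC (cos al) * w - RtoC (sin al) * (RtoC al * w))))
   * ker (xi / gap al) al (RtoC al * w))%C.

Lemma rder_ker_path (xi al : R) (w : C) : 0 < gap al ->
  rder (fun al => ker (xi / gap al) al (RtoC al * w)) al (dker xi al w).
Proof.
  intros Hg.
  assert (Hu : rder (fun al => RtoC al * w)%C al w).
  { eapply rder_eq; [apply rder_mult; [apply rder_id|apply rder_const]|cbv beta; ring]. }
  eapply rder_eq.
  - apply rder_Cexp. apply rder_mult.
    + apply rder_mult; [apply rder_const|apply rder_RtoC, scale_derive, Hg].
    + apply rder_minus.
      * apply (rder_cder csinh (fun al => RtoC al * w)%C); [apply cder_csinh|exact Hu].
      * apply rder_mult; [apply rder_RtoC, is_derive_cos|exact Hu].
  - unfold dker, ker. cbv beta. rewrite RtoC_opp. ring.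
Qed.

Lemma cc2_dker (xi b al x : R) (j : bool) : 0 < gap al ->
  cc2 (fun al x => dker xi al (lineb b x) * amp j (lineb b x))%C al x.
Proof.
  intros Hg.
  assert (Hgr : gap al <> 0) by lra.
  assert (Hu : cc2 (fun al x => RtoC al * lineb b x)%C al x).
  { apply cc2_mult; [apply (cc2_fst_ex (fun al => al)), ex_derive_id|apply cc2_lineb]. }
  assert (Hc : cc2 (fun al x => RtoC (cos al)) al x).
  { apply cc2_fst_ex. eexists; apply is_derive_cos. }
  assert (Hs : cc2 (fun al x => RtoC (sin al)) al x).
  { apply cc2_fst_ex. eexists; apply is_derive_sin. }
  assert (HY : cc2 (fun al x => RtoC (xi / gap al)) al x).
  { apply cc2_fst_ex. eexists; now apply scale_derive. }
  assert (HY' : cc2 (fun al x => RtoC (dscale xi al)) al x).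
  { apply cc2_fst_ex. unfold dscale, gap in *. auto_derive. repeat split; lra. }
  assert (Hsh : cc2 (fun al x => csinh (RtoC al * lineb b x)) al x).
  { eapply (cc2_cder csinh (fun al x => RtoC al * lineb b x)%C); [apply cder_csinh|exact Hu]. }
  assert (Hch : cc2 (fun al x => ccosh (RtoC al * lineb b x)) al x).
  { eapply (cc2_cder ccosh (fun al x => RtoC al * lineb b x)%C); [apply cder_ccosh|exact Hu]. }
  apply cc2_mult.
  - unfold dker. apply cc2_mult.
    + apply cc2_mult; [apply cc2_const|]. apply cc2_plus; apply cc2_mult; auto.
      * apply cc2_minus; [auto|]. apply cc2_mult; auto.
      * apply cc2_minus; [apply cc2_mult; [auto|apply cc2_lineb]|].
        apply cc2_minus; apply cc2_mult; auto using cc2_lineb.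
    + unfold ker.
      eapply (cc2_cder Cexp (fun al x => - Ci * RtoC (xi / gap al) *
        (csinh (RtoC al * lineb b x) - RtoC (cos al) * (RtoC al * lineb b x)))%C);
        [apply cder_Cexp|].
      apply cc2_mult; [apply cc2_mult; [apply cc2_const|exact HY]|].
      apply cc2_minus; [auto|]. apply cc2_mult; auto.
  - eapply (cc2_cder (amp j) (fun _ x => lineb b x)); [apply cder_amp|apply cc2_lineb].
Qed.

(* The derivative along the path, integrated by parts: what remains besides boundary terms
   is a multiple of the integral itself, cancelled by [nrm], and a term with a further
   factor [1 / y]. *)
Lemma path_identity (xi al b x : R) (j : bool) (p p' m m' : C -> C) :
  0 < xi -> good (xi / gap al) al b ->
  (forall u, strip_ok al u ->
    (den al u * p u = csinh u - RtoC (sin al / al) * u)%C /\ cder p u (p' u) /\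
    (p' u * amp j u + p u * damp j = RtoC (sig j al) * amp j u + den al u * m u)%C /\
    cder m u (m' u)) ->
  let u := fun x => (RtoC al * lineb b x)%C in
  rder (fun x => ker (xi / gap al) al (u x) *
          (RtoC (/ al) * (RtoC (- (al * sin al / gap al)) * p (u x) + lineb b x) * amp j (lineb b x)
           + Ci * RtoC (sin al / (xi * scl j al)) * m (u x)))%C x
    (dker xi al (lineb b x) * amp j (lineb b x)
      + RtoC (lam al) * integrand j xi b al x
      + Ci * RtoC (al * sin al / (xi * scl j al)) * (ker (xi / gap al) al (u x) * m' (u x)))%C.
Proof.
  intros Hxi G Hp u.
  pose proof (strip_line _ _ _ x G) as [Hst _].
  destruct (Hp _ Hst) as (P1 & P2 & P3 & P4).
  destruct G as (Ha & HY & _).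
  pose proof (gap_pos al Ha) as Hg. pose proof (sin_ge_lin al ltac:(lra)) as Hs.
  assert (Du : rder u x (RtoC al)) by apply rder_scaled_line.
  eapply rder_eq.
  - apply rder_mult; [apply (rder_cder (ker (xi / gap al) al) u); [apply cder_ker|exact Du]|].
    apply rder_plus.
    + apply rder_mult.
      * apply rder_mult; [apply rder_const|]. apply rder_plus; [|apply rder_lineb].
        apply rder_mult; [apply rder_const|apply (rder_cder p u); [exact P2|exact Du]].
      * apply (rder_cder (amp j) (lineb b)); [apply cder_amp|apply rder_lineb].
    + apply rder_mult; [apply rder_const|]. apply (rder_cder m u); [exact P4|exact Du].
  - cbv beta. unfold integrand. fold (u x) in *.
    set (E := ker (xi / gap al) al (u x)).
    unfold dker. fold (u x). fold E.
    assert (Ech : ccosh (u x) = (den al (u x) + RtoC (cos al))%C) by (unfold den; ring).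
    (* Hence [sinh u - u cos al = den p + (gap al / al) u]. The linear term times the derivative of
       [xi / gap al] cancels against the term with [sin al] in [dker]: this is the effect of keeping
       [xi] fixed, and only multiples of [den] remain. *)
    assert (Esh : csinh (u x) = (den al (u x) * p (u x) + RtoC (sin al / al) * u x)%C)
      by (rewrite P1; ring).
    rewrite Ech, Esh.
    assert (Eu : u x = (RtoC al * lineb b x)%C) by reflexivity.
    assert (Am : amp j (u x) = (RtoC (scl j al) * amp j (lineb b x))%C).
    { rewrite Eu. destruct j; simpl; ring. }
    rewrite Am in P3.
    set (dn := den al (u x)) in *. set (pv := p (u x)) in *. set (pv' := p' (u x)) in *.
    set (mv := m (u x)) in *. set (mv' := m' (u x)) in *.
    rewrite Eu. set (w := lineb b x) in *.
    assert (Es : RtoC (sig0 al) = (RtoC (sig j al) - RtoC (if j then gap al / (al ^ 2 * sin al) else 0))%C).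
    { unfold sig. destruct j; rewrite ?RtoC_plus; ring. }
    assert (Ec : cos al = (sin al - gap al) / al) by (unfold gap; field; lra).
    unfold lam, dscale. rewrite Ec.
    set (g := gap al) in *. set (s := sin al) in *.
    assert (nal : RtoC al <> 0) by (apply RtoC_neq_0; lra).
    assert (ng : RtoC g <> 0) by (apply RtoC_neq_0; lra).
    assert (ns : RtoC s <> 0) by (apply RtoC_neq_0; lra).
    assert (nxi : RtoC xi <> 0) by (apply RtoC_neq_0; lra).
    assert (I2 : (Ci * Ci = - (1))%C) by (apply injective_projections; simpl; ring).
    assert (N2 : al ^ 2 * s <> 0)
      by (apply Rmult_integral_contrapositive_currified; [apply pow_nonzero|]; lra).
    (* Moved to one side, the identity is a combination of [Ci * Ci + 1] and of the relation [P3]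
       that defines [m]; the coefficients are written out for each amplitude. *)
    assert (Hrow : forall z v : C, (z - v)%C = 0 -> z = v).
    { intros z v Hz. replace z with (z - v + v)%C by ring. rewrite Hz; ring. }
    apply Hrow.
    destruct j; simpl amp in *; simpl damp in *; simpl scl in *; cbv iota in Es;
      repeat first [rewrite RtoC_plus | rewrite RtoC_minus | rewrite RtoC_opp
        | rewrite RtoC_mult | rewrite RtoC_div by (exact N2 || nra) | rewrite RtoC_inv by (exact N2 || nra)]; rewrite Es;
      repeat first [rewrite RtoC_plus | rewrite RtoC_minus | rewrite RtoC_opp
        | rewrite RtoC_mult | rewrite RtoC_div by (exact N2 || nra) | rewrite RtoC_inv by (exact N2 || nra) | rewrite RtoC_pow].
    + transitivity ((Ci * Ci + 1) * (- (RtoC s / RtoC g) * dn * E * mv)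
        + (- (RtoC s / RtoC g) * E) * ((pv' * (RtoC al * w) + pv * 1)
             - (RtoC (sig true al) * (RtoC al * w) + dn * mv)))%C.
      * field. repeat split; assumption.
      * rewrite I2, P3. ring.
    + transitivity ((Ci * Ci + 1) * (- (RtoC al * RtoC s / RtoC g) * dn * E * mv)
        + (- (RtoC al * RtoC s / RtoC g) * E) * ((pv' * 1 + pv * 0)
             - (RtoC (sig false al) * 1 + dn * mv)))%C.
      * field. repeat split; assumption.
      * rewrite I2. replace (pv' * 1)%C with (pv' * (1 * 1))%C by ring. rewrite P3. ring.
Qed.

Lemma amp_bound (j : bool) (w : C) (B : R) : 1 <= B -> Cmod w <= B -> Cmod (amp j w) <= B.
Proof. intros; destruct j; simpl; [assumption|rewrite Cmod_1; lra]. Qed.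

(** Here [|x|] is measured by [al x], since [ker_mult_bound] absorbs exponentials of [al x]. The
    factor [/ al] does no harm in existence statements and in end-point terms. *)
Lemma lineb_bound (al b x : R) : 0 < al -> 1 <= b ->
  Cmod (lineb b x) <= (/ al + b) * exp (1 * Rabs (al * x)).
Proof.
  intros Ha Hb. unfold lineb.
  pose proof (exp_ineq1_le (1 * Rabs (al * x))) as E. pose proof (Rabs_pos (al * x)) as Hp.
  rewrite Rmult_plus_distr_r. apply Cmod_le_minus.
  - rewrite Cmod_R.
    replace (Rabs x) with (/ al * Rabs (al * x))
      by (rewrite Rabs_mult, (Rabs_right al) by lra; field; lra).
    apply Rmult_le_compat_l; [apply Rlt_le, Rinv_0_lt_compat, Ha|]. lra.
  - rewrite Cmod_mult, Cmod_Ci, Cmod_R, Rabs_right by lra. nra.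
Qed.

Lemma integrand_ccont (j : bool) (xi b al x : R) : ccont (integrand j xi b al) x.
Proof.
  apply ccont_mult; [apply ccont_ker|].
  eapply rder_ccont, (rder_cder (amp j) (lineb b)); [apply cder_amp|apply rder_lineb].
Qed.

Lemma lorentz_le (A B x : R) : 0 < A -> 0 <= B ->
  B / (1 + A * x ^ 2) <= B * (1 + / A) / (1 + x ^ 2).
Proof.
  intros HA HB. assert (0 <= x ^ 2) by nra.
  pose proof (Rinv_0_lt_compat A HA).
  assert (A * / A = 1) by (field; lra).
  apply Rle_div_l; [nra|]. unfold Rdiv. rewrite Rmult_assoc, Rmult_assoc.
  rewrite <- (Rmult_1_r B) at 1. apply Rmult_le_compat_l; [exact HB|].
  apply Rmult_le_reg_r with (1 + x ^ 2); [lra|].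
  replace ((1 + / A) * (/ (1 + x ^ 2) * (1 + A * x ^ 2)) * (1 + x ^ 2))
    with ((1 + / A) * (1 + A * x ^ 2)) by (field; lra).
  nra.
Qed.

Lemma clim_exists_integrand (j : bool) (xi b al : R) : good (xi / gap al) al b ->
  exists L, clim (integrand j xi b al) L.
Proof.
  intros G. pose proof (good_xi _ _ _ G) as [X _].
  set (A := xi / gap al * gap al * b) in *.
  assert (G' := G). destruct G' as (Ha & _ & Hb & _).
  pose proof (Rinv_0_lt_compat al ltac:(lra)).
  set (B := (/ al + b) * (exp (2 + 1 ^ 2) * exp (- (xi / gap al * gap al)))).
  assert (HB : 0 <= B).
  { apply Rmult_le_pos; [lra|]. apply Rmult_le_pos; apply Rlt_le, exp_pos. }
  destruct (dominated_clim (integrand j xi b al) (B * (1 + / A))) as (L & HL & _).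
  - intros; apply integrand_ccont.
  - intros t. eapply Rle_trans; [|apply lorentz_le; assumption].
    apply ker_mult_bound; [exact G|lra|lra|].
    apply amp_bound; [|apply lineb_bound; lra].
    pose proof (exp_ineq1_le (1 * Rabs (al * t))). pose proof (Rabs_pos (al * t)).
    assert (1 <= / al + b) by lra. nra.
  - now exists L.
Qed.

Lemma scl_pos (j : bool) (al : R) : 0 < al -> 0 < scl j al.
Proof. destruct j; simpl; lra. Qed.

(** [K0] has to be uniform, whereas [C0] may depend on everything but [N] and even blow up as [al1]
    tends to [0]: it bounds only end-point terms, which disappear for large [N]. Apart from these,
    the derivative of [nrm] times the integral is the error of the second integration by parts,
    accumulated over a path no longer than [alf]. *)
Lemma transport_finite : exists K0, 0 <= K0 /\
  forall xi b alf al1 j, good (xi / gap alf) alf b -> 0 < al1 <= alf ->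
  exists C0, 0 <= C0 /\ forall N, 0 < N ->
    Cmod (RtoC (nrm xi alf) * CInt (integrand j xi b alf) (- N) N
          - RtoC (nrm xi al1) * CInt (integrand j xi b al1) (- N) N)%C
    <= (C0 / (1 + xi * b * N ^ 2)
        + 2 * sqrt xi * (alf ^ 2 / (xi * scl j alf) * (K0 * exp (- xi) / sqrt (xi * b)))) * alf.
Proof.
  destruct amplitude_path as (K & p & p' & HK & Hp & Hm).
  exists (K * exp (2 + K ^ 2) * PI). split.
  { pose proof PI_RGT_0.
    apply Rmult_le_pos; [apply Rmult_le_pos; [exact HK|apply Rlt_le, exp_pos]|lra]. }
  intros xi b alf al1 j Gf H1.
  destruct (Hm j) as (m & m' & Hmj).
  assert (Hxi : 0 < xi) by (eapply good_path; [exact H1|exact Gf]).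
  assert (Gall : forall al, al1 <= al <= alf -> good (xi / gap al) al b /\ xi / gap al * gap al = xi).
  { intros al Hal. destruct (good_path xi b alf al ltac:(lra) Gf) as (Q1 & Q2 & _). now split. }
  pose proof Gf as (Haf & _ & Hb & Habf & _).
  set (A := / al1). assert (HA : 0 < A) by (apply Rinv_0_lt_compat; lra).
  (* The boundary expression grows at most like [exp ((K + 2) |al x|)]: [K] from [p] or [m], and [1]
     for each of up to two factors [lineb]. *)
  set (Bd := exp (2 + (K + 2) ^ 2) * exp (- xi)).
  assert (HBd : 0 < Bd) by (apply Rmult_lt_0_compat; apply exp_pos).
  set (BT := A * (4 * A * K + (A + b)) * (A + b) + 4 * A * A / xi * K).
  assert (HBT : 0 <= BT).
  { unfold BT. apply Rplus_le_le_0_compat; repeat apply Rmult_le_pos; try lra.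
    - apply Rplus_le_le_0_compat; [|lra]. repeat apply Rmult_le_pos; lra.
    - apply Rlt_le, Rinv_0_lt_compat; lra. }
  assert (Hsx : 0 < sqrt xi) by now apply sqrt_lt_R0.
  exists (2 * sqrt xi * (2 * (BT * Bd))); split; [apply Rmult_le_pos; [lra|nra]|].
  intros N HN.
  set (I := fun al => CInt (integrand j xi b al) (- N) N).
  pose (u := fun al x => (RtoC al * lineb b x)%C).
  pose (T := fun al x => (ker (xi / gap al) al (u al x) *
      (RtoC (/ al) * (RtoC (- (al * sin al / gap al)) * p al (u al x) + lineb b x) * amp j (lineb b x)
           + Ci * RtoC (sin al / (xi * scl j al)) * m al (u al x)))%C).
  pose (W := fun al x => (ker (xi / gap al) al (u al x) * m' al (u al x))%C).
  pose (k2 := fun al => (- Ci * RtoC (al * sin al / (xi * scl j al)))%C).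
  assert (HI : forall al, al1 <= al <= alf -> rder I al
     ((T al N - T al (- N)%R) - RtoC (lam al) * I al + k2 al * CInt (W al) (- N) N)%C).
  { intros al Hal. destruct (Gall al Hal) as [G Exi].
    assert (Ha : 0 < al <= 1 / 2) by lra.
    assert (Hst : forall x, strip_ok al (u al x)) by (intros x; apply (strip_line _ _ _ x G)).
    assert (CW : forall x, ccont (W al) x).
    { intros x. apply ccont_mult; [apply ccont_ker|].
      destruct (Hmj al (u al x) (Hst x)) as (_ & _ & [l D] & _). eapply ccont_holo_line, D. }
    pose proof (CInt_param (fun al x => integrand j xi b al x)
      (fun al x => dker xi al (lineb b x) * amp j (lineb b x))%C (- N) N al (al / 2)
      ltac:(lra) ltac:(lra)) as P.
    (* The neighbourhood in which one differentiates reaches up to [3 al / 2], beyond [1 / 2]; hence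
       the range of [gap_pos_1]. *)
    assert (Hg1 : forall z, Rabs (z - al) < al / 2 -> 0 < gap z).
    { intros z Hz. apply Rabs_def2 in Hz. apply gap_pos_1; lra. }
    eapply rder_eq; [apply P|].
    - intros z t Hz. eapply rder_eq; [apply rder_mult;
        [apply rder_ker_path, Hg1, Hz|apply rder_const]|cbv beta; ring].
    - intros z t _. apply integrand_ccont.
    - intros t. apply cc2_dker. now apply gap_pos.
    - set (dE := fun x => (dker xi al (lineb b x) * amp j (lineb b x))%C).
      assert (CdE : forall x, ccont dE x).
      { intros x. exact (cc2_ccont _ al x (cc2_dker xi b al x j (gap_pos al Ha))). }
      assert (CI : forall x, ccont (integrand j xi b al) x) by (intros; apply integrand_ccont).
      assert (CE : CInt (fun x => dE x + RtoC (lam al) * integrand j xi b al x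
          + (- k2 al) * W al x)%C (- N) N = (T al N - T al (- N)%R)%C).
      { apply CInt_FTC; [lra| |].
        - intros x _. ccont_tac.
        - intros x _. eapply rder_eq.
          + apply (path_identity xi al b x j (p al) (p' al) (m al) (m' al)); auto.
            intros v Hv. destruct (Hp al v Hv) as (Q1 & Q2 & _). destruct (Hmj al v Hv) as (Q3 & Q4 & _).
            now repeat split.
          + unfold dE, W, k2, u. ring. }
      rewrite <- CE.
      rewrite (CInt_plus (fun x => dE x + RtoC (lam al) * integrand j xi b al x)%C);
        [|lra|intros; ccont_tac|intros; ccont_tac].
      rewrite CInt_plus; [|lra|intros; ccont_tac|intros; ccont_tac].
      rewrite !CInt_scal; [|lra|intros; ccont_tac|lra|intros; ccont_tac].
      unfold I. ring. }
  assert (Hder : forall al, al1 <= al <= alf -> rder (fun al => RtoC (nrm xi al) * I al)%C al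
     (RtoC (nrm xi al) * ((T al N - T al (- N)%R) + k2 al * CInt (W al) (- N) N))%C).
  { intros al Hal. eapply rder_eq.
    - apply rder_mult; [apply rder_RtoC, nrm_derive; lra|now apply HI].
    - cbv beta. rewrite RtoC_mult. ring. }
  assert (HT : forall al x, al1 <= al <= alf ->
     Cmod (T al x) <= BT * Bd / (1 + xi * b * x ^ 2)).
  { intros al x Hal. destruct (Gall al Hal) as [G Exi].
    pose proof (strip_line _ _ _ x G) as [Hst Hre]. fold (u al x) in Hst, Hre.
    assert (Ha : 0 < al <= 1 / 2) by lra.
    unfold T.
    pose proof (ker_mult_bound (xi / gap al) al b x (K + 2) BT) as Q.
    rewrite Exi in Q. fold Bd in Q. apply Q; [exact G|lra|exact HBT|]. clear Q.
    set (e := Rabs (al * x)). assert (He : 0 <= e) by apply Rabs_pos.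
    pose proof (gap_ge al ltac:(lra)) as Hg1. pose proof (gap_pos al Ha) as Hg0.
    pose proof (sin_le_id al ltac:(lra)) as Hs2. pose proof (sin_ge_lin al ltac:(lra)) as Hs1.
    assert (HiA : 0 < / al <= A).
    { split; [apply Rinv_0_lt_compat; lra|]. apply Rinv_le_contravar; lra. }
    assert (Bp : Cmod (p al (u al x)) <= K * exp (K * e)).
    { unfold e; rewrite <- Hre. now apply Hp. }
    assert (Bm : Cmod (m al (u al x)) <= K * exp (K * e)).
    { unfold e; rewrite <- Hre. now apply Hmj. }
    assert (Bw : Cmod (lineb b x) <= (A + b) * exp (1 * e)).
    { eapply Rle_trans; [apply (lineb_bound al); lra|]. fold e.
      apply Rmult_le_compat_r; [apply Rlt_le, exp_pos|lra]. }
    assert (Ba : Cmod (amp j (lineb b x)) <= (A + b) * exp (1 * e)).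
    { apply amp_bound; [|exact Bw]. pose proof (exp_ineq1_le (1 * e)).
      assert (1 <= A + b) by lra. nra. }
    assert (Br : Cmod (RtoC (- (al * sin al / gap al))) <= 4 * A).
    { rewrite Cmod_R, Rabs_Ropp, Rabs_right.
      - apply Rle_trans with (4 * / al); [|lra].
        assert (0 < al ^ 3) by (apply pow_lt; lra).
        apply Rle_div_l; [exact Hg0|].
        apply Rle_trans with (4 * / al * (al ^ 3 / 4)).
        + replace (4 * / al * (al ^ 3 / 4)) with (al * al) by (field; lra). nra.
        + apply Rmult_le_compat_l; lra.
      - apply Rle_ge, Rmult_le_pos; [nra|]. apply Rlt_le, Rinv_0_lt_compat, Hg0. }
    assert (Bs : Cmod (Ci * RtoC (sin al / (xi * scl j al)))%C <= 4 * A * A / xi).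
    { rewrite Cmod_mult, Cmod_Ci, Rmult_1_l, Cmod_R.
      pose proof (scl_pos j al ltac:(lra)) as Hsc.
      rewrite Rabs_right.
      2: { apply Rle_ge, Rmult_le_pos; [lra|]. apply Rlt_le, Rinv_0_lt_compat; nra. }
      apply Rle_div_l; [nra|].
      replace (4 * A * A / xi * (xi * scl j al)) with (4 * A * A * scl j al) by (field; lra).
      assert (HA2 : 2 <= A).
      { apply Rle_trans with (/ al); [|lra]. apply Rle_trans with (/ (1/2)); [lra|].
        apply Rinv_le_contravar; lra. }
      destruct j; simpl scl; [|nra].
      assert (al <= A * al) by nra. assert (0 <= A * al) by nra. nra. }
    assert (Xe : exp (K * e) <= exp ((K + 1) * e)) by (apply exp_le_compat; nra).
    assert (X1 : exp (1 * e) <= exp ((K + 1) * e)) by (apply exp_le_compat; nra).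
    assert (Xk : exp (K * e) <= exp ((K + 2) * e)) by (apply exp_le_compat; nra).
    assert (Xs : exp ((K + 2) * e) = exp ((K + 1) * e) * exp (1 * e))
      by (rewrite <- exp_plus; f_equal; ring).
    unfold BT. rewrite Rmult_plus_distr_r. apply Cmod_le_plus.
    - replace (A * (4 * A * K + (A + b)) * (A + b) * exp ((K + 2) * e))
        with (A * ((4 * A * K + (A + b)) * exp ((K + 1) * e)) * ((A + b) * exp (1 * e)))
        by (rewrite Xs; ring).
      apply Cmod_le_mult; [|exact Ba]. apply Cmod_le_mult; [rewrite Cmod_R, Rabs_right; lra|].
      rewrite Rmult_plus_distr_r. apply Cmod_le_plus.
      + replace (4 * A * K * exp ((K + 1) * e)) with (4 * A * (K * exp ((K + 1) * e))) by ring.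
        apply Cmod_le_mult; [exact Br|]. eapply Rle_trans; [exact Bp|].
        now apply Rmult_le_compat_l.
      + eapply Rle_trans; [exact Bw|]. apply Rmult_le_compat_l; lra.
    - rewrite Rmult_assoc. apply Cmod_le_mult; [exact Bs|].
      eapply Rle_trans; [exact Bm|]. now apply Rmult_le_compat_l. }
  assert (HW : forall al, al1 <= al <= alf ->
     Cmod (CInt (W al) (- N) N) <= K * exp (2 + K ^ 2) * PI * exp (- xi) / sqrt (xi * b)).
  { intros al Hal. destruct (Gall al Hal) as [G Exi].
    assert (Hst : forall x, strip_ok al (u al x)) by (intros x; apply (strip_line _ _ _ x G)).
    replace (K * exp (2 + K ^ 2) * PI * exp (- xi) / sqrt (xi * b))
      with (K * (exp (2 + K ^ 2) * exp (- xi)) * PI / sqrt (xi * b)) by (unfold Rdiv; ring).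
    apply CInt_lorentz; [nra|exact HN| |].
    - intros x. apply ccont_mult; [apply ccont_ker|].
      destruct (Hmj al (u al x) (Hst x)) as (_ & _ & [l D] & _). eapply ccont_holo_line, D.
    - intros x. pose proof (ker_mult_bound (xi / gap al) al b x K K (m' al (u al x)) G HK HK) as Q.
      rewrite Exi in Q. apply Q.
      rewrite <- (proj2 (strip_line _ _ _ x G)). destruct (Hmj al (u al x) (Hst x)) as (_ & _ & _ & _ & Q5); exact Q5. }
  set (D0 := 2 * sqrt xi * (2 * (BT * Bd)) / (1 + xi * b * N ^ 2)
        + 2 * sqrt xi * (alf ^ 2 / (xi * scl j alf) *
             (K * exp (2 + K ^ 2) * PI * exp (- xi) / sqrt (xi * b)))).
  assert (HD : 0 <= D0).
  { assert (0 < sqrt (xi * b)) by (apply sqrt_lt_R0; nra).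
    pose proof (scl_pos j alf ltac:(lra)). pose proof PI_RGT_0.
    unfold D0. assert (0 <= N ^ 2) by nra. assert (0 < xi * b) by nra.
    apply Rplus_le_le_0_compat.
    - apply Rdiv_le_0_compat; [apply Rmult_le_pos; [lra|nra]|nra].
    - apply Rmult_le_pos; [lra|]. apply Rmult_le_pos.
      + apply Rdiv_le_0_compat; [apply pow2_ge_0|nra].
      + apply Rdiv_le_0_compat; [|assumption].
        repeat (apply Rmult_le_pos; [|try lra; apply Rlt_le, exp_pos]). exact HK. }
  apply Rle_trans with (D0 * (alf - al1)); [|apply Rmult_le_compat_l; lra].
  apply (rder_bound (fun al => RtoC (nrm xi al) * I al)%C
    (fun al => RtoC (nrm xi al) * ((T al N - T al (- N)%R) + k2 al * CInt (W al) (- N)%R N))%C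
    al1 alf D0); [lra|exact Hder|].
  intros al Hal. destruct (Gall al Hal) as [G Exi].
  assert (Ha : 0 < al <= 1 / 2) by lra.
  pose proof (nrm_bounds xi al Hxi Ha) as [Hn1 Hn2].
  unfold D0, Rdiv. rewrite (Rmult_assoc (2 * sqrt xi)), <- Rmult_plus_distr_l.
  apply Cmod_le_mult; [rewrite Cmod_R, Rabs_right; lra|].
  apply Cmod_le_plus.
  - replace (2 * (BT * Bd) * / (1 + xi * b * N ^ 2))
      with (BT * Bd / (1 + xi * b * N ^ 2) + BT * Bd / (1 + xi * b * (- N) ^ 2))
      by (replace ((- N) ^ 2) with (N ^ 2) by ring; unfold Rdiv; ring).
    apply Cmod_le_minus; now apply HT.
  - apply Cmod_le_mult; [|now apply HW].
    unfold k2. rewrite Cmod_mult, Cmod_opp, Cmod_Ci, Rmult_1_l, Cmod_R.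
    pose proof (sin_le_id al ltac:(lra)) as Hs2. pose proof (sin_ge_lin al ltac:(lra)) as Hs1.
    pose proof (scl_pos j al ltac:(lra)) as Hsc. pose proof (scl_pos j alf ltac:(lra)) as Hscf.
    rewrite Rabs_right.
    2: { apply Rle_ge, Rmult_le_pos; [nra|]. apply Rlt_le, Rinv_0_lt_compat; nra. }
    destruct j; simpl scl in *.
    + replace (al * sin al / (xi * al)) with (sin al / xi) by (field; lra).
      replace (alf ^ 2 * / (xi * alf)) with (alf / xi) by (field; lra).
      apply Rmult_le_compat_r; [apply Rlt_le, Rinv_0_lt_compat; lra|]. lra.
    + rewrite !Rmult_1_r. apply Rmult_le_compat_r; [apply Rlt_le, Rinv_0_lt_compat; lra|]. nra.
Qed.

Lemma transport : exists K0, 0 <= K0 /\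
  forall xi b alf al1 j Lf L1, good (xi / gap alf) alf b -> 0 < al1 <= alf ->
  clim (integrand j xi b alf) Lf -> clim (integrand j xi b al1) L1 ->
  Cmod (RtoC (nrm xi alf) * Lf - RtoC (nrm xi al1) * L1)%C
    <= 2 * sqrt xi * (alf ^ 2 / (xi * scl j alf) * (K0 * exp (- xi) / sqrt (xi * b))) * alf.
Proof.
  destruct transport_finite as (K0 & HK0 & HT). exists K0; split; [exact HK0|].
  intros xi b alf al1 j Lf L1 G H1 Hf Hl.
  destruct (HT xi b alf al1 j G H1) as (C0 & HC0 & HB).
  assert (Hxi : 0 < xi) by (eapply good_path; [exact H1|exact G]).
  assert (G' := G). destruct G' as (Ha & _ & Hb & _).
  set (S := 2 * sqrt xi * _) in *.
  pose proof (clim_scal _ (RtoC (nrm xi alf)) _ (fun x => integrand_ccont j xi b alf x) Hf) as Hf'.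
  pose proof (clim_scal _ (RtoC (- nrm xi al1)) _ (fun x => integrand_ccont j xi b al1 x) Hl) as Hl'.
  assert (C1 : forall x, ccont (fun t => RtoC (nrm xi alf) * integrand j xi b alf t)%C x).
  { intros x. apply ccont_mult; [apply ccont_const|apply integrand_ccont]. }
  assert (C2 : forall x, ccont (fun t => RtoC (- nrm xi al1) * integrand j xi b al1 t)%C x).
  { intros x. apply ccont_mult; [apply ccont_const|apply integrand_ccont]. }
  pose proof (clim_plus _ _ _ _ C1 C2 Hf' Hl') as Hs.
  replace (RtoC (nrm xi alf) * Lf - RtoC (nrm xi al1) * L1)%C
    with (RtoC (nrm xi alf) * Lf + RtoC (- nrm xi al1) * L1)%C by (rewrite RtoC_opp; ring).
  apply le_epsilon. intros eps He.
  destruct (Hs (eps / 2) ltac:(lra)) as [N0 HN0].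
  assert (Hxb : 0 < xi * b) by nra.
  assert (Hq : 0 < 2 * (C0 * alf + 1) / eps / (xi * b)).
  { repeat apply Rdiv_lt_0_compat; nra. }
  set (N := Rmax (Rmax N0 1) (2 * (C0 * alf + 1) / eps / (xi * b))).
  assert (N1 : N0 <= N) by (eapply Rle_trans; [apply Rmax_l|apply Rmax_l]).
  assert (N2 : 1 <= N) by (eapply Rle_trans; [apply Rmax_r|apply Rmax_l]).
  assert (N3 : 2 * (C0 * alf + 1) / eps / (xi * b) <= N) by apply Rmax_r.
  specialize (HN0 N N1). specialize (HB N ltac:(lra)).
  rewrite CInt_plus in HN0 by (lra || auto).
  rewrite !CInt_scal in HN0 by (lra || (intros; apply integrand_ccont)).
  replace (RtoC (- nrm xi al1) * CInt (integrand j xi b al1) (- N) N)%C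
    with (- (RtoC (nrm xi al1) * CInt (integrand j xi b al1) (- N) N))%C in HN0
    by (rewrite RtoC_opp; ring).
  assert (Hd : C0 / (1 + xi * b * N ^ 2) * alf <= eps / 2).
  { unfold Rdiv at 1. rewrite Rmult_assoc, (Rmult_comm (/ _)), <- Rmult_assoc.
    apply Rle_div_l; [nra|].
    apply Rle_trans with (eps / 2 * (xi * b * N)).
    - apply Rmult_le_compat_l with (r := eps / 2 * (xi * b)) in N3; [|nra].
      replace (eps / 2 * (xi * b) * (2 * (C0 * alf + 1) / eps / (xi * b)))
        with (C0 * alf + 1) in N3 by (field; lra). lra.
    - apply Rmult_le_compat_l; [lra|].
      assert (0 <= xi * b * N * (N - 1)) by (apply Rmult_le_pos; nra). nra. }
  set (z := (RtoC (nrm xi alf) * Lf + RtoC (- nrm xi al1) * L1)%C) in *.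
  set (X := (RtoC (nrm xi alf) * CInt (integrand j xi b alf) (- N) N)%C) in *.
  set (Y := (RtoC (nrm xi al1) * CInt (integrand j xi b al1) (- N) N)%C) in *.
  replace z with ((X - Y) - (X + - Y - z))%C by ring.
  eapply Rle_trans; [apply Cmod_le_minus; [exact HB|exact HN0]|].
  rewrite Rmult_plus_distr_r. lra.
Qed.

(** * Taylor and Gaussian estimates *)

Lemma Cexp_diff (z w : C) :
  Cmod (Cexp z - Cexp w)%C <= Cmod (z - w)%C * (exp (Re z) + exp (Re w)).
Proof.
  assert (E0 : (w + RtoC 0 * (z - w))%C = w) by ring.
  assert (E1 : (w + RtoC 1 * (z - w))%C = z) by ring.
  pose proof (rder_bound (fun t => Cexp (w + RtoC t * (z - w)))%C
    (fun t => (z - w) * Cexp (w + RtoC t * (z - w)))%C 0 1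
    (Cmod (z - w)%C * (exp (Re z) + exp (Re w))) ltac:(lra)) as T.
  cbv beta in T. rewrite E0, E1 in T. rewrite Rminus_0_r, Rmult_1_r in T. apply T.
  - intros t _. apply rder_Cexp. eapply rder_eq; [apply rder_plus; [apply rder_const|
      apply rder_mult; [apply rder_id|apply rder_const]]|cbv beta; ring].
  - intros t Ht. apply Cmod_le_mult; [lra|]. rewrite Cmod_Cexp.
    replace (Re _) with ((1 - t) * Re w + t * Re z) by (simpl; unfold Re, Im; ring).
    pose proof (exp_pos (Re z)); pose proof (exp_pos (Re w)).
    destruct (Rle_dec (Re z) (Re w)).
    + apply Rle_trans with (exp (Re w)); [apply exp_le_compat; nra|lra].
    + apply Rle_trans with (exp (Re z)); [apply exp_le_compat; nra|lra].
Qed.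

(** From [|sinh| <= exp |Re u|], four integrations along the segment from [0] to [u] each gain a
    factor [Cmod u] ([Step]); the factorials are given away. *)
Lemma csinh_taylor (u : C) :
  Cmod (csinh u - u - u * u * u * / 6)%C <= Cmod u ^ 4 * exp (Rabs (Re u)).
Proof.
  set (B := exp (Rabs (Re u))). assert (HB : 0 < B) by apply exp_pos.
  pose proof (Cmod_ge_0 u) as Hu.
  assert (L : forall t, rder (fun t => RtoC t * u)%C t u).
  { intros t. eapply rder_eq; [apply rder_mult; [apply rder_id|apply rder_const]|cbv beta; ring]. }
  assert (Ds : forall t, rder (fun t => csinh (RtoC t * u)) t (ccosh (RtoC t * u) * u)%C).
  { intros t. apply (rder_cder csinh (fun t => RtoC t * u)%C); [apply cder_csinh|apply L]. }
  assert (Dc : forall t, rder (fun t => ccosh (RtoC t * u)) t (csinh (RtoC t * u) * u)%C).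
  { intros t. apply (rder_cder ccosh (fun t => RtoC t * u)%C); [apply cder_ccosh|apply L]. }
  assert (S0 : csinh (RtoC 0 * u) = 0).
  { rewrite Cmult_0_l. unfold csinh. replace (- 0)%C with (RtoC 0) by ring. ring. }
  assert (C0 : ccosh (RtoC 0 * u) = 1).
  { rewrite Cmult_0_l. unfold ccosh. replace (- 0)%C with (RtoC 0) by ring. rewrite Cexp_0. field. }
  assert (B0 : forall t, 0 <= t <= 1 -> Cmod (csinh (RtoC t * u)) <= B).
  { intros t Ht. unfold csinh.
    assert (Hr : forall s, s = 1 \/ s = -1 -> exp (Re (RtoC s * (RtoC t * u))%C) <= B).
    { intros s Hs. apply exp_le_compat.
      replace (Re _) with (s * (t * Re u)) by (simpl; unfold Re, Im; ring).
      pose proof (Rle_abs (Re u)). pose proof (Rle_abs (- Re u)) as Q. rewrite Rabs_Ropp in Q.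
      pose proof (Rabs_pos (Re u)).
      destruct Hs as [-> | ->]; nra. }
    pose proof (Hr 1 (or_introl eq_refl)) as H1. pose proof (Hr (-1) (or_intror eq_refl)) as H2.
    replace B with ((B + B) * / 2) by field. apply Cmod_le_mult.
    - apply Cmod_le_minus; rewrite Cmod_Cexp.
      + replace (RtoC t * u)%C with (RtoC 1 * (RtoC t * u))%C by ring. exact H1.
      + replace (- (RtoC t * u))%C with (RtoC (-1) * (RtoC t * u))%C
          by (apply injective_projections; simpl; ring). exact H2.
    - rewrite Cmod_inv, Cmod_R, Rabs_right by (lra || exact C2_neq_0). lra. }
  assert (Step : forall (f f' : R -> C) (M : R), 0 <= M -> f 0 = 0 ->
    (forall t, rder f t (f' t * u)%C) -> (forall t, 0 <= t <= 1 -> Cmod (f' t) <= M) ->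
    forall t, 0 <= t <= 1 -> Cmod (f t) <= M * Cmod u).
  { intros f f' M HM H0 Hd Hb t Ht.
    pose proof (rder_bound f (fun t => f' t * u)%C 0 t (M * Cmod u) ltac:(lra)) as T.
    rewrite H0 in T. replace (f t - 0)%C with (f t) in T by ring.
    eapply Rle_trans; [apply T|].
    - intros; apply Hd.
    - intros s Hs. apply Cmod_le_mult; [apply Hb; lra|lra].
    - assert (0 <= M * Cmod u) by nra. nra. }
  assert (T1 : forall t, 0 <= t <= 1 -> Cmod (ccosh (RtoC t * u) - 1)%C <= B * Cmod u).
  { apply (Step _ (fun t => csinh (RtoC t * u))); [lra| | |exact B0].
    - rewrite C0; ring.
    - intros t. eapply rder_eq; [apply rder_minus; [apply Dc|apply rder_const]|ring]. }
  assert (T2 : forall t, 0 <= t <= 1 ->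
     Cmod (csinh (RtoC t * u) - RtoC t * u)%C <= B * Cmod u * Cmod u).
  { apply (Step _ (fun t => ccosh (RtoC t * u) - 1)%C); [nra| | |exact T1].
    - rewrite S0; ring.
    - intros t. eapply rder_eq; [apply rder_minus; [apply Ds|apply L]|cbv beta; ring]. }
  assert (T3 : forall t, 0 <= t <= 1 ->
     Cmod (ccosh (RtoC t * u) - 1 - (RtoC t * u) * (RtoC t * u) * / 2)%C <= B * Cmod u * Cmod u * Cmod u).
  { apply (Step _ (fun t => csinh (RtoC t * u) - RtoC t * u)%C); [| | |exact T2].
    - assert (0 <= Cmod u * Cmod u) by nra. nra.
    - rewrite C0; ring.
    - intros t. eapply rder_eq; [apply rder_minus; [apply rder_minus; [apply Dc|apply rder_const]|
        apply rder_mult; [apply rder_mult; apply L|apply rder_const]]|cbv beta; field]. }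
  assert (T4 : forall t, 0 <= t <= 1 ->
     Cmod (csinh (RtoC t * u) - RtoC t * u
           - (RtoC t * u) * (RtoC t * u) * (RtoC t * u) * / 6)%C
     <= B * Cmod u * Cmod u * Cmod u * Cmod u).
  { apply (Step _ (fun t => ccosh (RtoC t * u) - 1 - (RtoC t * u) * (RtoC t * u) * / 2)%C);
      [| | |exact T3].
    - assert (0 <= Cmod u * Cmod u) by nra. assert (0 <= Cmod u * Cmod u * Cmod u) by nra. nra.
    - rewrite S0; ring.
    - intros t. eapply rder_eq; [apply rder_minus; [apply rder_minus; [apply Ds|apply L]|
        apply rder_mult; [apply rder_mult; [apply rder_mult; apply L|apply L]|apply rder_const]]|cbv beta; field]. }
  specialize (T4 1 ltac:(lra)). rewrite !Cmult_1_l in T4. eapply Rle_trans; [exact T4|].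
  apply Req_le; ring.
Qed.

Lemma gauss_dom (A k x : R) : 0 < A -> exp (k * Rabs x - A * x ^ 2) <= exp (k ^ 2 / (4 * A)).
Proof.
  intros HA. apply exp_le_compat.
  replace (x ^ 2) with (Rabs x ^ 2) by (rewrite <- Rsqr_pow2, <- Rsqr_abs, Rsqr_pow2; reflexivity).
  set (q := Rabs x).
  assert (E : k ^ 2 / (4 * A) - (k * q - A * q ^ 2) = (k - 2 * A * q) ^ 2 / (4 * A)) by (field; lra).
  assert (0 <= (k - 2 * A * q) ^ 2 / (4 * A)).
  { apply Rdiv_le_0_compat; [apply pow2_ge_0|lra]. }
  lra.
Qed.

(** By [z^m <= exp (m z)] everything in front of the Gaussian, including [1 + x^2], is below one
    exponential of [|x|], which completing the square absorbs. *)
Lemma poly_gauss (A c : R) (n : nat) : 0 < A -> 0 <= c -> exists B, 0 <= B /\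
  forall x, (1 + c + Rabs x) ^ n * exp (Rabs x) * exp (- (A * x ^ 2)) <= B / (1 + x ^ 2).
Proof.
  intros HA Hc. set (k := INR n + 3).
  exists (exp (INR n * (1 + c) + 2 + k ^ 2 / (4 * A))); split; [apply Rlt_le, exp_pos|].
  intros x. pose proof (Rabs_pos x) as Hx.
  assert (P1 : forall m z, 0 <= z -> z ^ m <= exp (INR m * z)).
  { intros m z Hz. induction m as [|m IH].
    - simpl. rewrite Rmult_0_l, exp_0; lra.
    - rewrite S_INR, Rmult_plus_distr_r, Rmult_1_l, exp_plus, (Rmult_comm (exp _)). simpl.
      apply Rmult_le_compat; [exact Hz|now apply pow_le| |exact IH].
      pose proof (exp_ineq1_le z); lra. }
  assert (P2 : 1 + x ^ 2 <= exp (2 * (1 + Rabs x))).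
  { apply Rle_trans with ((1 + Rabs x) ^ 2).
    - replace (x ^ 2) with (Rabs x ^ 2) by (rewrite <- Rsqr_pow2, <- Rsqr_abs, Rsqr_pow2; reflexivity).
      nra.
    - apply (P1 2%nat). lra. }
  assert (Hx2 : 0 <= x ^ 2) by nra.
  apply (Rle_div_r _ _ (1 + x ^ 2)); [lra|].
  apply Rle_trans with (exp (INR n * (1 + c + Rabs x)) * exp (Rabs x) * exp (- (A * x ^ 2)) *
     exp (2 * (1 + Rabs x))).
  - repeat apply Rmult_le_compat; try apply Rlt_le, exp_pos; try lra.
    + repeat apply Rmult_le_pos; try apply Rlt_le, exp_pos. apply pow_le; lra.
    + apply Rmult_le_pos; [apply pow_le; lra|apply Rlt_le, exp_pos].
    + apply pow_le; lra.
    + apply P1; lra.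
  - rewrite <- !exp_plus. 
    replace (INR n * (1 + c + Rabs x) + Rabs x + - (A * x ^ 2) + 2 * (1 + Rabs x))
      with (INR n * (1 + c) + 2 + (k * Rabs x - A * x ^ 2)) by (unfold k; ring).
    rewrite !(exp_plus (INR n * (1 + c) + 2)).
    apply Rmult_le_compat_l; [apply Rlt_le, exp_pos|now apply gauss_dom].
Qed.

(** * The limit of the path *)

(** The limit of [ker] on the path as [al] tends to [0]: [xi / gap al] behaves like [3 xi / al^3],
    and [sinh (al w) - al w cos al] like [al^3 (w^3 / 6 + w / 2)]. *)
Definition kcub (xi : R) (w : C) : C :=
  Cexp (- Ci * RtoC (3 * xi) * (w * w * w * / 6 + w * / 2))%C.

Definition integrand0 (j : bool) (xi b x : R) : C :=
  (kcub xi (lineb b x) * amp j (lineb b x))%C.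

Lemma Cmod_kcub (xi b x : R) :
  Cmod (kcub xi (lineb b x)) = exp (3 * xi / 2 * (b ^ 3 / 3 - b - b * x ^ 2)).
Proof.
  unfold kcub. rewrite Cmod_Cexp. f_equal.
  unfold lineb; simpl; unfold Re, Im; simpl. field.
Qed.

Lemma cder_cubic (w : C) : cder (fun w => w * w * w * / 6 + w * / 2)%C w (w * w * / 2 + / 2)%C.
Proof.
  eapply cder_eq.
  - apply cder_plus; apply cder_mult; try apply cder_const; [|apply cder_id].
    apply cder_mult; [apply cder_mult; apply cder_id|apply cder_id].
  - cbv beta. field.
Qed.

Lemma cder_kcub (xi : R) (w : C) :
  cder (kcub xi) w (- Ci * RtoC (3 * xi) * (w * w * / 2 + / 2) * kcub xi w)%C.
Proof.
  eapply cder_eq.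
  - apply (cder_comp Cexp (fun w => - Ci * RtoC (3 * xi) * (w * w * w * / 6 + w * / 2))%C);
      [apply cder_Cexp|apply cder_scal, cder_cubic].
  - fold (kcub xi w). ring.
Qed.

Lemma integrand0_ccont (j : bool) (xi b x : R) : ccont (integrand0 j xi b) x.
Proof.
  apply ccont_mult.
  - eapply rder_ccont, (rder_cder (kcub xi) (lineb b)); [apply cder_kcub|apply rder_lineb].
  - eapply rder_ccont, (rder_cder (amp j) (lineb b)); [apply cder_amp|apply rder_lineb].
Qed.

Lemma lineb_bound_abs (b x : R) : 0 <= b -> Cmod (lineb b x) <= b + Rabs x.
Proof.
  intros Hb. unfold lineb. rewrite Rplus_comm. apply Cmod_le_minus.
  - rewrite Cmod_R; lra.
  - rewrite Cmod_mult, Cmod_Ci, Cmod_R, Rabs_right; lra.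
Qed.

Lemma amp_line_bound (j : bool) (b x : R) : 0 <= b ->
  Cmod (amp j (lineb b x)) <= 1 + b + Rabs x.
Proof.
  intros Hb. pose proof (Rabs_pos x). apply amp_bound; [lra|].
  pose proof (lineb_bound_abs b x Hb); lra.
Qed.

Lemma gap_ge_quintic (al : R) : 0 <= al <= 1 -> al ^ 3 / 3 - al ^ 5 / 24 <= gap al.
Proof.
  intros H. unfold gap.
  pose proof (sin_ge_cubic al ltac:(lra)). pose proof (cos_le_quartic al ltac:(lra)).
  assert (al * cos al <= al * (1 - al ^ 2 / 2 + al ^ 4 / 24)) by (apply Rmult_le_compat_l; lra).
  nra.
Qed.

Lemma scale_cube (xi al : R) : 0 < xi -> 0 < al <= 1 / 2 ->
  3 * xi <= xi / gap al * al ^ 3 <= 3 * xi + xi * al.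
Proof.
  intros Hxi Ha. pose proof (gap_pos al Ha) as Hg.
  pose proof (gap_le al ltac:(lra)) as H1. pose proof (gap_ge_quintic al ltac:(lra)) as H2.
  pose proof (gap_ge al ltac:(lra)) as H3.
  assert (A3 : 0 < al ^ 3) by (apply pow_lt; lra).
  replace (xi / gap al * al ^ 3) with (xi * al ^ 3 / gap al) by (field; lra).
  split.
  - apply (Rle_div_r _ _ (gap al)); [lra|]. nra.
  - apply (Rle_div_l _ _ (gap al)); [lra|].
    assert (al ^ 5 = al * (al * al ^ 3)) by ring.
    assert (al * al ^ 3 <= 1 / 2 * al ^ 3) by nra.
    assert (Q : al ^ 3 <= 3 * gap al + al * gap al).
    { assert (al ^ 5 <= al * (1 / 2 * al ^ 3)) by nra.
      assert (al * (al ^ 3 / 4) <= al * gap al) by nra. nra. }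
    nra.
Qed.

(** Serves only to let [al] tend to [0] with [xi] and [b] fixed, so [B] may depend on both. The
    power [5] in [poly_gauss] is [4] from the difference of the exponents plus [1] from the
    amplitude. *)
Lemma integrand_close (j : bool) (xi b : R) : 0 < xi -> 1 <= b -> exists B, 0 <= B /\
  forall al x, good (xi / gap al) al b ->
  Cmod (integrand j xi b al x - integrand0 j xi b x)%C <= al * B / (1 + x ^ 2).
Proof.
  intros Hxi Hb. destruct (poly_gauss (xi * b) b 5) as (B & HB & HP); [nra|lra|].
  set (c := exp (2 - xi) + exp (3 * xi / 2 * (b ^ 3 / 3 - b))).
  assert (Hc : 0 < c) by (apply Rplus_lt_0_compat; apply exp_pos).
  exists (6 * xi * c * B); split; [repeat apply Rmult_le_pos; lra|].
  intros al x G. specialize (HP x).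
  assert (G' := G). destruct G' as (Ha & HY & _ & _).
  pose proof (gap_pos al Ha) as Hg. pose proof (scale_cube xi al Hxi Ha) as Hk.
  assert (Exi : xi / gap al * gap al = xi) by (field; lra).
  set (Y := xi / gap al) in *. set (k := Y * al ^ 3) in *.
  set (w := lineb b x). set (q := 1 + b + Rabs x).
  pose proof (Rabs_pos x) as Hx.
  assert (Hq : 2 <= q) by (unfold q; lra).
  assert (Hw : Cmod w <= q - 1) by (pose proof (lineb_bound_abs b x ltac:(lra)); unfold w, q; lra).
  pose proof (Cmod_ge_0 w) as Hw0.
  set (z1 := (- Ci * RtoC Y * (csinh (RtoC al * w) - RtoC (cos al) * (RtoC al * w)))%C).
  set (z0 := (- Ci * RtoC (3 * xi) * (w * w * w * / 6 + w * / 2))%C).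
  assert (Hz : Cmod (z1 - z0)%C <= al * (6 * xi * (q ^ 4 * exp (Rabs x)))).
  { set (u := (RtoC al * w)%C).
    (* Three sources of error: the Taylor remainder of [sinh], [Y al^3] against [3 xi], and
       [Y al (1 - cos al)] against [3 xi / 2]. They contribute [4 xi], [xi] and [xi] to the factor
       [6 xi]. *)
    assert (E : (z1 - z0 = - Ci * (RtoC Y * (csinh u - u - u * u * u * / 6)
        + RtoC (k - 3 * xi) * (w * w * w * / 6)
        + RtoC (Y * al * (1 - cos al) - 3 * xi / 2) * w))%C).
    { unfold z1, z0. fold u. unfold k.
      replace (RtoC (Y * al ^ 3 - 3 * xi)) with (RtoC Y * (RtoC al * RtoC al * RtoC al) - RtoC (3 * xi))%C
        by (apply injective_projections; simpl; ring).
      replace (RtoC (Y * al * (1 - cos al) - 3 * xi / 2))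
        with (RtoC Y * RtoC al * (1 - RtoC (cos al)) - RtoC (3 * xi) * / 2)%C
        by (apply injective_projections; simpl; field).
      unfold u. field. }
    rewrite E, Cmod_mult, Cmod_opp, Cmod_Ci, Rmult_1_l.
    assert (Qe : 1 <= exp (Rabs x)) by (pose proof (exp_ineq1_le (Rabs x)); lra).
    assert (Hwq : Cmod w <= q) by lra.
    assert (Q4 : Cmod w ^ 4 <= q ^ 4) by (apply pow_incr; lra).
    assert (Q3 : Cmod w * Cmod w * Cmod w <= q ^ 4).
    { apply Rle_trans with (q ^ 3).
      - replace (Cmod w * Cmod w * Cmod w) with (Cmod w ^ 3) by ring. apply pow_incr; lra.
      - simpl. assert (0 < q * (q * (q * 1))) by nra. nra. }
    assert (Q1 : Cmod w <= q ^ 4).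
    { apply Rle_trans with q; [lra|]. simpl. assert (1 <= q * (q * (q * 1))) by nra. nra. }
    assert (X4 : Cmod w ^ 4 <= q ^ 4 * exp (Rabs x)) by (assert (0 <= q ^ 4) by (apply pow_le; lra); nra).
    assert (X3 : Cmod w * Cmod w * Cmod w <= q ^ 4 * exp (Rabs x)) by (assert (0 <= q ^ 4) by (apply pow_le; lra); nra).
    assert (X1 : Cmod w <= q ^ 4 * exp (Rabs x)) by (assert (0 <= q ^ 4) by (apply pow_le; lra); nra).
    set (M := q ^ 4 * exp (Rabs x)) in *.
    assert (HM : 0 <= M) by lra.
    replace (al * (6 * xi * M)) with (4 * xi * (al * M) + al * xi * M + al * xi * M) by ring.
    apply Cmod_le_plus; [apply Cmod_le_plus|].
    - rewrite Cmod_mult, Cmod_R, Rabs_right by lra.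
      apply Rle_trans with (Y * (Cmod u ^ 4 * exp (Rabs (Re u)))).
      + apply Rmult_le_compat_l; [lra|apply csinh_taylor].
      + assert (Ecm : Cmod u = al * Cmod w).
        { unfold u. rewrite Cmod_mult, Cmod_R, Rabs_right; lra. }
        assert (Ere : Rabs (Re u) <= Rabs x).
        { unfold u, w, lineb; simpl; unfold Re, Im; simpl.
          replace (al * _ - _) with (al * x) by ring. rewrite Rabs_mult, Rabs_right by lra. nra. }
        rewrite Ecm.
        replace (Y * ((al * Cmod w) ^ 4 * exp (Rabs (Re u))))
          with (k * (al * (Cmod w ^ 4 * exp (Rabs (Re u))))) by (unfold k; ring).
        assert (exp (Rabs (Re u)) <= exp (Rabs x)) by now apply exp_le_compat.
        assert (0 <= Cmod w ^ 4) by (apply pow_le; lra).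
        pose proof (exp_pos (Rabs (Re u))).
        assert (Cmod w ^ 4 * exp (Rabs (Re u)) <= M).
        { unfold M. apply Rmult_le_compat; lra. }
        apply Rmult_le_compat; [lra| |nra|apply Rmult_le_compat_l; lra].
        apply Rmult_le_pos; [lra|]. apply Rmult_le_pos; lra.
    - apply Cmod_le_mult.
      + rewrite Cmod_R, Rabs_right; nra.
      + rewrite !Cmod_mult, Cmod_inv, Cmod_R, Rabs_right by
          (lra || (apply RtoC_neq_0; lra)).
        assert (0 <= Cmod w * Cmod w * Cmod w) by (assert (0 <= Cmod w * Cmod w) by nra; nra). lra.
    - apply Cmod_le_mult; [|exact X1].
      rewrite Cmod_R. apply Rabs_le.
      pose proof (cos_ge_quad al ltac:(lra)) as K1. pose proof (cos_le_quartic al ltac:(lra)) as K2.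
      assert (U1 : Y * al * (1 - cos al) <= k / 2).
      { replace (k / 2) with (Y * al * (al ^ 2 / 2)) by (unfold k; field).
        apply Rmult_le_compat_l; [nra|lra]. }
      assert (U2 : k / 2 - k * al ^ 2 / 24 <= Y * al * (1 - cos al)).
      { replace (k / 2 - k * al ^ 2 / 24) with (Y * al * (al ^ 2 / 2 - al ^ 4 / 24)) by (unfold k; field).
        apply Rmult_le_compat_l; [nra|lra]. }
      assert (k * al ^ 2 <= 4 * xi * al).
      { assert (al ^ 2 <= al) by nra. assert (0 <= al ^ 2) by nra.
        assert (k <= 4 * xi) by nra. apply Rmult_le_compat; lra. }
      split; nra. }
  assert (He1 : exp (Re z1) <= exp (2 - xi) * exp (- (xi * b * x ^ 2))).
  { rewrite <- Cmod_Cexp. change (Cexp z1) with (ker Y al (RtoC al * lineb b x)%C).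
    eapply Rle_trans; [apply (ker_gauss Y al b x G)|]. rewrite Exi, <- exp_plus.
    apply exp_le_compat. assert (0 <= xi * b * x ^ 2) by (apply Rmult_le_pos; [nra|apply pow2_ge_0]). lra. }
  assert (He0 : exp (Re z0) <= exp (3 * xi / 2 * (b ^ 3 / 3 - b)) * exp (- (xi * b * x ^ 2))).
  { rewrite <- Cmod_Cexp. change (Cexp z0) with (kcub xi (lineb b x)). rewrite Cmod_kcub, <- exp_plus.
    apply exp_le_compat. assert (0 <= xi * b * x ^ 2) by (apply Rmult_le_pos; [nra|apply pow2_ge_0]).
    replace (3 * xi / 2 * (b ^ 3 / 3 - b - b * x ^ 2))
      with (3 * xi / 2 * (b ^ 3 / 3 - b) - 3 / 2 * (xi * b * x ^ 2)) by field. lra. }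
  unfold integrand, integrand0. fold Y w.
  replace (_ - _)%C with ((Cexp z1 - Cexp z0) * amp j w)%C by (unfold z1, z0, ker, kcub; ring).
  rewrite Cmod_mult.
  apply Rle_trans with (al * (6 * xi * (q ^ 4 * exp (Rabs x))) * (c * exp (- (xi * b * x ^ 2))) * q).
  - apply Rmult_le_compat; try apply Cmod_ge_0; [|apply amp_line_bound; lra].
    eapply Rle_trans; [apply Cexp_diff|].
    pose proof (exp_pos (Re z1)). pose proof (exp_pos (Re z0)).
    apply Rmult_le_compat; [apply Cmod_ge_0|lra|exact Hz|].
    unfold c. rewrite Rmult_plus_distr_r. lra.
  - replace (al * (6 * xi * (q ^ 4 * exp (Rabs x))) * (c * exp (- (xi * b * x ^ 2))) * q)
      with (al * (6 * xi * c) * (q ^ 5 * exp (Rabs x) * exp (- (xi * b * x ^ 2)))) by ring.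
    replace (al * (6 * xi * c * B) / (1 + x ^ 2)) with (al * (6 * xi * c) * (B / (1 + x ^ 2)))
      by (unfold Rdiv; ring).
    apply Rmult_le_compat_l; [|exact HP]. repeat apply Rmult_le_pos; lra.
Qed.

(** The squares are compared: [nrm^2] is [xi / gap al * al^3] times [sin al / al], hence within
    [O (xi al)] of [3 xi]; then one divides by the sum of the roots. *)
Lemma nrm_limit (xi al : R) : 0 < xi -> 0 < al <= 1 / 2 ->
  Rabs (nrm xi al - sqrt (3 * xi)) <= 2 * sqrt xi * al.
Proof.
  intros Hxi Ha.
  pose proof (gap_pos al Ha) as Hg. pose proof (sin_ge_cubic al ltac:(lra)) as S1.
  pose proof (sin_le_id al ltac:(lra)) as S2. pose proof (sin_ge_lin al ltac:(lra)) as S3.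
  pose proof (scale_cube xi al Hxi Ha) as Hk.
  pose proof (nrm_bounds xi al Hxi Ha) as [Hn1 Hn2].
  assert (Hsx : 0 < sqrt xi) by now apply sqrt_lt_R0.
  assert (Hh : 0 < xi * sin al / gap al) by (apply Rdiv_lt_0_compat; nra).
  assert (E2 : nrm xi al ^ 2 = xi / gap al * al ^ 3 * (sin al / al)).
  { unfold nrm. rewrite Rpow_mult_distr, <- (Rsqr_pow2 (sqrt _)), Rsqr_sqrt by lra. field. lra. }
  assert (R1 : 1 - al <= sin al / al <= 1).
  { split.
    - apply (Rle_div_r _ _ al); [lra|]. nra.
    - apply (Rle_div_l _ _ al); lra. }
  set (k := xi / gap al * al ^ 3) in *. set (s := sin al / al) in *.
  assert (E3 : sqrt (3 * xi) ^ 2 = 3 * xi) by (rewrite <- Rsqr_pow2, Rsqr_sqrt; lra).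
  assert (E4 : sqrt xi ^ 2 = xi) by (rewrite <- Rsqr_pow2, Rsqr_sqrt; lra).
  assert (E5 : 3 / 2 * sqrt xi <= sqrt (3 * xi)).
  { apply Rsqr_incr_0_var; [|apply sqrt_pos]. rewrite !Rsqr_pow2, E3, Rpow_mult_distr, E4. lra. }
  set (n := nrm xi al) in *. set (h := sqrt (3 * xi)) in *. set (g := sqrt xi) in *.
  assert (D : - (4 * xi * al) <= n ^ 2 - h ^ 2 <= xi * al).
  { rewrite E2, E3. split; [|nra]. nra. }
  assert (F : (n - h) * (n + h) = n ^ 2 - h ^ 2) by ring.
  assert (P : 5 / 2 * g <= n + h) by lra.
  assert (Hg0 : 0 < g * al) by nra.
  apply Rabs_le; split; apply Rnot_lt_le; intros Hlt.
  - assert (2 * g * al * (5 / 2 * g) <= (h - n) * (n + h)) by (apply Rmult_le_compat; nra).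
    nra.
  - assert (2 * g * al * (5 / 2 * g) <= (n - h) * (n + h)) by (apply Rmult_le_compat; nra).
    nra.
Qed.

(** The bound of [transport] does not involve the lower end of the path, so that end can be sent to
    [0]. *)
Lemma transport_to_cubic : exists K0, 0 <= K0 /\
  forall xi b al j L L0, good (xi / gap al) al b ->
  clim (integrand j xi b al) L -> clim (integrand0 j xi b) L0 ->
  Cmod (RtoC (nrm xi al) * L - RtoC (sqrt (3 * xi)) * L0)%C
    <= 2 * sqrt xi * (al ^ 2 / (xi * scl j al) * (K0 * exp (- xi) / sqrt (xi * b))) * al.
Proof.
  destruct transport as (K0 & HK0 & HT). exists K0; split; [exact HK0|].
  intros xi b al j L L0 G HL HL0.
  assert (G' := G). destruct G' as (Ha & _ & Hb & _).
  assert (Hxi : 0 < xi) by (eapply (good_path xi b al al); [lra|exact G]).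
  destruct (integrand_close j xi b Hxi Hb) as (B & HB & HC).
  assert (Hsx : 0 < sqrt xi) by now apply sqrt_lt_R0.
  pose proof PI_RGT_0 as HPI.
  set (S := 2 * sqrt xi * _ * al).
  apply le_epsilon. intros eps He.
  set (Q := 2 * sqrt xi * (B * PI) + 2 * sqrt xi * Cmod L0 + 1).
  pose proof (Cmod_ge_0 L0) as HL00.
  assert (HBP : 0 <= B * PI) by nra.
  assert (HQ : 0 < Q) by (unfold Q; nra).
  (* At this end of the path, replacing [nrm] and the integral by their limits costs at most [eps];
     the non-uniform constant [B] enters only through this choice. *)
  set (a1 := Rmin al (eps / Q)).
  assert (Ha1 : 0 < a1) by (apply Rmin_glb_lt; [lra|now apply Rdiv_lt_0_compat]).
  assert (Ha1' : a1 <= al) by apply Rmin_l.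
  assert (Ha1q : a1 * Q <= eps).
  { apply (Rle_div_r _ _ Q); [lra|]. apply Rmin_r. }
  destruct (good_path xi b al a1 ltac:(lra) G) as (G1 & _ & _).
  destruct (clim_exists_integrand j xi b a1 G1) as [L1 HL1].
  specialize (HT xi b al a1 j L L1 G ltac:(lra) HL HL1). fold S in HT.
  assert (D1 : Cmod (L1 - L0)%C <= a1 * (B * PI)).
  { pose proof (clim_scal _ (RtoC (-1)) _ (fun x => integrand0_ccont j xi b x) HL0) as Hm.
    assert (Cm : forall x, ccont (fun t => RtoC (-1) * integrand0 j xi b t)%C x).
    { intros x. apply ccont_mult; [apply ccont_const|apply integrand0_ccont]. }
    pose proof (clim_plus _ _ _ _ (fun x => integrand_ccont j xi b a1 x) Cm HL1 Hm) as Hs.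
    replace (L1 - L0)%C with (L1 + RtoC (-1) * L0)%C by (apply injective_projections; simpl; ring).
    apply (clim_bound _ _ _ Hs). intros N HN.
    replace (a1 * (B * PI)) with (a1 * B * PI / sqrt 1) by (rewrite sqrt_1; field).
    apply CInt_lorentz; [lra|exact HN| |].
    - intros x. apply ccont_plus; [apply integrand_ccont|auto].
    - intros x. rewrite Rmult_1_l.
      replace (integrand j xi b a1 x + RtoC (-1) * integrand0 j xi b x)%C
        with (integrand j xi b a1 x - integrand0 j xi b x)%C
        by (apply injective_projections; simpl; ring).
      now apply HC. }
  pose proof (nrm_limit xi a1 Hxi ltac:(lra)) as D2.
  pose proof (nrm_bounds xi a1 Hxi ltac:(lra)) as [_ D3].
  pose proof (nrm_bounds xi a1 Hxi ltac:(lra)) as [D4 _].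
  replace (RtoC (nrm xi al) * L - RtoC (sqrt (3 * xi)) * L0)%C with
    ((RtoC (nrm xi al) * L - RtoC (nrm xi a1) * L1)
      + (RtoC (nrm xi a1) * (L1 - L0) + RtoC (nrm xi a1 - sqrt (3 * xi)) * L0))%C
    by (rewrite RtoC_minus; ring).
  eapply Rle_trans; [apply Cmod_le_plus; [exact HT|apply Cmod_le_plus; apply Cmod_le_mult;
    [rewrite Cmod_R, Rabs_right by lra; exact D3|exact D1|rewrite Cmod_R; exact D2|apply Rle_refl]]|].
  apply Rplus_le_compat_l. unfold Q in Ha1q. nra.
Qed.

(** * The Airy function *)

(** The sign is chosen so that the decay is below the real axis, on the same side as for [ker]. *)
Definition airy_phase (x : R) (z : C) : C := Cexp (- Ci * (z * z * z * / 3 + RtoC x * z))%C.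

Lemma cder_airy_phase (x : R) (z : C) :
  cder (airy_phase x) z (- Ci * (z * z + RtoC x) * airy_phase x z)%C.
Proof.
  eapply cder_eq.
  - apply (cder_comp Cexp (fun z => - Ci * (z * z * z * / 3 + RtoC x * z))%C); [apply cder_Cexp|].
    apply cder_scal, cder_plus.
    + apply cder_mult; [apply cder_mult; [apply cder_mult; apply cder_id|apply cder_id]|apply cder_const].
    + apply cder_scal, cder_id.
  - fold (airy_phase x z). cbv beta. field.
Qed.

Lemma Cmod_airy_phase (x a e : R) :
  Cmod (airy_phase x (RtoC a + Ci * RtoC e)%C) = exp (a ^ 2 * e - e ^ 3 / 3 + x * e).
Proof.
  unfold airy_phase. rewrite Cmod_Cexp. f_equal. simpl; unfold Re, Im; simpl. field.
Qed.

(** Integrand for [2 PI] times the [n]-th derivative of [Airy], on the line [Im z = - h], where it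
    has Gaussian decay and may be differentiated in [x]. *)
Definition airy_line (n : nat) (h x t : R) : C :=
  ((- Ci * lineb h t) ^ n * airy_phase x (lineb h t))%C.

Lemma cder_pow_lin (n : nat) (z : C) : exists l, cder (fun z => (- Ci * z) ^ n)%C z l.
Proof.
  induction n as [|n [l IH]].
  - exists 0. exact (cder_const 1 z).
  - eexists. simpl. apply cder_mult; [apply cder_scal, cder_id|exact IH].
Qed.

Lemma airy_line_ccont (n : nat) (h x t : R) : ccont (airy_line n h x) t.
Proof.
  apply ccont_mult.
  - destruct (cder_pow_lin n (lineb h t)) as [l Hl].
    eapply rder_ccont, (rder_cder (fun z => (- Ci * z) ^ n)%C (lineb h)); [exact Hl|apply rder_lineb].
  - eapply rder_ccont, (rder_cder (airy_phase x) (lineb h)); [apply cder_airy_phase|apply rder_lineb].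
Qed.

Lemma Cmod_airy_phase_line (h x t : R) :
  Cmod (airy_phase x (lineb h t)) = exp (h ^ 3 / 3 - x * h) * exp (- (h * t ^ 2)).
Proof.
  rewrite <- exp_plus. unfold lineb.
  replace (RtoC t - Ci * RtoC h)%C with (RtoC t + Ci * RtoC (- h))%C by (rewrite RtoC_opp; ring).
  rewrite Cmod_airy_phase. f_equal. field.
Qed.

Lemma airy_line_bound (n : nat) (h x t : R) : 0 < h ->
  Cmod (airy_line n h x t) <=
    exp (h ^ 3 / 3 - x * h) * ((1 + h + Rabs t) ^ n * exp (Rabs t) * exp (- (h * t ^ 2))).
Proof.
  intros Hh. unfold airy_line. rewrite Cmod_mult, Cmod_pow, Cmod_airy_phase_line.
  rewrite Cmod_mult, Cmod_opp, Cmod_Ci, Rmult_1_l.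
  pose proof (lineb_bound_abs h t ltac:(lra)) as Hw. pose proof (Rabs_pos t).
  pose proof (Cmod_ge_0 (lineb h t)).
  assert (P : Cmod (lineb h t) ^ n <= (1 + h + Rabs t) ^ n) by (apply pow_incr; lra).
  pose proof (exp_ineq1_le (Rabs t)). pose proof (exp_pos (h ^ 3 / 3 - x * h)).
  pose proof (exp_pos (- (h * t ^ 2))).
  assert (0 <= (1 + h + Rabs t) ^ n) by (apply pow_le; lra).
  replace (Cmod (lineb h t) ^ n * (exp (h ^ 3 / 3 - x * h) * exp (- (h * t ^ 2))))
    with (exp (h ^ 3 / 3 - x * h) * (Cmod (lineb h t) ^ n * exp (- (h * t ^ 2)))) by ring.
  apply Rmult_le_compat_l; [lra|]. apply Rmult_le_compat_r; [lra|]. nra.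
Qed.

Lemma airy_line_clim (n : nat) (h x : R) : 0 < h -> exists L, clim (airy_line n h x) L.
Proof.
  intros Hh. destruct (poly_gauss h h n) as (B & HB & HP); [lra|lra|].
  destruct (dominated_clim (airy_line n h x) (exp (h ^ 3 / 3 - x * h) * B)) as (L & HL & _);
    [| |now exists L].
  - intros; apply airy_line_ccont.
  - intros t. eapply Rle_trans; [apply airy_line_bound, Hh|].
    replace (exp (h ^ 3 / 3 - x * h) * B / (1 + t ^ 2))
      with (exp (h ^ 3 / 3 - x * h) * (B / (1 + t ^ 2))) by (unfold Rdiv; ring).
    apply Rmult_le_compat_l; [apply Rlt_le, exp_pos|apply HP].
Qed.

Lemma is_RInt_exp_lin (c h : R) : 0 < c ->
  is_RInt (fun e => exp (c * e)) (- h) 0 ((1 - exp (- (c * h))) / c).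
Proof.
  intros Hc.
  evar_last.
  - apply (is_RInt_derive (fun e => exp (c * e) / c)).
    + intros e _. auto_derive; [exact I|]. field; lra.
    + intros e _. apply @ex_derive_continuous. auto_derive. exact I.
  - unfold minus, plus, opp; simpl. rewrite Rmult_0_r, exp_0.
    replace (c * - h) with (- (c * h)) by ring. 
    match goal with |- @eq _ ?a ?b => change (@eq R a b) end. field; lra.
Qed.

(** On the vertical sides of the rectangle the modulus at height [e] is at most [E0 exp (N^2 e)]
    with [- h <= e <= 0], and the integral of this is below [E0 / N^2]. So the conditionally
    convergent integral inherits the value of the absolutely convergent one. *)
Lemma airy_real_line (h x : R) (L : C) : 0 < h -> clim (airy_line 0 h x) L ->
  clim (fun t => airy_phase x (RtoC t)) L.
Proof.
  intros Hh HL.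
  set (E0 := exp (h ^ 3 / 3 + Rabs x * h)).
  assert (HE : 0 < E0) by apply exp_pos.
  apply (clim_close (airy_line 0 h x) _ L (2 * E0) 1); [lra| |exact HL].
  intros N HN.
  pose proof (rectangle (airy_phase x) (fun z => - Ci * (z * z + RtoC x) * airy_phase x z)%C
    N (- h) 0 (scal E0 ((1 - exp (- (N ^ 2 * h))) / N ^ 2)) (fun e => scal E0 (exp (N ^ 2 * e)))) as T.
  replace (CInt (fun t => airy_phase x (RtoC t)) (- N) N)
    with (CInt (fun t => airy_phase x (RtoC t + Ci * RtoC 0)%C) (- N) N).
  2: { apply CInt_ext; [lra|]. intros t _. f_equal. ring. }
  replace (CInt (airy_line 0 h x) (- N) N)
    with (CInt (fun t => airy_phase x (RtoC t + Ci * RtoC (- h))%C) (- N) N).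
  2: { apply CInt_ext; [lra|]. intros t _.
       unfold airy_line, lineb. simpl. rewrite Cmult_1_l. f_equal.
       rewrite RtoC_opp; ring. }
  assert (N2 : 0 < N ^ 2) by nra.
  eapply Rle_trans; [apply T|].
  - lra.
  - lra.
  - intros z; apply cder_airy_phase.
  - intros z. eexists. apply cder_mult; [|apply cder_airy_phase].
    apply cder_scal, cder_plus; [apply cder_mult; apply cder_id|apply cder_const].
  - intros e He. rewrite !Cmod_airy_phase.
    replace ((- N) ^ 2) with (N ^ 2) by ring.
    assert (Q : exp (N ^ 2 * e - e ^ 3 / 3 + x * e) <= E0 * exp (N ^ 2 * e)).
    { unfold E0. rewrite <- exp_plus. apply exp_le_compat.
      assert (- e ^ 3 <= h ^ 3).
      { replace (- e ^ 3) with ((- e) ^ 3) by ring. apply pow_incr; lra. }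
      assert (x * e <= Rabs x * h).
      { eapply Rle_trans; [apply Rle_abs|]. rewrite Rabs_mult, (Rabs_left1 e) by lra.
        apply Rmult_le_compat_l; [apply Rabs_pos|lra]. }
      lra. }
    split; exact Q.
  - apply (is_RInt_scal (V := R_NormedModule)). now apply is_RInt_exp_lin.
  - change (2 * (E0 * ((1 - exp (- (N ^ 2 * h))) / N ^ 2)) <= 2 * E0 / N).
    pose proof (exp_pos (- (N ^ 2 * h))) as Hp.
    assert (Q : (1 - exp (- (N ^ 2 * h))) / N ^ 2 <= / N).
    { apply Rle_trans with (1 * / N ^ 2).
      - apply Rmult_le_compat_r; [apply Rlt_le, Rinv_0_lt_compat; lra|lra].
      - rewrite Rmult_1_l. apply Rinv_le_contravar; nra. }
    apply (Rmult_le_compat_l (2 * E0)) in Q; [|lra]. unfold Rdiv in *. lra.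
Qed.

Lemma airy_real_components (x t : R) :
  airy_phase x (RtoC t) = (cos (t ^ 3 / 3 + x * t), - sin (t ^ 3 / 3 + x * t)).
Proof.
  unfold airy_phase, Cexp; simpl; unfold Re, Im; simpl.
  match goal with |- (exp ?a * cos ?b, exp ?a * sin ?b) = _ =>
    replace a with 0 by field; replace b with (- (t ^ 3 / 3 + x * t)) by field end.
  rewrite exp_0, cos_neg, sin_neg. apply injective_projections; simpl; ring.
Qed.

Lemma RInt_reflect (f : R -> R) (N : R) : (forall t, continuous f t) ->
  RInt f (- N) 0 = RInt (fun t => f (- t)) 0 N.
Proof.
  intros Hf.
  assert (Hi : forall a b, ex_RInt f a b).
  { intros; apply (ex_RInt_continuous (V := R_CompleteNormedModule)); intros; apply Hf. }
  pose proof (RInt_comp_lin f (-1) 0 0 N (Hi _ _)) as E.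
  replace (-1 * 0 + 0) with 0 in E by ring. replace (-1 * N + 0) with (- N) in E by ring.
  rewrite <- (opp_RInt_swap f 0 (- N)) by apply Hi.
  rewrite <- E. rewrite RInt_scal.
  - unfold opp, scal; simpl; unfold mult; simpl.
    assert (Q : forall r : R, - (-1 * r) = r) by (intros; ring).
    etransitivity; [apply Q|]. apply RInt_ext. intros; f_equal; ring.
  - apply (ex_RInt_ext (fun t => f (- t))); [intros; f_equal; ring|].
    apply (ex_RInt_continuous (V := R_CompleteNormedModule)). intros z _.
    apply (continuous_comp (fun t => - t) f); [apply (continuous_opp (V := R_NormedModule)), continuous_id|apply Hf].
Qed.

Lemma Req_of_small (a : R) : (forall eps, 0 < eps -> Rabs a <= eps) -> a = 0.
Proof.
  intros H. destruct (Req_dec a 0) as [?|n]; [assumption|].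
  pose proof (Rabs_pos_lt a n). specialize (H (Rabs a / 2) ltac:(lra)). lra.
Qed.

(** On the real line the imaginary part is odd and cancels, and the even real part doubles the
    half-line integral. The height stays free because rescaling the line of height [b] leads to
    [h = c b]. *)
Lemma airy_rep (h x : R) : 0 < h -> clim (airy_line 0 h x) (RtoC (2 * PI * Airy x)).
Proof.
  intros Hh. destruct (airy_line_clim 0 h x Hh) as [L HL].
  pose proof (airy_real_line h x L Hh HL) as HR.
  set (c := fun t => cos (t ^ 3 / 3 + x * t)). set (s := fun t => - sin (t ^ 3 / 3 + x * t)).
  assert (Cc : forall t, continuous c t).
  { intros t. apply @ex_derive_continuous. unfold c. auto_derive. exact I. }
  assert (Cs : forall t, continuous s t).
  { intros t. apply @ex_derive_continuous. unfold s. auto_derive. exact I. }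
  assert (Ic : forall a b, ex_RInt c a b).
  { intros; apply (ex_RInt_continuous (V := R_CompleteNormedModule)); intros; apply Cc. }
  assert (Is : forall a b, ex_RInt s a b).
  { intros; apply (ex_RInt_continuous (V := R_CompleteNormedModule)); intros; apply Cs. }
  assert (EN : forall N, CInt (fun t => airy_phase x (RtoC t)) (- N) N = RtoC (2 * RInt c 0 N)).
  { intros N. unfold CInt. apply injective_projections; cbn [fst snd RtoC].
    - transitivity (RInt c (- N) N).
      { apply RInt_ext. intros t _. rewrite airy_real_components. reflexivity. }
      rewrite <- (RInt_Chasles c (- N) 0 N) by apply Ic. rewrite RInt_reflect by exact Cc.
      unfold plus; simpl.
      replace (RInt (fun t => c (- t)) 0 N) with (RInt c 0 N); [ring|].
      apply RInt_ext. intros t _. unfold c.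
      replace ((- t) ^ 3 / 3 + x * - t) with (- (t ^ 3 / 3 + x * t)) by field.
      now rewrite cos_neg.
    - transitivity (RInt s (- N) N).
      { apply RInt_ext. intros t _. rewrite airy_real_components. reflexivity. }
      rewrite <- (RInt_Chasles s (- N) 0 N) by apply Is. rewrite RInt_reflect by exact Cs.
      assert (Odd : RInt (fun t => s (- t)) 0 N = - RInt s 0 N).
      { apply (is_RInt_unique (V := R_CompleteNormedModule)).
        apply (is_RInt_ext (fun t => opp (s t))).
        - intros t _. unfold s. change (- - sin (t ^ 3 / 3 + x * t) =
            - sin ((- t) ^ 3 / 3 + x * - t)).
          replace ((- t) ^ 3 / 3 + x * - t) with (- (t ^ 3 / 3 + x * t)) by field.
          now rewrite sin_neg.
        - apply (is_RInt_opp (V := R_NormedModule)).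
          apply (RInt_correct (V := R_CompleteNormedModule)), Is. }
      rewrite Odd. change (- RInt s 0 N + RInt s 0 N = 0). ring. }
  assert (Im0 : Im L = 0).
  { apply Req_of_small. intros eps He. destruct (HR eps He) as [N0 H0].
    specialize (H0 N0 (Rle_refl _)). rewrite EN in H0.
    pose proof (im_le_Cmod (RtoC (2 * RInt c 0 N0) - L)%C) as Q. simpl in Q.
    unfold Im in *. replace (0 + - snd L) with (- snd L) in Q by ring.
    rewrite Rabs_Ropp in Q. lra. }
  assert (Gen : is_RInt_gen c (at_point 0) (Rbar_locally p_infty) (Re L / 2)).
  { intros P [eps HP]. pose proof (cond_pos eps) as He.
    destruct (HR (eps / 2)) as [N0 H0]; [lra|].
    exists (fun a => a = 0) (fun b => N0 < b); [reflexivity|now exists N0|].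
    intros a b -> Hb. exists (RInt c 0 b); split.
    - apply (RInt_correct (V := R_CompleteNormedModule)), Ic.
    - apply HP. specialize (H0 b ltac:(lra)). rewrite EN in H0.
      pose proof (re_le_Cmod (RtoC (2 * RInt c 0 b) - L)%C) as Q. simpl in Q.
      change (Rabs (RInt c 0 b - Re L / 2) < eps).
      replace (RInt c 0 b - Re L / 2) with ((2 * RInt c 0 b + - Re L) / 2) by field.
      unfold Rdiv; rewrite Rabs_mult, (Rabs_right (/ 2)) by lra. unfold Re in *. lra. }
  assert (EA : 2 * PI * Airy x = Re L).
  { change (Airy x) with (/ PI * RInt_gen c (at_point 0) (Rbar_locally p_infty)).
    rewrite (is_RInt_gen_unique _ _ Gen). field. apply PI_neq0. }
  rewrite EA. replace (RtoC (Re L)) with L; [exact HL|].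
  apply injective_projections; simpl; [reflexivity|exact Im0].
Qed.

Lemma Cexp_taylor (z : C) : Cmod (Cexp z - 1 - z)%C <= exp (Cmod z) * Cmod z ^ 2.
Proof.
  pose proof (cder_taylor Cexp Cexp Cexp 0 z (exp (Cmod z))) as T.
  rewrite Cexp_0 in T. replace (0 + z)%C with z in T by ring.
  replace (Cexp z - 1 - z)%C with (Cexp z - 1 - 1 * z)%C by ring.
  apply T; intros s Hs; try apply cder_Cexp.
  rewrite Cmod_Cexp. apply exp_le_compat.
  eapply Rle_trans; [apply Rle_abs|]. eapply Rle_trans; [apply re_le_Cmod|].
  replace (0 + RtoC s * z)%C with (RtoC s * z)%C by ring.
  rewrite Cmod_mult, Cmod_R, Rabs_right by lra. pose proof (Cmod_ge_0 z). nra.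
Qed.

Lemma clim_lin3 (f g k : R -> C) (a b : C) (L M P : C) :
  (forall x, ccont f x) -> (forall x, ccont g x) -> (forall x, ccont k x) ->
  clim f L -> clim g M -> clim k P ->
  clim (fun t => f t + (a * g t + b * k t))%C (L + (a * M + b * P))%C.
Proof.
  intros Cf Cg Ck Hf Hg Hk.
  apply clim_plus; [intros; ccont_tac|intros; ccont_tac|exact Hf|].
  apply clim_plus; [intros; ccont_tac|intros; ccont_tac|now apply clim_scal|now apply clim_scal].
Qed.

(** Passing from [x] to [x + d] multiplies the integrand by [exp z] with [z = - i d s], and [- i s]
    is also the factor between [airy_line n] and [airy_line (S n)]; so the remainder is the
    integrand times [exp z - 1 - z]. *)
Lemma airy_line_quad (n : nat) (h x : R) : 0 < h -> exists K, 0 <= K /\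
  forall d L Ld L1, Rabs d <= 1 ->
  clim (airy_line n h x) L -> clim (airy_line n h (x + d)) Ld -> clim (airy_line (S n) h x) L1 ->
  Cmod (Ld - L - RtoC d * L1)%C <= K * d ^ 2.
Proof.
  intros Hh. destruct (poly_gauss h h (n + 2)) as (B & HB & HP); [lra|lra|].
  set (E := exp (h ^ 3 / 3 - x * h) * exp h).
  assert (HE : 0 < E) by (apply Rmult_lt_0_compat; apply exp_pos).
  exists (E * B * PI). pose proof PI_RGT_0 as HPI.
  split; [apply Rmult_le_pos; [apply Rmult_le_pos|]; lra|].
  intros d L Ld L1 Hd HL HLd HL1.
  pose proof (clim_lin3 _ _ _ (RtoC (-1)) (RtoC (- d)) _ _ _
    (fun t => airy_line_ccont n h (x + d) t) (fun t => airy_line_ccont n h x t)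
    (fun t => airy_line_ccont (S n) h x t) HLd HL HL1) as Hs.
  replace (Ld - L - RtoC d * L1)%C with (Ld + (RtoC (-1) * L + RtoC (- d) * L1))%C
    by (apply injective_projections; simpl; ring).
  apply (clim_bound _ _ _ Hs). intros N HN.
  replace (E * B * PI * d ^ 2) with (E * B * d ^ 2 * PI / sqrt 1) by (rewrite sqrt_1; field).
  apply CInt_lorentz; [lra|exact HN| |].
  - intros t. apply ccont_plus; [apply airy_line_ccont|].
    apply ccont_plus; apply ccont_mult; try apply ccont_const; apply airy_line_ccont.
  - intros t. rewrite Rmult_1_l.
    set (s := lineb h t). set (z := (- Ci * RtoC d * s)%C).
    replace (airy_line n h (x + d) t + (RtoC (-1) * airy_line n h x t
        + RtoC (- d) * airy_line (S n) h x t))%C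
      with (airy_line n h x t * (Cexp z - 1 - z))%C.
    2: { unfold airy_line. fold s.
         assert (Ep : airy_phase (x + d) s = (airy_phase x s * Cexp z)%C).
         { unfold airy_phase. rewrite <- Cexp_plus. f_equal. rewrite RtoC_plus. unfold z. ring. }
         rewrite Ep, RtoC_opp. simpl.
         replace (RtoC (-1)) with (- (1))%C by (apply injective_projections; simpl; ring).
         unfold z. ring. }
    pose proof (lineb_bound_abs h t ltac:(lra)) as Hw. fold s in Hw.
    pose proof (Rabs_pos t) as Ht. pose proof (Cmod_ge_0 s) as Hs0.
    set (q := 1 + h + Rabs t) in *.
    assert (Hz : Cmod z = Rabs d * Cmod s).
    { unfold z. rewrite !Cmod_mult, Cmod_opp, Cmod_Ci, Cmod_R. ring. }
    pose proof (Rabs_pos d) as Hd0.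
    assert (Hq : 1 <= q) by (unfold q; lra).
    assert (H1 : Cmod (Cexp z - 1 - z)%C <= exp h * exp (Rabs t) * (d ^ 2 * q ^ 2)).
    { eapply Rle_trans; [apply Cexp_taylor|]. rewrite Hz.
      apply Rmult_le_compat; [apply Rlt_le, exp_pos|apply pow2_ge_0| |].
      - rewrite <- exp_plus. apply exp_le_compat. nra.
      - rewrite Rpow_mult_distr.
        replace (Rabs d ^ 2) with (d ^ 2) by (rewrite <- (Rsqr_pow2 (Rabs d)), <- Rsqr_abs, Rsqr_pow2; reflexivity).
        apply Rmult_le_compat_l; [apply pow2_ge_0|]. apply pow_incr. unfold q; lra. }
    assert (H2 : Cmod (airy_line n h x t) <= q ^ n * (exp (h ^ 3 / 3 - x * h) * exp (- (h * t ^ 2)))).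
    { unfold airy_line. fold s. rewrite Cmod_mult, Cmod_pow. unfold s at 2.
      rewrite Cmod_airy_phase_line. apply Rmult_le_compat_r.
      - apply Rmult_le_pos; apply Rlt_le, exp_pos.
      - rewrite Cmod_mult, Cmod_opp, Cmod_Ci, Rmult_1_l. apply pow_incr. unfold q; lra. }
    eapply Rle_trans; [apply Cmod_le_mult; [exact H2|exact H1]|].
    replace (q ^ n * (exp (h ^ 3 / 3 - x * h) * exp (- (h * t ^ 2))) *
        (exp h * exp (Rabs t) * (d ^ 2 * q ^ 2)))
      with (E * d ^ 2 * (q ^ (n + 2) * exp (Rabs t) * exp (- (h * t ^ 2))))
      by (unfold E; rewrite pow_add; ring).
    replace (E * B * d ^ 2 / (1 + t ^ 2)) with (E * d ^ 2 * (B / (1 + t ^ 2))) by (unfold Rdiv; ring).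
    apply Rmult_le_compat_l; [apply Rmult_le_pos; [lra|apply pow2_ge_0]|apply HP].
Qed.

Lemma is_derive_quad (f : R -> R) (x l K : R) : 0 <= K ->
  (forall d, Rabs d <= 1 -> Rabs (f (x + d) - f x - d * l) <= K * d ^ 2) -> is_derive f x l.
Proof.
  intros HK H. apply is_derive_Reals. intros eps He.
  assert (Hd : 0 < Rmin 1 (eps / (K + 1))).
  { apply Rmin_glb_lt; [lra|]. apply Rdiv_lt_0_compat; lra. }
  exists (mkposreal _ Hd). intros d Hd0 Hlt. simpl in Hlt.
  pose proof (Rmin_l 1 (eps / (K + 1))). pose proof (Rmin_r 1 (eps / (K + 1))).
  specialize (H d ltac:(lra)).
  replace ((f (x + d) - f x) / d - l) with ((f (x + d) - f x - d * l) / d) by (field; exact Hd0).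
  pose proof (Rabs_pos_lt d Hd0).
  unfold Rdiv. rewrite Rabs_mult, Rabs_inv.
  apply (Rlt_div_l _ _ (Rabs d)); [lra|].
  eapply Rle_lt_trans; [exact H|].
  replace (d ^ 2) with (Rabs d ^ 2) by (rewrite <- (Rsqr_pow2 (Rabs d)), <- Rsqr_abs, Rsqr_pow2; reflexivity).
  assert (K * Rabs d < eps).
  { apply Rle_lt_trans with ((K + 1) * Rabs d); [nra|].
    apply Rlt_le_trans with ((K + 1) * (eps / (K + 1))); [apply Rmult_lt_compat_l; lra|].
    apply Req_le; field; lra. }
  nra.
Qed.

Lemma airy_line_derive (n : nat) (f : R -> R) :
  (forall h x, 0 < h -> clim (airy_line n h x) (RtoC (2 * PI * f x))) ->
  forall x, is_derive f x (Derive f x) /\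
    forall h, 0 < h -> clim (airy_line (S n) h x) (RtoC (2 * PI * Derive f x)).
Proof.
  intros Hf.
  assert (Main : forall h x : R, 0 < h -> exists l, is_derive f x l /\
     clim (airy_line (S n) h x) (RtoC (2 * PI * l))).
  { intros h x Hh. destruct (airy_line_clim (S n) h x Hh) as [L1 HL1].
    destruct (airy_line_quad n h x Hh) as (K & HK & HQ).
    pose proof PI_RGT_0 as HPI.
    assert (Q : forall d, Rabs d <= 1 ->
      Cmod (RtoC (2 * PI * f (x + d)%R) - RtoC (2 * PI * f x) - RtoC d * L1)%C <= K * d ^ 2).
    { intros d Hd. apply HQ; auto. }
    exists (Re L1 / (2 * PI)). split.
    - apply (is_derive_quad f x _ (K / (2 * PI))).
      { apply Rdiv_le_0_compat; lra. }
      intros d Hd. specialize (Q d Hd).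
      eapply Rle_trans in Q; [|apply re_le_Cmod].
      replace (f (x + d) - f x - d * (Re L1 / (2 * PI)))
        with (/ (2 * PI) * Re (RtoC (2 * PI * f (x + d)%R) - RtoC (2 * PI * f x) - RtoC d * L1)%C)
        by (simpl; unfold Re, Im; field; lra).
      rewrite Rabs_mult, Rabs_right by (apply Rle_ge, Rlt_le, Rinv_0_lt_compat; lra).
      replace (K / (2 * PI) * d ^ 2) with (/ (2 * PI) * (K * d ^ 2)) by (field; lra).
      apply Rmult_le_compat_l; [apply Rlt_le, Rinv_0_lt_compat; lra|exact Q].
    - replace (RtoC (2 * PI * (Re L1 / (2 * PI)))) with L1; [exact HL1|].
      apply injective_projections; simpl; [unfold Re; field; lra|].
      (* [L1] is a limit of real difference quotients, so its imaginary part is at most [K d] for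
         every small [d]. *)
      change (Im L1 = 0). apply Req_of_small. intros eps He.
      set (d := Rmin 1 (eps / (K + 1))).
      assert (Hd : 0 < d) by (apply Rmin_glb_lt; [lra|apply Rdiv_lt_0_compat; lra]).
      assert (Hd1 : d <= 1) by apply Rmin_l. assert (Hd2 : d <= eps / (K + 1)) by apply Rmin_r.
      specialize (Q d ltac:(rewrite Rabs_right; lra)).
      eapply Rle_trans in Q; [|apply im_le_Cmod].
      replace (Im _) with (- (d * Im L1)) in Q by (simpl; unfold Re, Im; ring).
      rewrite Rabs_Ropp, Rabs_mult, (Rabs_right d) in Q by lra.
      assert (E1 : d * (K + 1) <= eps) by (apply (Rle_div_r _ _ (K + 1)); lra).
      assert (Rabs (Im L1) <= K * d); [|nra].
      apply Rmult_le_reg_l with d; [exact Hd|]. lra. }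
  intros x. split.
  - destruct (Main 1 x Rlt_0_1) as (l & Hl & _). rewrite (is_derive_unique _ _ _ Hl). exact Hl.
  - intros h Hh. destruct (Main h x Hh) as (l & Hl & Hc). rewrite (is_derive_unique _ _ _ Hl). exact Hc.
Qed.

Lemma Airy_derive (x : R) : is_derive Airy x (Airy' x).
Proof. apply (airy_line_derive 0 Airy). intros; now apply airy_rep. Qed.

Lemma airy'_rep (h x : R) : 0 < h -> clim (airy_line 1 h x) (RtoC (2 * PI * Airy' x)).
Proof.
  intros Hh. apply (airy_line_derive 0 Airy); [|exact Hh]. intros; now apply airy_rep.
Qed.

(** [((- i s)^2 - x)] times the phase is the derivative of [- i] times the phase along the line, so
    the integrals of [airy_line 2] and of [x] times [airy_line 0] differ only by end-point terms. *)
Lemma Airy'_derive (x : R) : is_derive Airy' x (x * Airy x).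
Proof.
  destruct (airy_line_derive 1 Airy') with (x := x) as [D H2].
  { intros; now apply airy'_rep. }
  specialize (H2 1 Rlt_0_1).
  assert (E : RtoC (2 * PI * Derive Airy' x) = (RtoC x * RtoC (2 * PI * Airy x))%C).
  { apply (clim_unique (airy_line 2 1 x)); [exact H2|].
    pose proof (clim_scal _ (RtoC x) _ (fun t => airy_line_ccont 0 1 x t) (airy_rep 1 x Rlt_0_1)) as H0.
    set (E0 := exp (1 ^ 3 / 3 - x * 1)). assert (HE : 0 < E0) by apply exp_pos.
    apply (clim_close _ _ _ (2 * E0) 1 ltac:(lra)) with (2 := H0).
    intros N HN.
    assert (C2 : forall t, ccont (airy_line 2 1 x) t) by (intros; apply airy_line_ccont).
    assert (C0 : forall t, ccont (airy_line 0 1 x) t) by (intros; apply airy_line_ccont).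
    replace (CInt (airy_line 2 1 x) (- N) N - CInt (fun t => RtoC x * airy_line 0 1 x t)%C (- N) N)%C
      with (CInt (fun t => airy_line 2 1 x t + RtoC (-1) * (RtoC x * airy_line 0 1 x t))%C (- N) N).
    2: { rewrite CInt_plus; [|lra|intros; ccont_tac|intros; ccont_tac].
         rewrite CInt_scal; [|lra|intros; ccont_tac].
         replace (RtoC (-1)) with (- (1))%C by (apply injective_projections; simpl; ring). ring. }
    rewrite (CInt_FTC _ (fun t => - Ci * airy_phase x (lineb 1 t))%C); [|lra|intros; ccont_tac|].
    - assert (Bd : forall t, t ^ 2 = N ^ 2 -> Cmod (- Ci * airy_phase x (lineb 1 t))%C <= E0 / N).
      { intros t Ht. rewrite Cmod_mult, Cmod_opp, Cmod_Ci, Rmult_1_l, Cmod_airy_phase_line, Ht.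
        apply Rmult_le_compat_l; [lra|]. rewrite Rmult_1_l, exp_Ropp.
        apply Rinv_le_contravar; [lra|]. pose proof (exp_ineq1_le (N ^ 2)). nra. }
      replace (2 * E0 / N) with (E0 / N + E0 / N) by (field; lra).
      apply Cmod_le_minus; apply Bd; ring.
    - intros t _. eapply rder_eq.
      + apply rder_mult; [apply rder_const|].
        apply (rder_cder (airy_phase x) (lineb 1)); [apply cder_airy_phase|apply rder_lineb].
      + cbv beta. unfold airy_line. simpl.
        replace (RtoC (-1)) with (- (1))%C by (apply injective_projections; simpl; ring).
        assert (I2 : (Ci * Ci = - (1))%C) by (apply injective_projections; simpl; ring).
        set (s := lineb 1 t). set (p := airy_phase x s).
        transitivity ((Ci * Ci) * (s * s) * p + (Ci * Ci) * RtoC x * p)%C; [ring|].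
        transitivity ((Ci * Ci) * (s * s) * p + - (1) * RtoC x * p)%C; [rewrite I2; ring|ring]. }
  pose proof PI_RGT_0.
  apply (f_equal fst) in E. simpl in E.
  assert (E2 : Derive Airy' x = x * Airy x).
  { apply Rmult_eq_reg_l with (2 * PI); lra. }
  rewrite <- E2. exact D.
Qed.

(** * Boundedness and monotonicity of [Airy] on the half line *)

Lemma Airy_bounded : exists B, forall x, 0 <= x -> Rabs (Airy x) <= B.
Proof.
  pose proof PI_RGT_0 as HPI.
  exists (exp (1 / 3)). intros x Hx.
  assert (H : Cmod (RtoC (2 * PI * Airy x)) <= exp (1 / 3) * PI / sqrt 1).
  { apply (clim_bound _ _ _ (airy_rep 1 x Rlt_0_1)). intros N HN.
    apply CInt_lorentz; [lra|exact HN|intros; apply airy_line_ccont|].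
    intros t. unfold airy_line. simpl. rewrite Cmult_1_l, Cmod_airy_phase_line.
    apply Rmult_le_compat; try apply Rlt_le, exp_pos.
    - apply exp_le_compat. lra.
    - rewrite exp_Ropp. apply Rinv_le_contravar; [nra|].
      eapply Rle_trans; [|apply exp_ineq1_le]. nra. }
  rewrite sqrt_1, Cmod_R, Rabs_mult, Rabs_right in H by lra.
  pose proof (Rabs_pos (Airy x)). nra.
Qed.

(* [Airy * Airy'] is nondecreasing on the half line since [Airy'' = x Airy]; were it
   positive somewhere, [Airy ^ 2] would grow at least linearly. *)
Lemma Airy_sqr_decreasing (x z : R) : 0 <= x <= z -> Airy z ^ 2 <= Airy x ^ 2.
Proof.
  intros Hx.
  assert (D1 : forall t, is_derive (fun t => Airy t * Airy' t) t (Airy' t ^ 2 + t * Airy t ^ 2)).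
  { intros t. evar_last.
    - apply (is_derive_mult Airy Airy' t _ _ (Airy_derive t) (Airy'_derive t) Rmult_comm).
    - unfold plus, mult; simpl. match goal with |- @eq _ ?a ?b => change (@eq R a b) end. ring. }
  assert (D2 : forall t, is_derive (fun t => Airy t ^ 2) t (2 * (Airy t * Airy' t))).
  { intros t. evar_last.
    - apply (is_derive_pow Airy 2), Airy_derive.
    - simpl. ring. }
  assert (Mono : forall (f f' : R -> R) (a b m : R), a <= b -> (forall t, is_derive f t (f' t)) ->
    (forall t, a <= t <= b -> m <= f' t) -> m * (b - a) <= f b - f a).
  { intros f f' a b m Hab Hd Hm.
    destruct (MVT_gen f a b f') as [c [Hc E]].
    - intros; apply Hd.
    - intros t _. apply continuity_pt_filterlim, @ex_derive_continuous. eexists; apply Hd.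
    - rewrite Rmin_left, Rmax_right in Hc by lra. rewrite E.
      apply Rmult_le_compat_r; [lra|]. now apply Hm. }
  assert (Neg : forall t, 0 <= t -> Airy t * Airy' t <= 0).
  { intros t Ht. apply Rnot_lt_le. intros Hp.
    destruct Airy_bounded as [B HB].
    set (e := Airy t * Airy' t) in *.
    assert (G : forall s, t <= s -> e <= Airy s * Airy' s).
    { intros s Hs. pose proof (Mono _ _ t s 0 Hs D1) as M.
      assert (0 * (s - t) <= Airy s * Airy' s - Airy t * Airy' t).
      { apply M. intros q Hq. pose proof (pow2_ge_0 (Airy' q)). pose proof (pow2_ge_0 (Airy q)). nra. }
      unfold e. lra. }
    (* Growth of [Airy^2] at rate at least [2 e] would bring it to [B^2 + 1] here. *)
    set (s := t + (B ^ 2 + 1) / (2 * e)).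
    assert (Hs : 0 < (B ^ 2 + 1) / (2 * e)).
    { apply Rdiv_lt_0_compat; [pose proof (pow2_ge_0 B); lra|lra]. }
    pose proof (Mono _ _ t s (2 * e) ltac:(unfold s; lra) D2) as M.
    assert (Q : 2 * e * (s - t) <= Airy s ^ 2 - Airy t ^ 2).
    { apply M. intros q Hq. specialize (G q ltac:(lra)). lra. }
    replace (2 * e * (s - t)) with (B ^ 2 + 1) in Q by (unfold s; field; lra).
    specialize (HB s ltac:(unfold s; lra)).
    assert (Airy s ^ 2 <= B ^ 2).
    { rewrite <- (Rsqr_pow2 (Airy s)), Rsqr_abs, Rsqr_pow2. apply pow_incr.
      split; [apply Rabs_pos|exact HB]. }
    pose proof (pow2_ge_0 (Airy t)). lra. }
  pose proof (Mono (fun t => - Airy t ^ 2) (fun t => - (2 * (Airy t * Airy' t))) x z 0 ltac:(lra)) as M.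
  assert (0 * (z - x) <= - Airy z ^ 2 - - Airy x ^ 2); [|lra].
  apply M.
  - intros t. apply (is_derive_opp (fun t => Airy t ^ 2)), D2.
  - intros t Ht. specialize (Neg t ltac:(lra)). lra.
Qed.

(** * Rescaling the cubic integrals to Airy integrals *)

Lemma CInt_scale (f : R -> C) (c a b : R) : 0 < c -> a <= b -> (forall x, ccont f x) ->
  CInt (fun t => f (c * t)) a b = (/ RtoC c * CInt f (c * a) (c * b))%C.
Proof.
  intros Hc Hab Hf.
  assert (nc : RtoC c <> 0) by (apply RtoC_neq_0; lra).
  assert (Hg : forall x, ccont (fun t => f (c * t)) x).
  { intros x. destruct (Hf (c * x)) as [H1 H2].
    assert (Hl : continuous (fun t : R => c * t) x).
    { apply @ex_derive_continuous. auto_derive. exact I. }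
    split; [apply (continuous_comp (fun t => c * t) (fun t => Re (f t)))
           |apply (continuous_comp (fun t => c * t) (fun t => Im (f t)))]; assumption. }
  apply (Cmult_cancel_l (RtoC c)); [exact nc|].
  rewrite Cmult_assoc, Cinv_r, Cmult_1_l by exact nc.
  rewrite <- CInt_scal by auto.
  assert (Hcab : c * a <= c * b) by (apply Rmult_le_compat_l; lra).
  unfold CInt. apply injective_projections; cbn [fst snd].
  - pose proof (RInt_comp_lin (fun t => Re (f t)) c 0 a b) as E.
    rewrite !Rplus_0_r in E. rewrite <- E by (apply ccont_ex_RInt_re; auto).
    apply RInt_ext. intros t _. rewrite Rplus_0_r. simpl. unfold scal, Re, Im; simpl. unfold mult; simpl. ring.
  - pose proof (RInt_comp_lin (fun t => Im (f t)) c 0 a b) as E.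
    rewrite !Rplus_0_r in E. rewrite <- E by (apply ccont_ex_RInt_im; auto).
    apply RInt_ext. intros t _. rewrite Rplus_0_r. simpl. unfold scal, Re, Im; simpl. unfold mult; simpl. ring.
Qed.

Lemma clim_scale (f : R -> C) (c : R) (L : C) : 0 < c -> (forall x, ccont f x) ->
  clim f L -> clim (fun t => f (c * t)) (/ RtoC c * L)%C.
Proof.
  intros Hc Hf H eps He.
  assert (nc : RtoC c <> 0) by (apply RtoC_neq_0; lra).
  destruct (H (c * eps)) as [N0 HN]; [nra|].
  exists (Rmax (N0 / c) 0). intros N HNN.
  pose proof (Rmax_l (N0 / c) 0). pose proof (Rmax_r (N0 / c) 0).
  rewrite CInt_scale by (auto; lra).
  replace (c * - N) with (- (c * N)) by ring.
  specialize (HN (c * N)).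
  replace (_ - _)%C with (/ RtoC c * (CInt f (- (c * N)) (c * N) - L))%C by ring.
  rewrite Cmod_mult, Cmod_inv, Cmod_R, Rabs_right by (lra || exact nc).
  apply Rmult_le_reg_l with c; [exact Hc|].
  rewrite <- Rmult_assoc, Rinv_r, Rmult_1_l by lra. apply HN.
  apply Rle_trans with (c * (N0 / c)); [apply Req_le; field; lra|apply Rmult_le_compat_l; lra].
Qed.

(** The substitution [z = c w] turns [3 xi (w^3 / 6 + w / 2)] into [z^3 / 3 + c^2 z] when
    [c^3 = 3 xi / 2]; hence the argument [c^2] of the Airy function. *)
Lemma kcub_airy (xi b c t : R) : c ^ 3 = 3 * xi / 2 ->
  kcub xi (lineb b t) = airy_phase (c ^ 2) (lineb (c * b) (c * t)).
Proof.
  intros Hc. unfold kcub, airy_phase. f_equal.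
  replace (RtoC (3 * xi)) with (2 * (RtoC c * RtoC c * RtoC c))%C
    by (apply injective_projections; simpl; nra).
  replace (lineb (c * b) (c * t)) with (RtoC c * lineb b t)%C
    by (unfold lineb; rewrite !RtoC_mult; ring).
  replace (RtoC (c ^ 2)) with (RtoC c * RtoC c)%C by (apply injective_projections; simpl; ring).
  field.
Qed.

Lemma cubic_value_0 (xi b c : R) : 0 < c -> 0 < b -> c ^ 3 = 3 * xi / 2 ->
  clim (integrand0 false xi b) (RtoC (2 * PI * Airy (c ^ 2) / c)).
Proof.
  intros Hc Hb Hx.
  pose proof (clim_scale _ c _ Hc (fun t => airy_line_ccont 0 (c * b) (c ^ 2) t)
    (airy_rep (c * b) (c ^ 2) ltac:(nra))) as H.
  replace (RtoC (2 * PI * Airy (c ^ 2) / c)) with (/ RtoC c * RtoC (2 * PI * Airy (c ^ 2)))%C.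
  - revert H. apply clim_ext. intros t. unfold integrand0, airy_line.
    rewrite (kcub_airy xi b c t Hx). simpl. ring.
  - apply injective_projections; simpl; field; nra.
Qed.

Lemma cubic_value_1 (xi b c : R) : 0 < c -> 0 < b -> c ^ 3 = 3 * xi / 2 ->
  clim (integrand0 true xi b) (Ci * RtoC (2 * PI * Airy' (c ^ 2) / c ^ 2))%C.
Proof.
  intros Hc Hb Hx.
  assert (nc : RtoC c <> 0) by (apply RtoC_neq_0; lra).
  pose proof (clim_scale _ c _ Hc (fun t => airy_line_ccont 1 (c * b) (c ^ 2) t)
    (airy'_rep (c * b) (c ^ 2) ltac:(nra))) as H.
  assert (Cg : forall x, ccont (fun t => airy_line 1 (c * b) (c ^ 2) (c * t)) x).
  { intros x. apply ccont_mult.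
    - destruct (cder_pow_lin 1 (lineb (c * b) (c * x))) as [l Hl].
      eapply rder_ccont, (rder_cder (fun z => (- Ci * z) ^ 1)%C (fun x => lineb (c * b) (c * x))); [exact Hl|].
      apply rder_minus; [|apply rder_const]. apply (rder_RtoC (fun x => c * x) x c).
      auto_derive; [exact I|ring].
    - eapply rder_ccont, (rder_cder (airy_phase (c ^ 2)) (fun x => lineb (c * b) (c * x)));
        [apply cder_airy_phase|].
      apply rder_minus; [|apply rder_const]. apply (rder_RtoC (fun x => c * x) x c).
      auto_derive; [exact I|ring]. }
  apply (clim_scal _ (Ci * / RtoC c)%C) in H; [|exact Cg].
  replace (Ci * RtoC (2 * PI * Airy' (c ^ 2) / c ^ 2))%C
    with (Ci * / RtoC c * (/ RtoC c * RtoC (2 * PI * Airy' (c ^ 2))))%C.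
  - revert H. apply clim_ext. intros t. unfold integrand0, airy_line.
    rewrite (kcub_airy xi b c t Hx).
    replace (lineb (c * b) (c * t)) with (RtoC c * lineb b t)%C
      by (unfold lineb; rewrite !RtoC_mult; ring).
    assert (I2 : (Ci * Ci = - (1))%C) by (apply injective_projections; simpl; ring).
    set (p := airy_phase _ _). set (w := lineb b t). simpl.
    transitivity (- (Ci * Ci) * (p * w))%C; [field; exact nc|rewrite I2; ring].
  - apply injective_projections; simpl; field; repeat split; nra.
Qed.

(** * A lower bound for the Airy function *)

Lemma exp_ge_quartic (z : R) : 0 <= z -> z ^ 3 * (1 + z) <= 256 * exp z.
Proof.
  intros Hz. pose proof (exp_ineq1_le (z / 4)) as H.
  assert (E : exp z = exp (z / 4) ^ 4).
  { simpl. rewrite Rmult_1_r, <- !exp_plus. f_equal. field. }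
  assert (Q : (1 + z / 4) ^ 4 <= exp (z / 4) ^ 4) by (apply pow_incr; lra).
  rewrite E. assert (0 <= z ^ 2) by nra. assert (0 <= z ^ 3) by (apply pow_le; lra). nra.
Qed.

(** On the line through the saddle point the real part is [exp (- xi - z) cos (a t^3 / 3)] with
    [z = a t^2]. Replacing the cosine by [1] loses at most [exp (- z) z^3 / (18 a)], which
    [exp_ge_quartic] turns into an integrable profile smaller by a factor [1 / a]. *)
Lemma integrand0_re_ge (xi a t : R) : 0 < xi -> a = 3 * xi / 2 ->
  exp (- xi) * (exp (- (a * t ^ 2)) - 128 / (9 * a) / (1 + a * t ^ 2))
    <= Re (integrand0 false xi 1 t).
Proof.
  intros Hxi Ha.
  assert (E : Re (integrand0 false xi 1 t) = exp (- xi) * (exp (- (a * t ^ 2)) * cos (a * t ^ 3 / 3))).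
  { unfold integrand0. simpl amp. rewrite Cmult_1_r. unfold kcub, Cexp. cbn [fst Re].
    rewrite <- Rmult_assoc, <- exp_plus. f_equal.
    - f_equal. unfold lineb; simpl; unfold Re, Im; simpl. rewrite Ha. field.
    - rewrite <- cos_neg. f_equal. unfold lineb; simpl; unfold Re, Im; simpl. rewrite Ha. field. }
  rewrite E. apply Rmult_le_compat_l; [apply Rlt_le, exp_pos|].
  set (z := a * t ^ 2).
  assert (Hz : 0 <= z) by (unfold z; apply Rmult_le_pos; [lra|apply pow2_ge_0]).
  assert (C1 : 1 - (a * t ^ 3 / 3) ^ 2 / 2 <= cos (a * t ^ 3 / 3)).
  { destruct (Rle_dec 0 (a * t ^ 3 / 3)); [now apply cos_ge_quad|].
    rewrite <- cos_neg. replace ((a * t ^ 3 / 3) ^ 2) with ((- (a * t ^ 3 / 3)) ^ 2) by ring.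
    apply cos_ge_quad; lra. }
  assert (C2 : (a * t ^ 3 / 3) ^ 2 / 2 = z ^ 3 / (18 * a)) by (unfold z; field; lra).
  pose proof (exp_pos (- z)) as He.
  assert (C3 : exp (- z) * (z ^ 3 / (18 * a)) <= 128 / (9 * a) / (1 + z)).
  { apply (Rle_div_r _ _ (1 + z)); [lra|].
    pose proof (exp_ge_quartic z Hz) as Q.
    assert (Q2 : exp (- z) * (z ^ 3 * (1 + z)) <= 256).
    { apply (Rmult_le_compat_l (exp (- z))) in Q; [|lra].
      replace (exp (- z) * (256 * exp z)) with 256 in Q; [exact Q|].
      rewrite exp_Ropp. field. apply Rgt_not_eq, exp_pos. }
    apply Rle_trans with (/ (18 * a) * (exp (- z) * (z ^ 3 * (1 + z)))).
    - apply Req_le; field; lra.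
    - apply Rle_trans with (/ (18 * a) * 256).
      + apply Rmult_le_compat_l; [apply Rlt_le, Rinv_0_lt_compat; lra|exact Q2].
      + apply Req_le; field; lra. }
  nra.
Qed.

(** With [q = a^(-1/2)] the Gaussian contributes at least [2 q / 3], from [[- q, q]] alone and
    [exp (- 1) >= 1 / 3]. The loss is at most [128 PI q / (9 a)], below [2 q / 5] once
    [a = c^3 >= 216]; the difference exceeds [q / 5]. *)
Lemma Airy_large (c : R) : 6 <= c ->
  exp (- (2 / 3 * c ^ 3)) / sqrt c / (20 * PI) <= Airy (c ^ 2).
Proof.
  intros Hc. set (a := c ^ 3). set (xi := 2 / 3 * a).
  assert (Ha : 216 <= a) by (unfold a; nra).
  assert (Hxi : 0 < xi) by (unfold xi; lra).
  pose proof (cubic_value_0 xi 1 c ltac:(lra) Rlt_0_1 ltac:(unfold xi, a; field)) as HL.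
  pose proof PI_RGT_0 as HPI. pose proof PI_4 as HPI4.
  assert (Hsa : 0 < sqrt a) by (apply sqrt_lt_R0; lra).
  assert (Hss : sqrt a * sqrt a = a) by (apply sqrt_sqrt; lra).
  set (q := / sqrt a).
  assert (Hq : 0 < q) by (apply Rinv_0_lt_compat, Hsa).
  assert (Hqa : a * q ^ 2 = 1) by (unfold q; rewrite <- Hss at 1; field; lra).
  pose proof (exp_pos (- xi)) as He.
  assert (Low : exp (- xi) * (q / 5) <= 2 * PI * Airy (c ^ 2) / c).
  { apply le_epsilon. intros eps Heps.
    destruct (HL eps Heps) as [N0 HN].
    set (N := Rmax (Rmax N0 q) 1).
    assert (N1 : N0 <= N) by (eapply Rle_trans; [apply Rmax_l|apply Rmax_l]).
    assert (N2 : q <= N) by (eapply Rle_trans; [apply Rmax_r|apply Rmax_l]).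
    assert (N3 : 1 <= N) by apply Rmax_r.
    specialize (HN N N1). eapply Rle_trans in HN; [|apply re_le_Cmod].
    change (Re (CInt (integrand0 false xi 1) (- N) N - RtoC (2 * PI * Airy (c ^ 2) / c))%C)
      with (RInt (fun t => Re (integrand0 false xi 1 t)) (- N) N - 2 * PI * Airy (c ^ 2) / c) in HN.
    apply Rabs_le_between in HN.
    assert (HI : exp (- xi) * (q / 5) <= RInt (fun t => Re (integrand0 false xi 1 t)) (- N) N); [|lra].
    set (g := fun t => exp (- (a * t ^ 2))).
    assert (Cg : forall t, continuous g t).
    { intros t. apply @ex_derive_continuous. unfold g. auto_derive. exact I. }
    assert (Ig : forall u v, ex_RInt g u v).
    { intros; apply (ex_RInt_continuous (V := R_CompleteNormedModule)); intros; apply Cg. }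
    assert (G1 : 2 * q / 3 <= RInt g (- N) N).
    { rewrite <- (RInt_Chasles g (- N) (- q) N), <- (RInt_Chasles g (- q) q N) by apply Ig.
      assert (P1 : 0 <= RInt g (- N) (- q)).
      { apply RInt_ge_0; [lra|apply Ig|]. intros; apply Rlt_le, exp_pos. }
      assert (P2 : 0 <= RInt g q N).
      { apply RInt_ge_0; [lra|apply Ig|]. intros; apply Rlt_le, exp_pos. }
      assert (P3 : 2 * q / 3 <= RInt g (- q) q).
      { assert (Ec : RInt (fun _ => / 3) (- q) q = 2 * q / 3).
        { rewrite RInt_const. unfold scal; simpl; unfold mult; simpl. field. }
        rewrite <- Ec. apply RInt_le; [lra|apply ex_RInt_const|apply Ig|].
        intros t Ht. unfold g. apply Rle_trans with (exp (- (1))).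
        - rewrite exp_Ropp. apply Rinv_le_contravar; [apply exp_pos|apply exp_le_3].
        - apply exp_le_compat. assert (t ^ 2 <= q ^ 2) by nra.
          assert (a * t ^ 2 <= a * q ^ 2) by (apply Rmult_le_compat_l; lra). lra. }
      unfold plus; simpl. lra. }
    destruct (is_RInt_lorentz a (128 / (9 * a)) N) as (l & Hl & Hl2);
      [lra|apply Rdiv_le_0_compat; lra|lra|].
    assert (Hl3 : l <= 2 * q / 5).
    { eapply Rle_trans; [exact Hl2|].
      replace (128 / (9 * a) * PI / sqrt a) with (q * (128 * PI / (9 * a))) by (unfold q; field; lra).
      replace (2 * q / 5) with (q * (2 / 5)) by field.
      apply Rmult_le_compat_l; [lra|]. apply (Rle_div_l _ _ (9 * a)); [lra|]. lra. }
    apply Rle_trans with (exp (- xi) * (RInt g (- N) N - l)).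
    - apply Rmult_le_compat_l; [lra|]. lra.
    - assert (Hint : is_RInt (fun t => scal (exp (- xi)) (minus (g t) (128 / (9 * a) / (1 + a * t ^ 2))))
                (- N) N (scal (exp (- xi)) (minus (RInt g (- N) N) l))).
      { apply (is_RInt_scal (V := R_NormedModule)), (is_RInt_minus (V := R_NormedModule)); [|exact Hl].
        apply (RInt_correct (V := R_CompleteNormedModule)), Ig. }
      eapply (is_RInt_le _ _ (- N) N _ _ ltac:(lra) Hint).
      + apply (RInt_correct (V := R_CompleteNormedModule)). apply ccont_ex_RInt_re; [lra|].
        intros; apply integrand0_ccont.
      + intros t _. apply integrand0_re_ge; [lra|unfold xi; lra]. }
  assert (Hsc : 0 < sqrt c) by (apply sqrt_lt_R0; lra).
  assert (Ecq : c * q = / sqrt c).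
  { unfold q, a. replace (c ^ 3) with (c ^ 2 * c) by ring.
    rewrite sqrt_mult, sqrt_pow2 by nra. field. lra. }
  unfold Rdiv. rewrite <- Ecq.
  apply (Rmult_le_compat_r c) in Low; [|lra].
  replace (2 * PI * Airy (c ^ 2) / c * c) with (2 * PI * Airy (c ^ 2)) in Low by (field; lra).
  apply Rmult_le_reg_l with (2 * PI); [lra|].
  fold a. fold xi.
  replace (2 * PI * (exp (- xi) * (c * q) * / (20 * PI))) with (exp (- xi) * (q / 5) * c / 2) by (field; lra).
  assert (0 < exp (- xi) * (q / 5) * c) by (repeat apply Rmult_lt_0_compat; lra). lra.
Qed.

(** For [c < 6] the monotonicity of [Airy^2] gives [|Airy (c^2)| >= Airy 36]. The variable [q]
    replaces [c] under the root so that the bound does not degenerate as [c] tends to [0]; it will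
    be [c b]. *)
Lemma Airy_lower : exists k, 0 < k /\ forall c q, 0 < c -> 1 <= q -> c <= q ->
  k * exp (- (2 / 3 * c ^ 3)) / sqrt q <= Rabs (Airy (c ^ 2)).
Proof.
  pose proof PI_RGT_0 as HPI.
  assert (H6 : 0 < Airy 36).
  { pose proof (Airy_large 6 ltac:(lra)) as H. replace (6 ^ 2) with 36 in H by ring.
    eapply Rlt_le_trans; [|exact H].
    repeat apply Rdiv_lt_0_compat; try apply exp_pos; try (apply sqrt_lt_R0; lra); lra. }
  set (k := Rmin (Airy 36) (/ (20 * PI))).
  assert (Hi : 0 < / (20 * PI)) by (apply Rinv_0_lt_compat; lra).
  assert (Hk : 0 < k) by now apply Rmin_glb_lt.
  exists k; split; [exact Hk|]. intros c q Hc Hq Hcq.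
  assert (Hsq : 1 <= sqrt q) by (rewrite <- sqrt_1; now apply sqrt_le_1_alt).
  pose proof (exp_pos (- (2 / 3 * c ^ 3))) as He.
  assert (Hc3 : 0 < c ^ 3) by now apply pow_lt.
  destruct (Rle_dec 6 c) as [H|H].
  - eapply Rle_trans; [|apply Rle_abs]. eapply Rle_trans; [|now apply Airy_large].
    assert (Hsc : 0 < sqrt c) by (apply sqrt_lt_R0; lra).
    replace (exp (- (2 / 3 * c ^ 3)) / sqrt c / (20 * PI))
      with (/ (20 * PI) * exp (- (2 / 3 * c ^ 3)) * / sqrt c) by (field; lra).
    unfold Rdiv. apply Rmult_le_compat.
    + apply Rmult_le_pos; lra.
    + apply Rlt_le, Rinv_0_lt_compat; lra.
    + apply Rmult_le_compat_r; [lra|apply Rmin_r].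
    + apply Rinv_le_contravar; [lra|now apply sqrt_le_1_alt].
  - apply Rle_trans with (Airy 36).
    + apply Rle_trans with k; [|apply Rmin_l].
      apply (Rle_div_l _ _ (sqrt q)); [lra|].
      assert (exp (- (2 / 3 * c ^ 3)) <= 1) by (rewrite <- exp_0; apply exp_le_compat; lra).
      nra.
    + apply Rsqr_incr_0_var; [|apply Rabs_pos].
      rewrite <- Rsqr_abs, !Rsqr_pow2. apply Airy_sqr_decreasing. nra.
Qed.

(** * The Bessel function *)

Lemma clim_bound_eps (f : R -> C) (L : C) (K : R) : clim f L ->
  (forall eps, 0 < eps -> exists N1, forall N, N1 <= N -> Cmod (CInt f (- N) N) <= K + eps) ->
  Cmod L <= K.
Proof.
  intros H HK. apply le_epsilon. intros eps He.
  destruct (H (eps / 2) ltac:(lra)) as [N0 h].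
  destruct (HK (eps / 2) ltac:(lra)) as [N1 h1].
  specialize (h (Rmax N0 N1) (Rmax_l _ _)). specialize (h1 (Rmax N0 N1) (Rmax_r _ _)).
  set (I := CInt f _ _) in *.
  replace L with (I - (I - L))%C by ring.
  replace (K + eps) with ((K + eps / 2) + eps / 2) by field. now apply Cmod_le_minus.
Qed.

Definition kernelK (y : R) (nu z : C) : C := Cexp (- (RtoC y * ccosh z) + nu * z)%C.

Lemma cder_kernelK (y : R) (nu z : C) :
  cder (kernelK y nu) z ((- (RtoC y * csinh z) + nu) * kernelK y nu z)%C.
Proof.
  eapply cder_eq.
  - apply (cder_comp Cexp (fun z => - (RtoC y * ccosh z) + nu * z)%C); [apply cder_Cexp|].
    apply cder_plus; [apply cder_opp, cder_scal, cder_ccosh|apply cder_scal, cder_id].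
  - fold (kernelK y nu z). ring.
Qed.

Lemma cder_kernelK' (y : R) (nu z : C) :
  exists l, cder (fun z => (- (RtoC y * csinh z) + nu) * kernelK y nu z)%C z l.
Proof.
  eexists. apply cder_mult; [|apply cder_kernelK].
  apply cder_plus; [apply cder_opp, cder_scal, cder_csinh|apply cder_const].
Qed.

Lemma kernelK_real (y : R) (nu : C) (s : R) :
  kernelK y nu (RtoC s) = Cexp (RtoC (- (y * cosh s)) + nu * RtoC s)%C.
Proof.
  unfold kernelK. f_equal. f_equal. unfold RtoC at 2. rewrite ccosh_components, cos_0, sin_0.
  apply injective_projections; simpl; ring.
Qed.

Lemma Cmod_kernelK (y r T a e : R) :
  Cmod (kernelK y (RtoC r + Ci * RtoC T) (RtoC a + Ci * RtoC e)%C) =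
  exp (- (y * cosh a * cos e) + r * a - T * e).
Proof.
  unfold kernelK. rewrite Cmod_Cexp. f_equal.
  replace (RtoC a + Ci * RtoC e)%C with (a, e) by (apply injective_projections; simpl; ring).
  rewrite ccosh_components. simpl; unfold Re, Im; simpl. ring.
Qed.

Lemma gauss_lorentz (A k x : R) : 0 < A ->
  exp (k * Rabs x - A * x ^ 2) <= exp ((k + 2) ^ 2 / (4 * A)) / (1 + x ^ 2).
Proof.
  intros HA. pose proof (Rabs_pos x) as Hx. assert (0 <= x ^ 2) by apply pow2_ge_0.
  apply (Rle_div_r _ _ (1 + x ^ 2)); [lra|].
  apply Rle_trans with (exp (k * Rabs x - A * x ^ 2) * exp (2 * Rabs x)).
  - apply Rmult_le_compat_l; [apply Rlt_le, exp_pos|].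
    replace (x ^ 2) with (Rabs x ^ 2) by (rewrite <- Rsqr_pow2, <- Rsqr_abs, Rsqr_pow2; reflexivity).
    replace (exp (2 * Rabs x)) with (exp (Rabs x) ^ 2)
      by (simpl; rewrite Rmult_1_r, <- exp_plus; f_equal; ring).
    pose proof (exp_ineq1_le (Rabs x)). nra.
  - rewrite <- exp_plus.
    replace (k * Rabs x - A * x ^ 2 + 2 * Rabs x) with ((k + 2) * Rabs x - A * x ^ 2) by ring.
    now apply gauss_dom.
Qed.

Lemma kernelK_real_bound (y r T s : R) : 0 < y ->
  Cmod (kernelK y (RtoC r + Ci * RtoC T) (RtoC s)) <= exp (Rabs r * Rabs s - y / 2 * s ^ 2).
Proof.
  intros Hy. replace (RtoC s) with (RtoC s + Ci * RtoC 0)%C by ring.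
  rewrite Cmod_kernelK, cos_0. apply exp_le_compat.
  pose proof (cosh_ge_quad s) as Hc. apply (Rmult_le_compat_l y) in Hc; [|lra].
  pose proof (Rle_abs (r * s)) as Ha. rewrite Rabs_mult in Ha. nra.
Qed.

Lemma kernelK_ccont (y : R) (nu c : C) (x : R) : ccont (fun s => kernelK y nu (RtoC s + c)) x.
Proof. eapply ccont_cder_line, cder_kernelK. Qed.

Lemma kernelK_ccont_real (y : R) (nu : C) (x : R) : ccont (fun s => kernelK y nu (RtoC s)) x.
Proof.
  eapply rder_ccont, (rder_cder (kernelK y nu) RtoC); [apply cder_kernelK|apply rder_id].
Qed.

Lemma BesselK_clim (y r T : R) : 0 < y ->
  exists L, clim (fun s => kernelK y (RtoC r + Ci * RtoC T) (RtoC s)) L /\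
    BesselK (RtoC r + Ci * RtoC T) y = (RtoC (/ 2) * L)%C.
Proof.
  intros Hy. set (nu := (RtoC r + Ci * RtoC T)%C).
  destruct (dominated_clim (fun s => kernelK y nu (RtoC s)) (exp ((Rabs r + 2) ^ 2 / (4 * (y / 2)))))
    as (L & HL & HI).
  - intros; apply kernelK_ccont_real.
  - intros s. eapply Rle_trans; [now apply kernelK_real_bound|]. apply gauss_lorentz; lra.
  - exists L; split; [exact HL|]. unfold BesselK. f_equal.
    apply (is_RInt_gen_unique (V := C_R_CompleteNormedModule)).
    revert HI. apply is_RInt_gen_ext.
    exists (fun _ => True) (fun _ => True); [now exists 0|now exists 0|].
    intros a b _ _ s _. apply kernelK_real.
Qed.

(** Below the height [h < PI / 2] the decay rate [y cosh a cos e] keeps the positive factor [cos h],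
    which would be lost at [PI / 2]; [T >= 0] makes the factor [exp (- T e)] at most [1]. *)
Lemma BesselK_shift (y r T h : R) (L : C) : 0 < y -> 0 <= T -> 0 < h < PI / 2 ->
  clim (fun s => kernelK y (RtoC r + Ci * RtoC T) (RtoC s)) L ->
  clim (fun s => kernelK y (RtoC r + Ci * RtoC T) (RtoC s + Ci * RtoC h)%C) L.
Proof.
  intros Hy HT Hh HL. set (nu := (RtoC r + Ci * RtoC T)%C) in *.
  assert (Hcos : 0 < cos h) by (apply cos_gt_0; lra).
  set (k := y * cos h / 2). assert (Hk : 0 < k) by (unfold k; nra).
  set (B := exp ((Rabs r + 1) ^ 2 / (4 * k))). assert (HB : 0 < B) by apply exp_pos.
  apply (clim_close (fun s => kernelK y nu (RtoC s)) _ L (2 * (h * B)) 1); [nra| |exact HL].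
  intros N HN.
  replace (CInt (fun s => kernelK y nu (RtoC s)) (- N) N)
    with (CInt (fun s => kernelK y nu (RtoC s + Ci * RtoC 0)%C) (- N) N).
  2: { apply CInt_ext; [lra|]. intros t _. f_equal. ring. }
  assert (Ig : is_RInt (fun _ => B / N) 0 h (scal (h - 0) (B / N)))
    by apply (is_RInt_const (V := R_NormedModule)).
  pose proof (rectangle (kernelK y nu) (fun z => (- (RtoC y * csinh z) + nu) * kernelK y nu z)%C
    N 0 h (scal (h - 0) (B / N)) (fun _ => B / N) ltac:(lra) ltac:(lra) (cder_kernelK y nu) (cder_kernelK' y nu)) as Rc.
  eapply Rle_trans; [apply Rc; [|exact Ig]|].
  - intros e He.
    assert (Q : forall a, (a = N \/ a = - N) ->
       Cmod (kernelK y nu (RtoC a + Ci * RtoC e)) <= B / N).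
    { intros a Ha. unfold nu. rewrite Cmod_kernelK.
      assert (Ea : a ^ 2 = N ^ 2) by (destruct Ha as [-> | ->]; ring).
      assert (Era : r * a <= Rabs r * N).
      { eapply Rle_trans; [apply Rle_abs|]. rewrite Rabs_mult. apply Req_le. f_equal.
        destruct Ha as [-> | ->]; [|rewrite Rabs_Ropp]; apply Rabs_right; lra. }
      assert (Hce : cos h <= cos e) by (apply cos_decr_1; lra).
      pose proof (cosh_ge_quad a) as Hch. rewrite Ea in Hch.
      assert (HN2 : 0 <= N ^ 2) by apply pow2_ge_0.
      assert (H1 : k * N ^ 2 <= y * cosh a * cos e).
      { apply Rle_trans with (y * (1 + N ^ 2 / 2) * cos h); [unfold k; nra|].
        apply Rmult_le_compat; try nra. }
      (* One unit of the exponent is set aside: [exp (- N) <= 1 / N] supplies the rate for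
         [clim_close]. *)
      apply Rle_trans with (exp ((Rabs r + 1) * Rabs N - k * N ^ 2) * exp (- N)).
      - rewrite <- exp_plus. apply exp_le_compat. rewrite (Rabs_right N) by lra. nra.
      - apply Rmult_le_compat; try apply Rlt_le, exp_pos; [now apply gauss_dom|].
        rewrite exp_Ropp. apply Rinv_le_contravar; [lra|]. pose proof (exp_ineq1_le N); lra. }
    split; apply Q; [now left|now right].
  - unfold scal; simpl; unfold mult; simpl. apply Req_le. field. lra.
Qed.

(** This is [exp (nu i PI / 2)] for [nu = r + i y cos al]. *)
Definition phaseK (y al r : R) : C :=
  Cexp (RtoC (- (y * (PI / 2) * cos al)) + Ci * RtoC (r * (PI / 2)))%C.

Definition wave (r y al b x : R) : C :=
  (ker y al (RtoC al * lineb b x) * Cexp (RtoC r * (RtoC al * lineb b x)))%C.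

(** The substitution is [z = u + i PI / 2], and [cosh (u + i PI / 2) = i sinh u]. *)
Lemma kernelK_wave (y al r b x : R) :
  kernelK y (RtoC r + Ci * RtoC (y * cos al)) (RtoC (al * x) + Ci * RtoC (PI / 2 - al * b))
    = (phaseK y al r * wave r y al b x)%C.
Proof.
  unfold kernelK, phaseK, wave, ker. rewrite <- !Cexp_plus. f_equal.
  set (u := (RtoC al * lineb b x)%C).
  assert (Eu : u = (al * x, - (al * b))).
  { unfold u, lineb. apply injective_projections; simpl; ring. }
  rewrite Eu.
  replace (RtoC (al * x) + Ci * RtoC (PI / 2 - al * b))%C with (al * x, PI / 2 - al * b)
    by (apply injective_projections; simpl; ring).
  rewrite ccosh_components, csinh_components, cos_neg, sin_neg.
  assert (C1 : cos (PI / 2 - al * b) = sin (al * b)) by (rewrite cos_shift; reflexivity).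
  assert (S1 : sin (PI / 2 - al * b) = cos (al * b)) by (rewrite sin_shift; reflexivity).
  rewrite C1, S1. apply injective_projections; simpl; field.
Qed.

Lemma Cexp_neq_0 (z : C) : Cexp z <> 0.
Proof. apply Cmod_gt_0. rewrite Cmod_Cexp. apply exp_pos. Qed.

Lemma BesselK_wave (y al r b : R) : good y al b ->
  exists J, clim (wave r y al b) J /\
    BesselK (RtoC r + Ci * RtoC (y * cos al)) y = (RtoC (al / 2) * phaseK y al r * J)%C.
Proof.
  intros (Ha & Hy & Hb & Hab & _).
  destruct (BesselK_clim y r (y * cos al) Hy) as (L & HL & E).
  pose proof PI_4 as HP4. pose proof PI2_1 as HP1. 
  assert (Hc : 0 < cos al) by (apply cos_gt_0; lra).
  assert (Hh : 0 < PI / 2 - al * b < PI / 2) by nra.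
  apply (BesselK_shift y r (y * cos al) _ L Hy ltac:(nra) Hh) in HL.
  apply (clim_scale _ al) in HL; [|lra|intros; apply kernelK_ccont].
  assert (nal : RtoC al <> 0) by (apply RtoC_neq_0; lra).
  assert (np : phaseK y al r <> 0) by apply Cexp_neq_0.
  assert (Cw : forall x, ccont (wave r y al b) x).
  { intros x. apply ccont_mult; [apply ccont_ker|].
    eapply (ccont_holo_line (fun u => Cexp (RtoC r * u))).
    apply (cder_comp Cexp (fun u => RtoC r * u)%C); [apply cder_Cexp|apply cder_scal, cder_id]. }
  exists (/ phaseK y al r * (/ RtoC al * L))%C. split.
  - apply (clim_ext (fun x => / phaseK y al r * (phaseK y al r * wave r y al b x))%C).
    + intros x. field. exact np.
    + apply clim_scal.
      * intros x. apply ccont_mult; [apply ccont_const|apply Cw].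
      * revert HL. apply clim_ext. intros x. apply kernelK_wave.
  - rewrite E.
    replace (RtoC (al / 2)) with (RtoC (/ 2) * RtoC al)%C
      by (apply injective_projections; simpl; field).
    field. split; assumption.
Qed.

(** The multiple of [den] in [amplitude_order] is what [ker_by_parts] estimates. The coefficient of
    [I1] is [sin (r al)] without division by [al], since [integrand true] carries [lineb b x] in
    place of [u = al * lineb b x]. *)
Lemma wave_reduction (M : R) : 0 <= M -> exists K, 0 <= K /\
  forall y al r b J I0 I1, good y al b -> Rabs r <= M ->
  clim (wave r y al b) J ->
  clim (integrand false (y * gap al) b al) I0 -> clim (integrand true (y * gap al) b al) I1 ->
  Cmod (J - (RtoC (cos (r * al)) * I0 + RtoC (sin (r * al)) * I1))%C
    <= K / y * (exp (- (y * gap al)) / sqrt (y * gap al * b)).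
Proof.
  intros HM. destruct (amplitude_order M HM) as (K & Q & Q' & HK & HQ).
  pose proof PI_RGT_0 as HPI.
  assert (HKe : 0 <= K * exp (2 + K ^ 2)) by (apply Rmult_le_pos; [exact HK|apply Rlt_le, exp_pos]).
  exists (K * exp (2 + K ^ 2) * PI). split; [apply Rmult_le_pos; lra|].
  intros y al r b J I0 I1 G Hr HJ H0 H1.
  pose proof (good_xi y al b G) as [X1 _].
  assert (G' := G). destruct G' as (Ha & Hy & Hb & _).
  pose proof (gap_pos al Ha) as Hg.
  set (xi := y * gap al) in *.
  assert (Hxi : 0 < xi) by (unfold xi; nra).
  assert (Ey : xi / gap al = y) by (unfold xi; field; lra).
  assert (Cw : forall x, ccont (wave r y al b) x).
  { intros x. apply ccont_mult; [apply ccont_ker|].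
    eapply (ccont_holo_line (fun u => Cexp (RtoC r * u))).
    apply (cder_comp Cexp (fun u => RtoC r * u)%C); [apply cder_Cexp|apply cder_scal, cder_id]. }
  pose proof (clim_lin3 _ _ _ (RtoC (- cos (r * al))) (RtoC (- sin (r * al))) _ _ _ Cw
    (fun x => integrand_ccont false xi b al x) (fun x => integrand_ccont true xi b al x) HJ H0 H1) as Hs.
  replace (J - (RtoC (cos (r * al)) * I0 + RtoC (sin (r * al)) * I1))%C
    with (J + (RtoC (- cos (r * al)) * I0 + RtoC (- sin (r * al)) * I1))%C
    by (rewrite !RtoC_opp; ring).
  apply (clim_bound_eps _ _ _ Hs). intros eps He.
  set (Bd := exp (2 + K ^ 2) * exp (- xi)). assert (HBd : 0 < Bd) by (apply Rmult_lt_0_compat; apply exp_pos).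
  assert (Hay : 0 < al * y) by nra.
  set (c := / (al * y) * (2 * (K * Bd))).
  assert (Hc : 0 <= c).
  { apply Rmult_le_pos; [apply Rlt_le, Rinv_0_lt_compat, Hay|nra]. }
  assert (Hq : 0 <= c / eps / (xi * b)) by (repeat apply Rdiv_le_0_compat; lra).
  exists (1 + c / eps / (xi * b)). intros N HN.
  pose proof (ker_by_parts y al b K (Q al r) (Q' al r) G HK) as P.
  assert (P' : forall u, strip_ok al u -> cder (Q al r) u (Q' al r u) /\ (exists l, cder (Q' al r) u l) /\
     Cmod (Q al r u) <= K * exp (K * Rabs (Re u)) /\ Cmod (Q' al r u) <= K * exp (K * Rabs (Re u))).
  { intros u Hu. destruct (HQ al r u Hu Hr) as (_ & q1 & q2 & q3 & q4). now repeat split. }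
  specialize (P P' N ltac:(lra)). fold xi in P. fold Bd in P.
  replace (CInt _ (- N) N) with (CInt (fun x => ker y al (RtoC al * lineb b x) *
           (den al (RtoC al * lineb b x) * Q al r (RtoC al * lineb b x)))%C (- N) N).
  2: { apply CInt_ext; [lra|]. intros x _.
       destruct (strip_line y al b x G) as [Hst _].
       destruct (HQ al r _ Hst Hr) as (Eq & _).
       unfold wave, integrand. rewrite Ey, Eq. simpl amp.
       replace (RtoC (sin (r * al))) with (RtoC (sin (r * al) / al) * RtoC al)%C
         by (apply injective_projections; simpl; field; lra).
       rewrite !RtoC_opp.
       replace (RtoC (sin (r * al))) with (RtoC (sin (r * al) / al) * RtoC al)%C
         by (apply injective_projections; simpl; field; lra).
       ring. }
  eapply Rle_trans; [exact P|].
  assert (Hsq : 0 < sqrt (xi * b)) by (apply sqrt_lt_R0; lra).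
  rewrite Rmult_plus_distr_l, Rplus_comm. apply Rplus_le_compat.
  - apply Req_le. unfold Bd. field. lra.
  - replace (/ (al * y) * (2 * (K * Bd / (1 + xi * b * N ^ 2)))) with (c / (1 + xi * b * N ^ 2))
      by (unfold c, Rdiv; ring).
    assert (HN1 : 1 <= N) by lra.
    apply (Rle_div_l _ _ (1 + xi * b * N ^ 2)); [nra|].
    assert (E1 : c <= eps * (xi * b) * N).
    { apply Rle_trans with (eps * (xi * b) * (c / eps / (xi * b))); [apply Req_le; field; lra|].
      apply Rmult_le_compat_l; [nra|lra]. }
    assert (0 <= eps * (xi * b) * N * (N - 1)) by (repeat apply Rmult_le_pos; lra).
    nra.
Qed.

(** * The asymptotic formula *)

Lemma Rpower_third (a : R) (n : nat) : 0 < a -> Rpower a (INR n / 3) = Rpower a (1 / 3) ^ n.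
Proof.
  intros Ha. rewrite <- Rpower_pow by apply exp_pos. rewrite Rpower_mult. f_equal. field.
Qed.

Lemma cbrt_pow3 (a : R) : 0 < a -> Rpower a (1 / 3) ^ 3 = a.
Proof.
  intros Ha. rewrite <- Rpower_third by exact Ha.
  replace (INR 3 / 3) with 1 by (simpl; field). now apply Rpower_1.
Qed.

(** [edge al] is [sqrt zeta] at [theta = PI / 2 - al]. *)
Definition edge (al : R) : R := Rpower (3 / 2 * gap al) (1 / 3).

Lemma edge_facts (al : R) : 0 < al <= 1 / 2 ->
  0 < edge al /\ edge al ^ 3 = 3 / 2 * gap al /\ al <= 2 * edge al.
Proof.
  intros Ha. pose proof (gap_pos al Ha) as Hg. pose proof (gap_ge al ltac:(lra)) as Hg1.
  assert (E : edge al ^ 3 = 3 / 2 * gap al) by (apply cbrt_pow3; lra).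
  assert (He : 0 < edge al) by apply exp_pos.
  split; [exact He|split; [exact E|]].
  apply Rnot_lt_le. intros H.
  assert ((2 * edge al) ^ 3 <= al ^ 3) by (apply pow_incr; lra).
  rewrite Rpow_mult_distr, E in H0. lra.
Qed.

Lemma pow3_le_1 (a : R) : 1 <= a ^ 3 -> 1 <= a.
Proof.
  intros H. apply Rnot_lt_le. intros Ha.
  destruct (Rle_dec a 0); assert (0 <= a ^ 2) by apply pow2_ge_0; [nra|].
  assert (a ^ 2 < 1) by nra. nra.
Qed.

(** If [xi < 1], then [b = xi^(-1/3)], and [(al b)^3 = al^3 / xi <= 4 / y]. This is at most [1 / 8],
    that is [al b <= 1 / 2], exactly because [y >= 32]. The second claim holds since [(c b)^3] is at
    least [3 / 2]. *)
Lemma good_exists (y al : R) : 0 < al <= 1 / 2 -> 32 <= y ->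
  exists b, good y al b /\ forall c, c ^ 3 = 3 * (y * gap al) / 2 -> 1 <= c * b.
Proof.
  intros Ha Hy. pose proof (gap_pos al Ha) as Hg. pose proof (gap_ge al ltac:(lra)) as Hg1.
  set (xi := y * gap al).
  assert (Hxi : 0 < xi) by (unfold xi; nra).
  destruct (Rle_dec 1 xi) as [H|H].
  - exists 1. split.
    + repeat split; try lra. left. split; [reflexivity|exact H].
    + intros c Hc. rewrite Rmult_1_r. apply pow3_le_1. lra.
  - set (b := / Rpower xi (1 / 3)).
    pose proof (cbrt_pow3 xi Hxi) as E.
    assert (Hq : 0 < Rpower xi (1 / 3)) by apply exp_pos.
    assert (Eb : b ^ 3 * xi = 1).
    { transitivity (b ^ 3 * Rpower xi (1 / 3) ^ 3); [now rewrite E|]. unfold b. field. lra. }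
    assert (Hb0 : 0 < b) by (apply Rinv_0_lt_compat, Hq).
    assert (Hb3 : 0 < b ^ 3) by (apply pow_lt, Hb0).
    assert (Hb : 1 <= b) by (apply pow3_le_1; nra).
    exists b. split.
    + repeat split; try lra.
      * apply Rnot_lt_le. intros Hlt.
        assert (Q : 1 / 8 < (al * b) ^ 3).
        { set (v := al * b) in *. assert (1 / 4 < v ^ 2) by nra. nra. }
        assert (Q2 : (al * b) ^ 3 * xi <= 4 * gap al).
        { rewrite Rpow_mult_distr, Rmult_assoc, Eb. lra. }
        assert (32 * gap al <= xi) by (unfold xi; nra). nra.
      * right. split; [fold xi; lra|exact Eb].
    + intros c Hc. apply pow3_le_1. rewrite Rpow_mult_distr, Hc. fold xi. nra.
Qed.

(** The factors on the left come from the substitution [u = al * lineb b x] and the [1 / 2] of the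
    Bessel integral, from the transport along the path, and from the value of the cubic integral. *)
Lemma path_value (y al : R) : 0 < al <= 1 / 2 -> 0 < y ->
  let e := edge al in let c := Rpower y (1 / 3) * e in
  c ^ 3 = 3 * (y * gap al) / 2 /\
  al / 2 * (sqrt (3 * (y * gap al)) / nrm (y * gap al) al) * (2 * PI / c)
    = PI * sqrt 2 / Rpower y (1 / 3) * sqrt (e / sin al).
Proof.
  intros Ha Hy e c.
  pose proof (gap_pos al Ha) as Hg. pose proof (sin_ge_lin al ltac:(lra)) as Hs.
  destruct (edge_facts al Ha) as (He & He3 & _). fold e in He, He3.
  assert (HY : 0 < Rpower y (1 / 3)) by apply exp_pos.
  pose proof (cbrt_pow3 y Hy) as HY3.
  split.
  - unfold c. rewrite Rpow_mult_distr, HY3, He3. field.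
  - set (s := sin al) in *. set (Y := Rpower y (1 / 3)) in *.
    assert (Hxi : 0 < y * gap al) by nra.
    assert (E1 : sqrt (3 * (y * gap al)) = sqrt (y * e ^ 2 * s) * sqrt 2 * sqrt (e / s)).
    { assert (P1 : 0 < y * e ^ 2 * s).
      { apply Rmult_lt_0_compat; [apply Rmult_lt_0_compat; [lra|apply pow_lt; lra]|lra]. }
      assert (P2 : 0 <= e / s) by (apply Rdiv_le_0_compat; lra).
      rewrite <- (sqrt_mult (y * e ^ 2 * s) 2), <- (sqrt_mult (y * e ^ 2 * s * 2) (e / s)) by lra.
      f_equal. replace (y * e ^ 2 * s * 2 * (e / s)) with (2 * y * e ^ 3) by (field; lra).
      rewrite He3. field. }
    assert (E2 : nrm (y * gap al) al = al * sqrt (y * e ^ 2 * s) / e).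
    { unfold nrm. fold s. replace (y * gap al * s / gap al) with (y * s) by (field; lra).
      replace (y * e ^ 2 * s) with (e ^ 2 * (y * s)) by ring.
      assert (0 <= y * s) by (apply Rmult_le_pos; lra).
      rewrite (sqrt_mult (e ^ 2)), sqrt_pow2 by (lra || apply pow2_ge_0). field. lra. }
    assert (Hq : 0 < sqrt (y * e ^ 2 * s)).
    { apply sqrt_lt_R0.
      apply Rmult_lt_0_compat; [apply Rmult_lt_0_compat; [lra|apply pow_lt; lra]|lra]. }
    rewrite E1, E2. unfold c. fold Y. field. repeat split; lra.
Qed.

(** Both reductions leave errors of size [exp (- xi) / (y sqrt (xi b))]. [Airy_lower] with [q = c b]
    converts them into [|Airy|] at the cost of a factor [1 / c], hence a bound uniform down to
    [al = 0]. *)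
Lemma main_alpha (M : R) : 0 <= M -> exists K, 0 <= K /\
  forall al r y, 0 < al <= 1 / 2 -> Rabs r <= M -> 32 <= y ->
  let Y := Rpower y (1 / 3) in let e := edge al in
  Cmod (BesselK (RtoC r + Ci * RtoC (y * cos al)) y
     - phaseK y al r * (RtoC (PI * sqrt 2 / Y * (cos (r * al) * sqrt (e / sin al) * Airy ((Y * e) ^ 2)))
         + Ci * RtoC (PI * sqrt 2 / Y ^ 2 * (sin (r * al) / e * sqrt (e / sin al) * Airy' ((Y * e) ^ 2)))))%C
  <= K * (Rabs (Airy ((Y * e) ^ 2)) * exp (- (y * (PI / 2) * cos al)) / Y ^ 4).
Proof.
  intros HM.
  destruct (wave_reduction M HM) as (K1 & HK1 & HW).
  destruct transport_to_cubic as (K0 & HK0 & HT).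
  destruct Airy_lower as (k & Hk & HA).
  set (K2 := K1 + 8 * K0 * (1 + M)).
  assert (HK2 : 0 <= K2) by (unfold K2; nra).
  exists (2 * K2 / k). split; [apply Rdiv_le_0_compat; lra|].
  intros al r y Ha Hr Hy Y e.
  destruct (good_exists y al Ha Hy) as (b & G & Hcb).
  pose proof (good_xi y al b G) as [X1 _].
  assert (G' := G). destruct G' as (_ & _ & Hb & _).
  pose proof (gap_pos al Ha) as Hg. pose proof (gap_ge al ltac:(lra)) as Hg1.
  pose proof (sin_ge_lin al ltac:(lra)) as Hs.
  destruct (path_value y al Ha ltac:(lra)) as [Hc3 Hval]. fold Y e in Hc3, Hval.
  destruct (edge_facts al Ha) as (He & He3 & Hae). fold e in He, He3, Hae.
  assert (HY : 0 < Y) by apply exp_pos.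
  assert (HY3 : Y ^ 3 = y) by (apply cbrt_pow3; lra).
  set (c := Y * e) in *. assert (Hc : 0 < c) by (unfold c; nra).
  specialize (Hcb c Hc3).
  set (xi := y * gap al) in *.
  assert (Hxi : 0 < xi) by (unfold xi; nra).
  assert (Ey : xi / gap al = y) by (unfold xi; field; lra).
  assert (G2 : good (xi / gap al) al b) by (rewrite Ey; exact G).
  destruct (BesselK_wave y al r b G) as (J & HJ & EK).
  destruct (clim_exists_integrand false xi b al G2) as [I0 HI0].
  destruct (clim_exists_integrand true xi b al G2) as [I1 HI1].
  pose proof (cubic_value_0 xi b c Hc ltac:(lra) Hc3) as HL0.
  pose proof (cubic_value_1 xi b c Hc ltac:(lra) Hc3) as HL1.
  pose proof (HT xi b al false I0 _ G2 HI0 HL0) as T0.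
  pose proof (HT xi b al true I1 _ G2 HI1 HL1) as T1.
  pose proof (HW y al r b J I0 I1 G Hr HJ HI0 HI1) as W. fold xi in W.
  pose proof (nrm_bounds xi al Hxi Ha) as [Hn1 _].
  assert (Hsx : 0 < sqrt xi) by now apply sqrt_lt_R0.
  set (n := nrm xi al) in *. assert (Hn : 0 < n) by lra.
  set (Ex := exp (- xi) / sqrt (xi * b)) in *.
  assert (Hsq : 0 < sqrt (xi * b)) by (apply sqrt_lt_R0; lra).
  assert (HEx : 0 < Ex) by (apply Rdiv_lt_0_compat; [apply exp_pos|exact Hsq]).
  set (Y0 := RtoC (2 * PI * Airy (c ^ 2) / c)) in *.
  set (Y1 := (Ci * RtoC (2 * PI * Airy' (c ^ 2) / c ^ 2))%C) in *.
  set (g := sqrt (3 * xi) / n).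
  assert (Hal3 : al ^ 3 / xi <= 4 / y).
  { apply (Rle_div_l _ _ xi); [lra|]. replace (4 / y * xi) with (4 * gap al) by (unfold xi; field; lra). lra. }
  (* The transport error divided by [nrm >= sqrt xi] is of order [al^3 / xi], hence [1 / y]. The
     weight [scl j al] is [al] for the second amplitude; there [|sin (r al)| <= M al] provides
     it. *)
  assert (D : forall j I Lm, Cmod (RtoC n * I - RtoC (sqrt (3 * xi)) * Lm)%C <=
      2 * sqrt xi * (al ^ 2 / (xi * scl j al) * (K0 * exp (- xi) / sqrt (xi * b))) * al ->
      scl j al * Cmod (I - RtoC g * Lm)%C <= 8 * K0 / y * Ex).
  { intros j I Lm H.
    pose proof (scl_pos j al ltac:(lra)) as Hsc.
    assert (nn : RtoC n <> 0) by (apply RtoC_neq_0; lra).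
    assert (EI : (RtoC n * I - RtoC (sqrt (3 * xi)) * Lm = RtoC n * (I - RtoC g * Lm))%C).
    { replace (RtoC (sqrt (3 * xi))) with (RtoC n * RtoC g)%C
        by (apply injective_projections; simpl; unfold g; field; lra). ring. }
    rewrite EI, Cmod_mult, Cmod_R, Rabs_right in H by lra.
    set (m := Cmod (I - RtoC g * Lm)%C) in *.
    assert (Hm : 0 <= m) by apply Cmod_ge_0.
    assert (H2 : sqrt xi * m <= sqrt xi * (2 * (al ^ 3 / xi) * K0 * Ex / scl j al)).
    { apply Rle_trans with (n * m); [apply Rmult_le_compat_r; lra|].
      eapply Rle_trans; [exact H|]. apply Req_le. unfold Ex. field. lra. }
    apply Rmult_le_reg_l in H2; [|exact Hsx].
    apply Rle_trans with (2 * (al ^ 3 / xi) * K0 * Ex).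
    - apply (Rmult_le_compat_l (scl j al)) in H2; [|lra].
      replace (scl j al * (2 * (al ^ 3 / xi) * K0 * Ex / scl j al))
        with (2 * (al ^ 3 / xi) * K0 * Ex) in H2 by (field; lra). exact H2.
    - replace (8 * K0 / y * Ex) with (2 * (4 / y) * K0 * Ex) by (field; lra).
      apply Rmult_le_compat_r; [lra|]. apply Rmult_le_compat_r; [lra|]. lra. }
  apply D in T0. apply D in T1. simpl scl in T0, T1. rewrite Rmult_1_l in T0.
  assert (Hsin : Rabs (sin (r * al)) <= M * al).
  { pose proof (sin_div_bound al r ltac:(lra)) as Q. unfold Rdiv in Q.
    rewrite Rabs_mult, (Rabs_right (/ al)) in Q by (apply Rle_ge, Rlt_le, Rinv_0_lt_compat; lra).
    apply (Rmult_le_compat_r al) in Q; [|lra].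
    rewrite Rmult_assoc, Rinv_l, Rmult_1_r in Q by lra. nra. }
  assert (FJ : Cmod (J - RtoC g * (RtoC (cos (r * al)) * Y0 + RtoC (sin (r * al)) * Y1))%C
     <= K2 / y * Ex).
  { replace (J - RtoC g * (RtoC (cos (r * al)) * Y0 + RtoC (sin (r * al)) * Y1))%C
      with ((J - (RtoC (cos (r * al)) * I0 + RtoC (sin (r * al)) * I1))
        + (RtoC (cos (r * al)) * (I0 - RtoC g * Y0) + RtoC (sin (r * al)) * (I1 - RtoC g * Y1)))%C
      by ring.
    replace (K2 / y * Ex) with (K1 / y * Ex + (1 * (8 * K0 / y * Ex) + M * (8 * K0 / y * Ex)))
      by (unfold K2; field; lra).
    apply Cmod_le_plus; [exact W|]. apply Cmod_le_plus.
    - apply Cmod_le_mult; [|exact T0]. rewrite Cmod_R. apply Rabs_le, COS_bound.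
    - rewrite Cmod_mult, Cmod_R.
      apply Rle_trans with (M * al * Cmod (I1 - RtoC g * Y1)%C).
      + apply Rmult_le_compat_r; [apply Cmod_ge_0|exact Hsin].
      + rewrite Rmult_assoc. now apply Rmult_le_compat_l. }
  set (ph := phaseK y al r) in *.
  assert (EM : (ph * (RtoC (PI * sqrt 2 / Y * (cos (r * al) * sqrt (e / sin al) * Airy (c ^ 2)))
         + Ci * RtoC (PI * sqrt 2 / Y ^ 2 * (sin (r * al) / e * sqrt (e / sin al) * Airy' (c ^ 2)))))%C
     = (RtoC (al / 2) * ph * (RtoC g * (RtoC (cos (r * al)) * Y0 + RtoC (sin (r * al)) * Y1)))%C).
  { assert (V : al / 2 * g * (2 * PI / c) = PI * sqrt 2 / Y * sqrt (e / sin al)) by exact Hval.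
    replace (PI * sqrt 2 / Y * (cos (r * al) * sqrt (e / sin al) * Airy (c ^ 2)))
      with (PI * sqrt 2 / Y * sqrt (e / sin al) * (cos (r * al) * Airy (c ^ 2))) by ring.
    replace (PI * sqrt 2 / Y ^ 2 * (sin (r * al) / e * sqrt (e / sin al) * Airy' (c ^ 2)))
      with (PI * sqrt 2 / Y * sqrt (e / sin al) * (sin (r * al) * Airy' (c ^ 2) / c))
      by (unfold c; field; lra).
    rewrite <- V. unfold Y0, Y1.
    replace (2 * PI * Airy (c ^ 2) / c) with (2 * PI / c * Airy (c ^ 2)) by (field; lra).
    replace (2 * PI * Airy' (c ^ 2) / c ^ 2) with (2 * PI / c * (Airy' (c ^ 2) / c)) by (field; lra).
    replace (sin (r * al) * Airy' (c ^ 2) / c) with (sin (r * al) * (Airy' (c ^ 2) / c)) by (field; lra).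
    rewrite !RtoC_mult. ring. }
  rewrite EK, EM.
  replace (RtoC (al / 2) * ph * J - RtoC (al / 2) * ph * (RtoC g * (RtoC (cos (r * al)) * Y0
      + RtoC (sin (r * al)) * Y1)))%C with (RtoC (al / 2) * ph *
      (J - RtoC g * (RtoC (cos (r * al)) * Y0 + RtoC (sin (r * al)) * Y1)))%C by ring.
  set (dec := exp (- (y * (PI / 2) * cos al))).
  assert (Hdec : 0 < dec) by apply exp_pos.
  assert (Hph : Cmod ph = dec).
  { unfold ph, phaseK, dec. rewrite Cmod_Cexp. f_equal. simpl; unfold Re, Im; simpl. ring. }
  apply Rle_trans with (al / 2 * dec * (K2 / y * Ex)).
  { apply Cmod_le_mult; [|exact FJ]. rewrite Cmod_mult, Hph, Cmod_R, Rabs_right; lra. }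
  specialize (HA c (c * b) Hc Hcb ltac:(nra)).
  replace (2 / 3 * c ^ 3) with xi in HA by lra.
  assert (Hscb : 0 < sqrt (c * b)) by (apply sqrt_lt_R0; lra).
  assert (Hroot : c / 2 * sqrt (c * b) <= sqrt (xi * b)).
  { replace (c / 2 * sqrt (c * b)) with (sqrt ((c / 2) ^ 2 * (c * b)))
      by (rewrite sqrt_mult, sqrt_pow2 by nra; reflexivity).
    apply sqrt_le_1_alt. replace xi with (2 / 3 * c ^ 3) by lra.
    assert (0 < c ^ 3 * b) by (apply Rmult_lt_0_compat; [apply pow_lt|]; lra). nra. }
  assert (HE1 : Ex <= 2 / c * (Rabs (Airy (c ^ 2)) / k)).
  { unfold Ex. apply (Rle_div_l _ _ (sqrt (xi * b))); [exact Hsq|].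
    apply (Rle_div_l _ _ (sqrt (c * b))) in HA; [|exact Hscb].
    apply Rle_trans with (2 / c * (Rabs (Airy (c ^ 2)) / k) * (c / 2 * sqrt (c * b))).
    - replace (2 / c * (Rabs (Airy (c ^ 2)) / k) * (c / 2 * sqrt (c * b)))
        with (Rabs (Airy (c ^ 2)) * sqrt (c * b) / k) by (field; lra).
      apply (Rle_div_r _ _ k); lra.
    - apply Rmult_le_compat_l; [|exact Hroot].
      pose proof (Rabs_pos (Airy (c ^ 2))).
      apply Rmult_le_pos; apply Rdiv_le_0_compat; lra. }
  assert (Hpos : 0 <= Rabs (Airy (c ^ 2)) / k) by (apply Rdiv_le_0_compat; [apply Rabs_pos|exact Hk]).
  (* Since [al / 2 <= e] and [c = Y e], the edge cancels, and [y = Y^3] leaves [1 / Y^4]. *)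
  apply Rle_trans with (e * dec * (K2 / y * (2 / c * (Rabs (Airy (c ^ 2)) / k)))).
  - apply Rmult_le_compat.
    + apply Rmult_le_pos; lra.
    + apply Rmult_le_pos; [apply Rdiv_le_0_compat; lra|lra].
    + apply Rmult_le_compat_r; lra.
    + apply Rmult_le_compat_l; [apply Rdiv_le_0_compat; lra|exact HE1].
  - apply Req_le. rewrite <- HY3. unfold c. field. repeat split; lra.
Qed.

(** * The right angle *)

(** Supplies the continuity in the imaginary part of the order when [al] tends to [0]. The factor
    [|s|] from the difference of the exponentials is bounded by [exp |s|], which raises [|r|] to
    [|r| + 1]. *)
Lemma BesselK_lipschitz (y r : R) : 0 < y -> exists K, 0 <= K /\ forall T T',
  Cmod (BesselK (RtoC r + Ci * RtoC T) y - BesselK (RtoC r + Ci * RtoC T') y)%C <= K * Rabs (T - T').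
Proof.
  intros Hy. pose proof PI_RGT_0 as HPI.
  set (B := exp ((Rabs r + 1 + 2) ^ 2 / (4 * (y / 2)))). assert (HB : 0 < B) by apply exp_pos.
  exists (B * PI). split; [nra|]. intros T T'.
  destruct (BesselK_clim y r T Hy) as (L & HL & ->).
  destruct (BesselK_clim y r T' Hy) as (L' & HL' & ->).
  set (f := fun s : R => kernelK y (RtoC r + Ci * RtoC T) (RtoC s)) in *.
  set (f' := fun s : R => kernelK y (RtoC r + Ci * RtoC T') (RtoC s)) in *.
  assert (Cf : forall s, ccont f s) by (intros; apply kernelK_ccont_real).
  assert (Cf' : forall s, ccont f' s) by (intros; apply kernelK_ccont_real).
  pose proof (clim_scal _ (RtoC (-1)) _ Cf' HL') as Hm.
  assert (Cm : forall s, ccont (fun t => RtoC (-1) * f' t)%C s) by (intros; ccont_tac).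
  pose proof (clim_plus _ _ _ _ Cf Cm HL Hm) as Hs.
  replace (RtoC (/ 2) * L - RtoC (/ 2) * L')%C with (RtoC (/ 2) * (L + RtoC (-1) * L'))%C
    by (apply injective_projections; simpl; field).
  rewrite Cmod_mult, Cmod_R, Rabs_right by lra.
  assert (H : Cmod (L + RtoC (-1) * L')%C <= 2 * Rabs (T - T') * B * PI / sqrt 1).
  { apply (clim_bound _ _ _ Hs). intros N HN. apply CInt_lorentz; [lra|exact HN|intros; ccont_tac|].
    intros s. rewrite Rmult_1_l.
    replace (f s + RtoC (-1) * f' s)%C with (f s - f' s)%C by (apply injective_projections; simpl; ring).
    pose proof (kernelK_real_bound y r T s Hy) as B1. pose proof (kernelK_real_bound y r T' s Hy) as B2.
    unfold f, f'. unfold kernelK in *. rewrite Cmod_Cexp in B1, B2.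
    eapply Rle_trans; [apply Cexp_diff|].
    set (Q := exp (Rabs r * Rabs s - y / 2 * s ^ 2)) in *.
    replace (_ - _)%C with (Ci * RtoC (T - T') * RtoC s)%C
      by (rewrite RtoC_minus; ring).
    rewrite !Cmod_mult, Cmod_Ci, !Cmod_R, Rmult_1_l.
    apply Rle_trans with (Rabs (T - T') * Rabs s * (Q + Q)).
    - apply Rmult_le_compat_l; [|lra]. apply Rmult_le_pos; apply Rabs_pos.
    - assert (HQ : Rabs s * Q <= B / (1 + s ^ 2)).
      { eapply Rle_trans; [|apply gauss_lorentz; lra].
        apply Rle_trans with (exp (Rabs s) * Q).
        - apply Rmult_le_compat_r; [apply Rlt_le, exp_pos|]. pose proof (exp_ineq1_le (Rabs s)); lra.
        - unfold Q. rewrite <- exp_plus. apply exp_le_compat. lra. }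
      replace (2 * Rabs (T - T') * B / (1 + s ^ 2)) with (2 * Rabs (T - T') * (B / (1 + s ^ 2)))
        by (unfold Rdiv; ring).
      pose proof (Rabs_pos (T - T')). nra. }
  rewrite sqrt_1 in H. lra.
Qed.

(** * Limits from the right at [al = 0] *)

Notation tends f l := (filterlim f (at_right 0) (locally l)).

Lemma at_right_small (d : R) : 0 < d -> at_right 0 (fun a => 0 < a < d).
Proof.
  intros Hd. exists (mkposreal d Hd). intros a Hb Ha. simpl in Hb.
  change (Rabs (a - 0) < d) in Hb. rewrite Rminus_0_r, Rabs_right in Hb; lra.
Qed.

Lemma tends_of_bound (f : R -> R) (l K : R) : 0 <= K ->
  at_right 0 (fun a => Rabs (f a - l) <= K * a) -> tends f l.
Proof.
  intros HK H. apply filterlim_locally. intros [eps He].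
  assert (Hd : 0 < eps / (K + 1)) by (apply Rdiv_lt_0_compat; lra).
  generalize (filter_and _ _ H (at_right_small _ Hd)). apply filter_imp.
  intros a [H1 [H2 H3]]. change (Rabs (f a - l) < eps).
  apply Rle_lt_trans with (K * a); [exact H1|].
  apply (Rlt_div_r _ _ (K + 1)) in H3; [|lra]. nra.
Qed.

Lemma tends_ext (f g : R -> R) (l : R) :
  at_right 0 (fun a => f a = g a) -> tends f l -> tends g l.
Proof. intros H. now apply filterlim_ext_loc. Qed.

Lemma tends_cont (f g : R -> R) (l : R) : continuous g l -> tends f l -> tends (fun a => g (f a)) (g l).
Proof. intros Hg Hf. exact (filterlim_comp _ _ _ f g _ _ _ Hf Hg). Qed.

Lemma tends_mult (f g : R -> R) (l m : R) : tends f l -> tends g m -> tends (fun a => f a * g a) (l * m).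
Proof.
  intros Hf Hg. exact (filterlim_comp_2 f g Rmult Hf Hg (filterlim_mult l m)).
Qed.

Lemma tends_eq (f : R -> R) (l m : R) : tends f l -> l = m -> tends f m.
Proof. now intros H <-. Qed.

Lemma tends_const (c : R) : tends (fun _ => c) c.
Proof. apply filterlim_const. Qed.

Lemma tends_id : tends (fun a => a) 0.
Proof.
  apply (tends_of_bound _ _ 1); [lra|]. generalize (at_right_small 1 Rlt_0_1). apply filter_imp.
  intros a Ha. rewrite Rminus_0_r, Rabs_right; lra.
Qed.

Lemma tends_sin_div (r : R) : tends (fun a => sin (r * a) / a) r.
Proof.
  assert (D : is_derive (fun a => sin (r * a)) 0 r).
  { auto_derive; [exact I|]. rewrite Rmult_0_r, cos_0. ring. }
  apply is_derive_Reals in D. apply filterlim_locally. intros [eps He].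
  destruct (D eps He) as [d Hd].
  generalize (at_right_small d (cond_pos d)). apply filter_imp. intros a [H1 H2].
  specialize (Hd a ltac:(lra)). rewrite Rabs_right in Hd by lra. specialize (Hd H2).
  rewrite Rplus_0_l, Rmult_0_r, sin_0, Rminus_0_r in Hd. exact Hd.
Qed.

Lemma tends_sin_ratio : tends (fun a => sin a / a) 1.
Proof.
  apply (tends_ext (fun a => sin (1 * a) / a)); [|apply tends_sin_div].
  apply filter_forall. intros a. now rewrite Rmult_1_l.
Qed.

Lemma pow3_inj (a b : R) : 0 < a -> 0 < b -> a ^ 3 = b ^ 3 -> a = b.
Proof.
  intros Ha Hb H.
  assert (E : (a - b) * (a ^ 2 + a * b + b ^ 2) = 0) by (ring_simplify; lra).
  apply Rmult_integral in E. destruct E as [E|E]; [lra|]. nra.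
Qed.

(** The limit of [sqrt zeta / al]: [gap al] behaves like [al^3 / 3], so [3/2 * gap al] behaves like
    [al^3 / 2]. *)
Definition edge_limit : R := Rpower (1 / 2) (1 / 3).

Lemma tends_edge_ratio : tends (fun a => edge a / a) edge_limit.
Proof.
  apply (tends_ext (fun a => Rpower (3 / 2 * (gap a / a ^ 3)) (1 / 3))).
  - generalize (at_right_small (1 / 2) ltac:(lra)). apply filter_imp. intros a Ha.
    destruct (edge_facts a ltac:(lra)) as (E1 & E2 & _).
    pose proof (gap_pos a ltac:(lra)) as Hg.
    assert (A3 : 0 < a ^ 3) by (apply pow_lt; lra).
    assert (Hq : 0 < gap a / a ^ 3) by now apply Rdiv_lt_0_compat.
    (* The two expressions are positive, so it suffices to compare their cubes, which avoids rules
       for real powers of quotients. *)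
    apply pow3_inj; [apply exp_pos|apply Rdiv_lt_0_compat; lra|].
    rewrite cbrt_pow3 by lra. unfold Rdiv at 3. rewrite Rpow_mult_distr, E2, pow_inv.
    unfold Rdiv; ring.
  - unfold edge_limit. replace (1 / 2) with (3 / 2 * (1 / 3)) by field.
    apply (tends_cont (fun a => gap a / a ^ 3) (fun q => Rpower (3 / 2 * q) (1 / 3))).
    + apply @ex_derive_continuous. unfold Rpower. auto_derive. lra.
    + apply (tends_of_bound _ _ 1); [lra|].
      generalize (at_right_small (1 / 2) ltac:(lra)). apply filter_imp. intros a Ha.
      pose proof (gap_le a ltac:(lra)) as H1. pose proof (gap_ge_quintic a ltac:(lra)) as H2.
      assert (A3 : 0 < a ^ 3) by (apply pow_lt; lra).
      rewrite Rabs_left1.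
      * replace (- (gap a / a ^ 3 - 1 / 3)) with ((a ^ 3 / 3 - gap a) / a ^ 3) by (field; lra).
        apply (Rle_div_l _ _ (a ^ 3)); [lra|].
        assert (a ^ 5 = a * (a * a ^ 3)) by ring. assert (0 < a * a ^ 3) by nra. nra.
      * apply Rle_minus. apply (Rle_div_l _ _ (a ^ 3)); lra.
Qed.

Lemma edge_limit_pos : 0 < edge_limit.
Proof. apply exp_pos. Qed.

Lemma tends_edge_sin : tends (fun a => sqrt (edge a / sin a)) (sqrt edge_limit).
Proof.
  pose proof edge_limit_pos as Hl.
  apply (tends_ext (fun a => sqrt (edge a / a * / (sin a / a)))).
  - generalize (at_right_small (1 / 2) ltac:(lra)). apply filter_imp. intros a Ha.
    pose proof (sin_ge_lin a ltac:(lra)). f_equal. field. lra.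
  - apply (tends_cont _ sqrt).
    + apply continuity_pt_filterlim, continuity_pt_sqrt. lra.
    + replace edge_limit with (edge_limit * / 1) by field.
      apply tends_mult; [apply tends_edge_ratio|]. apply (tends_cont _ Rinv); [|apply tends_sin_ratio].
      apply @ex_derive_continuous. auto_derive. lra.
Qed.

Lemma tends_sin_edge (r : R) : tends (fun a => sin (r * a) / edge a) (r / edge_limit).
Proof.
  pose proof edge_limit_pos as Hl.
  apply (tends_ext (fun a => sin (r * a) / a * / (edge a / a))).
  - generalize (at_right_small (1 / 2) ltac:(lra)). apply filter_imp. intros a Ha.
    destruct (edge_facts a ltac:(lra)) as (E1 & _ & _). field. lra.
  - apply tends_mult; [apply tends_sin_div|]. apply (tends_cont _ Rinv); [|apply tends_edge_ratio].
    apply @ex_derive_continuous. auto_derive. lra.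
Qed.

Lemma tends_edge : tends edge 0.
Proof.
  apply (tends_ext (fun a => edge a / a * a)).
  - generalize (at_right_small (1 / 2) ltac:(lra)). apply filter_imp. intros a Ha. field. lra.
  - apply (tends_eq _ (edge_limit * 0)); [|ring].
    apply tends_mult; [apply tends_edge_ratio|apply tends_id].
Qed.

(** * The coefficients in terms of [al = PI / 2 - theta] *)

Lemma zeta_base_gap (al : R) : zeta_base (PI / 2 - al) = 3 / 2 * gap al.
Proof.
  unfold zeta_base, gap.
  replace (sin (PI / 2 - al)) with (cos al) by (rewrite sin_shift; reflexivity).
  replace (cos (PI / 2 - al)) with (sin al) by (rewrite cos_shift; reflexivity).
  ring.
Qed.

Lemma zeta_edge (al : R) : 0 < al <= 1 / 2 -> zeta (PI / 2 - al) = edge al ^ 2.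
Proof.
  intros Ha. pose proof (gap_pos al Ha) as Hg.
  unfold zeta, rpow. rewrite zeta_base_gap.
  destruct (Rlt_dec 0 (3 / 2 * gap al)) as [_|n]; [|lra].
  unfold edge. rewrite <- Rpower_third by lra. f_equal; simpl; field.
Qed.

Lemma zeta_right_angle : zeta (PI / 2) = 0.
Proof.
  unfold zeta, rpow, zeta_base. rewrite sin_PI2, cos_PI2.
  destruct (Rlt_dec _ _) as [H|]; [|reflexivity]. lra.
Qed.

Lemma coefA_raw (al : R) : 0 < al <= 1 / 2 ->
  rpow (zeta (PI / 2 - al) / cos (PI / 2 - al) ^ 2) (1 / 4) = sqrt (edge al / sin al).
Proof.
  intros Ha. pose proof (sin_ge_lin al ltac:(lra)) as Hs.
  destruct (edge_facts al Ha) as (He & _ & _).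
  rewrite zeta_edge, cos_shift by exact Ha.
  assert (Hq : 0 < edge al / sin al) by (apply Rdiv_lt_0_compat; lra).
  replace (edge al ^ 2 / sin al ^ 2) with ((edge al / sin al) ^ 2) by (field; lra).
  unfold rpow. destruct (Rlt_dec _ _) as [_|n]; [|exfalso; apply n, pow_lt, Hq].
  rewrite <- Rpower_pow, Rpower_mult by exact Hq.
  rewrite <- Rpower_sqrt by exact Hq. f_equal; simpl; field.
Qed.

(** The minus sign, from [theta - PI / 2 = - al], accounts for the opposite signs of the second term
    in [main_alpha] and in the theorem. *)
Lemma coefB_raw (r al : R) : 0 < al <= 1 / 2 ->
  sin (r * (PI / 2 - al) - r * (PI / 2)) * rpow (zeta (PI / 2 - al)) (- (1 / 2))
    = - (sin (r * al) / edge al).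
Proof.
  intros Ha. destruct (edge_facts al Ha) as (He & _ & _).
  rewrite zeta_edge by exact Ha.
  replace (r * (PI / 2 - al) - r * (PI / 2)) with (- (r * al)) by ring. rewrite sin_neg.
  unfold rpow. destruct (Rlt_dec _ _) as [_|n]; [|exfalso; apply n, pow_lt, He].
  rewrite <- Rpower_pow, Rpower_mult by exact He.
  replace (INR 2 * - (1 / 2)) with (- (1)) by (simpl; field).
  rewrite Rpower_Ropp, Rpower_1 by exact He. unfold Rdiv. ring.
Qed.

Lemma extend_left_off (a x : R) (f : R -> R) : x <> a -> extend_left a f x = f x.
Proof. intros H. unfold extend_left. destruct (Req_EM_T x a); [contradiction|reflexivity]. Qed.

(** The value of [lim] is specified for proper Cauchy filters. Convergence makes the image filter
    Cauchy, and some value of [f] is then close both to [lim] and to [l]. *)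
Lemma extend_left_limit (a l : R) (f : R -> R) :
  filterlim (fun t => f (a - t)) (at_right 0) (locally l) -> extend_left a f a = l.
Proof.
  intros H. unfold extend_left. destruct (Req_EM_T a a) as [_|n]; [|contradiction].
  assert (Hf : filterlim f (at_left a) (locally l)).
  { apply (filterlim_ext (fun t => f (a - (a - t)))); [intros; f_equal; ring|].
    apply (filterlim_comp _ _ _ (fun t => a - t) (fun t => f (a - t)) _ (at_right 0)); [|exact H].
    intros P [eps HP]. exists eps. intros t Ht Hlt. apply HP; [|lra].
    change (Rabs (a - t - 0) < eps). change (Rabs (t - a) < eps) in Ht.
    replace (a - t - 0) with (- (t - a)) by ring. now rewrite Rabs_Ropp. }
  set (F := filtermap f (at_left a)).
  assert (PF : ProperFilter F) by (apply filtermap_proper_filter; apply at_left_proper_filter).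
  assert (HC : cauchy F).
  { intros eps. exists l. apply Hf. now exists eps. }
  pose proof (complete_cauchy (T := R_CompleteSpace) F PF HC) as HL.
  apply Rminus_diag_uniq. apply Req_of_small. intros eps He.
  assert (He2 : 0 < eps / 2) by lra.
  specialize (HL (mkposreal _ He2)).
  assert (Hl : F (ball l (mkposreal _ He2))) by (apply Hf; now exists (mkposreal _ He2)).
  destruct (filter_ex _ (filter_and _ _ HL Hl)) as (z & Z1 & Z2).
  change (Rabs (z - lim (T := R_CompleteSpace) F) < eps / 2) in Z1.
  change (Rabs (z - l) < eps / 2) in Z2.
  replace (lim (T := R_CompleteSpace) F - l) with ((z - l) - (z - lim (T := R_CompleteSpace) F)) by ring.
  eapply Rle_trans; [apply Rabs_triang|]. rewrite Rabs_Ropp. lra.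
Qed.

Lemma coefA_right_angle : coefA (PI / 2) = sqrt edge_limit.
Proof.
  apply extend_left_limit. apply (tends_ext (fun a => sqrt (edge a / sin a))); [|apply tends_edge_sin].
  generalize (at_right_small (1 / 2) ltac:(lra)). apply filter_imp. intros a Ha.
  symmetry. apply coefA_raw. lra.
Qed.

Lemma coefB_right_angle (r : R) : coefB r (PI / 2) = - (r / edge_limit).
Proof.
  apply extend_left_limit.
  apply (tends_ext (fun a => -1 * (sin (r * a) / edge a))).
  - generalize (at_right_small (1 / 2) ltac:(lra)). apply filter_imp. intros a Ha.
    rewrite coefB_raw by lra. ring.
  - apply (tends_eq _ (-1 * (r / edge_limit))); [|ring].
    apply tends_mult; [apply tends_const|apply tends_sin_edge].
Qed.

Definition amplitude_Ai (Y r a : R) : R :=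
  PI * sqrt 2 / Y * (cos (r * a) * sqrt (edge a / sin a) * Airy ((Y * edge a) ^ 2)).
Definition amplitude_Ai' (Y r a : R) : R :=
  PI * sqrt 2 / Y ^ 2 * (sin (r * a) / edge a * sqrt (edge a / sin a) * Airy' ((Y * edge a) ^ 2)).

Lemma tends_airy_arg (f f' : R -> R) (Y : R) : (forall x, is_derive f x (f' x)) ->
  tends (fun a => f ((Y * edge a) ^ 2)) (f 0).
Proof.
  intros Hd. apply (tends_eq _ (f ((Y * 0) ^ 2))); [|f_equal; ring].
  apply (tends_cont edge (fun e => f ((Y * e) ^ 2))); [|apply tends_edge].
  apply (continuous_comp (fun e : R => (Y * e) ^ 2) f).
  - apply @ex_derive_continuous. auto_derive. exact I.
  - apply @ex_derive_continuous. eexists; apply Hd.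
Qed.

Lemma tends_cos (k : R) : tends (fun a => cos (k * a)) 1.
Proof.
  apply (tends_eq _ (cos (k * 0))); [|rewrite Rmult_0_r; apply cos_0].
  apply (tends_cont (fun a => a) (fun a => cos (k * a))); [|apply tends_id].
  apply @ex_derive_continuous. auto_derive. exact I.
Qed.

Lemma tends_amplitude_Ai (Y r : R) :
  tends (amplitude_Ai Y r) (PI * sqrt 2 / Y * (1 * sqrt edge_limit * Airy 0)).
Proof.
  apply tends_mult; [apply tends_const|]. apply tends_mult; [apply tends_mult|].
  - apply tends_cos.
  - apply tends_edge_sin.
  - apply (tends_airy_arg Airy Airy'), Airy_derive.
Qed.

Lemma tends_amplitude_Ai' (Y r : R) :
  tends (amplitude_Ai' Y r) (PI * sqrt 2 / Y ^ 2 * (r / edge_limit * sqrt edge_limit * Airy' 0)).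
Proof.
  apply tends_mult; [apply tends_const|]. apply tends_mult; [apply tends_mult|].
  - apply tends_sin_edge.
  - apply tends_edge_sin.
  - apply (tends_airy_arg Airy' (fun x => x * Airy x)), Airy'_derive.
Qed.

Lemma tends_decay (y : R) :
  tends (fun a => exp (- (y * (PI / 2) * cos a))) (exp (- (y * (PI / 2) * cos 0))).
Proof.
  apply (tends_cont (fun a => a) (fun a => exp (- (y * (PI / 2) * cos a)))); [|apply tends_id].
  apply @ex_derive_continuous. auto_derive. exact I.
Qed.

Lemma phaseK_split (y al r : R) :
  phaseK y al r = (RtoC (exp (- (y * (PI / 2) * cos al))) * Cexp (Ci * RtoC (r * (PI / 2))))%C.
Proof.
  unfold phaseK. rewrite Cexp_plus. f_equal.
  unfold Cexp; simpl; unfold Re, Im; simpl. rewrite cos_0, sin_0.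
  apply injective_projections; simpl; ring.
Qed.

(** The constant of [main_alpha] does not depend on [al], and for fixed [y] and [r] every term has a
    limit as [al] tends to [0], so the inequality passes to the limit. *)
Lemma main_right_angle (M : R) : 0 <= M -> exists K, 0 <= K /\
  forall r y, Rabs r <= M -> 32 <= y ->
  let Y := Rpower y (1 / 3) in
  Cmod (BesselK (RtoC r + Ci * RtoC (y * cos 0)) y
     - phaseK y 0 r * (RtoC (PI * sqrt 2 / Y * (1 * sqrt edge_limit * Airy 0))
         + Ci * RtoC (PI * sqrt 2 / Y ^ 2 * (r / edge_limit * sqrt edge_limit * Airy' 0))))%C
  <= K * (Rabs (Airy 0) * exp (- (y * (PI / 2) * cos 0)) / Y ^ 4).
Proof.
  intros HM. destruct (main_alpha M HM) as (K & HK & HA).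
  exists K; split; [exact HK|]. intros r y Hr Hy Y.
  destruct (BesselK_lipschitz y r ltac:(lra)) as (L & HL & Lip).
  assert (HY : 0 < Y) by apply exp_pos.
  set (dec := fun a => exp (- (y * (PI / 2) * cos a))).
  set (P0 := PI * sqrt 2 / Y * (1 * sqrt edge_limit * Airy 0)).
  set (P1 := PI * sqrt 2 / Y ^ 2 * (r / edge_limit * sqrt edge_limit * Airy' 0)).
  set (B0 := BesselK (RtoC r + Ci * RtoC (y * cos 0)) y).
  set (ph := Cexp (Ci * RtoC (r * (PI / 2)))%C).
  assert (Hph : Cmod ph = 1).
  { unfold ph. rewrite Cmod_Cexp.
    replace (Re (Ci * RtoC (r * (PI / 2)))%C) with 0 by (simpl; unfold Re, Im; simpl; ring).
    apply exp_0. }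
  (* The four quarters of [eps] go to the Bessel function, the two amplitudes and the error
     bound. *)
  apply le_epsilon. intros eps He. assert (He4 : 0 < eps / 4) by lra.
  pose proof (tends_mult _ _ _ _ (tends_decay y) (tends_amplitude_Ai Y r)) as T0.
  pose proof (tends_mult _ _ _ _ (tends_decay y) (tends_amplitude_Ai' Y r)) as T1.
  assert (TR : tends (fun a => K * (Rabs (Airy ((Y * edge a) ^ 2)) * dec a * / Y ^ 4))
                 (K * (Rabs (Airy 0) * dec 0 * / Y ^ 4))).
  { apply tends_mult; [apply tends_const|]. apply tends_mult; [|apply tends_const].
    apply tends_mult; [|apply tends_decay].
    apply (tends_cont _ Rabs); [apply continuity_pt_filterlim, Rcontinuity_abs|].
    apply (tends_airy_arg Airy Airy'), Airy_derive. }
  assert (TB : tends (fun a => L * (y * a)) 0).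
  { apply (tends_eq _ (L * (y * 0))); [|ring].
    apply tends_mult; [apply tends_const|]. apply tends_mult; [apply tends_const|apply tends_id]. }
  pose proof (proj1 (filterlim_locally _ _) T0 (mkposreal _ He4)) as E0.
  pose proof (proj1 (filterlim_locally _ _) T1 (mkposreal _ He4)) as E1.
  pose proof (proj1 (filterlim_locally _ _) TR (mkposreal _ He4)) as E2.
  pose proof (proj1 (filterlim_locally _ _) TB (mkposreal _ He4)) as E3.
  assert (E4 : at_right 0 (fun a => 0 < a < 1 / 2)) by (apply at_right_small; lra).
  destruct (filter_ex _ (filter_and _ _ E4
    (filter_and _ _ (filter_and _ _ E0 E1) (filter_and _ _ E2 E3)))) as (a & Ha & (h0 & h1) & (h2 & h3)).
  change (Rabs (dec a * amplitude_Ai Y r a - dec 0 * P0) < eps / 4) in h0.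
  change (Rabs (dec a * amplitude_Ai' Y r a - dec 0 * P1) < eps / 4) in h1.
  change (Rabs (K * (Rabs (Airy ((Y * edge a) ^ 2)) * dec a * / Y ^ 4)
     - K * (Rabs (Airy 0) * dec 0 * / Y ^ 4)) < eps / 4) in h2.
  change (Rabs (L * (y * a) - 0) < eps / 4) in h3.
  specialize (HA a r y ltac:(lra) Hr Hy). cbv zeta in HA. fold Y in HA.
  fold (amplitude_Ai Y r a) in HA. fold (amplitude_Ai' Y r a) in HA.
  specialize (Lip (y * cos 0) (y * cos a)). fold B0 in Lip.
  set (Ba := BesselK (RtoC r + Ci * RtoC (y * cos a)) y) in *.
  assert (HLip : Cmod (B0 - Ba)%C <= eps / 4).
  { eapply Rle_trans; [exact Lip|]. rewrite cos_0.
    apply Rle_trans with (L * (y * a)).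
    - apply Rmult_le_compat_l; [exact HL|].
      pose proof (cos_ge_quad a ltac:(lra)). pose proof (COS_bound a).
      replace (y * 1 - y * cos a) with (y * (1 - cos a)) by ring.
      rewrite Rabs_right by (apply Rle_ge, Rmult_le_pos; lra).
      apply Rmult_le_compat_l; [lra|nra].
    - apply Rabs_def2 in h3. lra. }
  rewrite phaseK_split in HA |- *. fold ph in HA |- *. fold (dec a) in HA. fold (dec 0).
  set (Va := (RtoC (dec a) * ph * (RtoC (amplitude_Ai Y r a) + Ci * RtoC (amplitude_Ai' Y r a)))%C) in *.
  set (V0 := (RtoC (dec 0) * ph * (RtoC P0 + Ci * RtoC P1))%C).
  assert (HV : Cmod (Va - V0)%C <= eps / 4 + eps / 4).
  { replace (Va - V0)%C with (ph * (RtoC (dec a * amplitude_Ai Y r a - dec 0 * P0)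
       + Ci * RtoC (dec a * amplitude_Ai' Y r a - dec 0 * P1)))%C
      by (unfold Va, V0; rewrite !RtoC_minus, !RtoC_mult; ring).
    rewrite Cmod_mult, Hph, Rmult_1_l. apply Cmod_le_plus.
    - rewrite Cmod_R. lra.
    - rewrite Cmod_mult, Cmod_Ci, Cmod_R, Rmult_1_l. lra. }
  replace (B0 - V0)%C with ((B0 - Ba) + ((Ba - Va) + (Va - V0)))%C by ring.
  eapply Rle_trans; [apply Cmod_le_plus; [exact HLip|apply Cmod_le_plus; [exact HA|exact HV]]|].
  apply Rabs_def2 in h2. unfold Rdiv in *. lra.
Qed.

Theorem theorem1p5 :
  forall M : R, 0 <= M ->
  exists theta0 : R, 0 < theta0 /\
  exists C1 C2 y0 : R, 0 < y0 /\
  forall theta r y : R,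
    0 < theta <= PI / 2 ->
    PI / 2 - theta0 <= theta <= PI / 2 ->
    Rabs r <= M ->
    y0 <= y ->
    let t := y * sin theta in
    let nu := (RtoC r + Ci * RtoC t)%C in
    let x := Rpower y (2 / 3) * zeta theta in
    let phase :=
      Cexp (RtoC (- (y * (PI / 2) * sin theta)) + Ci * RtoC (r * (PI / 2)))%C in
    let decay := exp (- (y * (PI / 2) * sin theta)) in
    0 <= zeta_base theta /\ 0 <= zeta theta /\
    exists E1 E2 : C,
      BesselK nu y =
        (RtoC (PI * sqrt 2 / Rpower y (1 / 3)) * phase
           * RtoC (cos (r * theta - r * (PI / 2)) * coefA theta * Airy x)
         - Ci * RtoC (PI * sqrt 2 / Rpower y (2 / 3)) * phase
           * RtoC (coefB r theta * coefA theta * Airy' x)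
         + E1 + E2)%C /\
      Cmod E1 <= C1 * (Rabs (Airy x) * decay / Rpower y (4 / 3)) /\
      Cmod E2 <= C2 * (Rabs (Airy' x) * decay / Rpower y (5 / 3)).
Proof.
  intros M HM.
  destruct (main_alpha M HM) as (K & HK & HA).
  destruct (main_right_angle M HM) as (K' & HK' & HA').
  (* The range [1 / 2] is that of [al] in all uniform estimates, and [32] comes from [good_exists].
     The whole error is placed in [E1], so [C2 = 0]. *)
  exists (1 / 2); split; [lra|]. exists (Rmax K K'), 0, 32. split; [lra|].
  intros theta r y Hth Hth0 Hr Hy t nu x phase decay.
  set (al := PI / 2 - theta).
  assert (Eth : theta = PI / 2 - al) by (unfold al; ring).
  assert (Hal : 0 <= al <= 1 / 2) by (unfold al; lra).
  assert (Hg : 0 <= gap al).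
  { pose proof (gap_ge al Hal). assert (0 <= al ^ 3) by (apply pow_le; lra). lra. }
  split; [rewrite Eth, zeta_base_gap; lra|].
  split; [unfold zeta, rpow; destruct (Rlt_dec _ _); [apply Rlt_le, exp_pos|lra]|].
  set (Y := Rpower y (1 / 3)).
  assert (HY : 0 < Y) by apply exp_pos.
  assert (EY2 : Rpower y (2 / 3) = Y ^ 2).
  { unfold Y. rewrite <- Rpower_third by lra. f_equal; simpl; field. }
  assert (EY4 : Rpower y (4 / 3) = Y ^ 4).
  { unfold Y. rewrite <- Rpower_third by lra. f_equal; simpl; field. }
  assert (Et : sin theta = cos al) by (rewrite Eth; apply sin_shift).
  assert (Eph : phase = phaseK y al r) by (unfold phase, phaseK; rewrite Et; reflexivity).
  set (main := (RtoC (PI * sqrt 2 / Y) * phase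
           * RtoC (cos (r * theta - r * (PI / 2)) * coefA theta * Airy x)
         - Ci * RtoC (PI * sqrt 2 / Rpower y (2 / 3)) * phase
           * RtoC (coefB r theta * coefA theta * Airy' x))%C).
  assert (Main : Cmod (BesselK nu y - main)%C <= Rmax K K' * (Rabs (Airy x) * decay / Y ^ 4)).
  { assert (Hd : 0 <= Rabs (Airy x) * decay / Y ^ 4).
    { apply Rdiv_le_0_compat; [|now apply pow_lt].
      apply Rmult_le_pos; [apply Rabs_pos|apply Rlt_le, exp_pos]. }
    assert (Ecos : cos (r * theta - r * (PI / 2)) = cos (r * al)).
    { rewrite Eth. replace (r * (PI / 2 - al) - r * (PI / 2)) with (- (r * al)) by ring. apply cos_neg. }
    unfold nu, t in *. unfold decay in *. unfold main. rewrite EY2, Ecos, Eph, Et in *.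
    destruct (Req_dec al 0) as [H0|H0].
    (* At the right angle the two saddle points coincide and [gap] vanishes, so the limit case is
       quoted instead of [main_alpha]. *)
    - assert (Eth2 : theta = PI / 2) by lra.
      assert (Ex : x = 0) by (unfold x; rewrite Eth2, zeta_right_angle; ring).
      apply Rle_trans with (K' * (Rabs (Airy x) * exp (- (y * (PI / 2) * cos al)) / Y ^ 4));
        [|apply Rmult_le_compat_r; [exact Hd|apply Rmax_r]].
      specialize (HA' r y Hr Hy). cbv zeta in HA'. fold Y in HA'.
      rewrite Ex, H0 in *. rewrite Eth2, coefA_right_angle, coefB_right_angle.
      eapply Rle_trans; [|exact HA']. apply Req_le. f_equal.
      rewrite Rmult_0_r, cos_0, !RtoC_mult, RtoC_opp. ring.
    - assert (Ha : 0 < al <= 1 / 2) by lra.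
      assert (Ex : x = (Y * edge al) ^ 2).
      { unfold x. rewrite EY2, Eth, zeta_edge by exact Ha. ring. }
      apply Rle_trans with (K * (Rabs (Airy x) * exp (- (y * (PI / 2) * cos al)) / Y ^ 4));
        [|apply Rmult_le_compat_r; [exact Hd|apply Rmax_l]].
      specialize (HA al r y Ha Hr Hy). cbv zeta in HA. fold Y in HA. rewrite <- Ex in HA.
      assert (EA : coefA theta = sqrt (edge al / sin al)).
      { unfold coefA. rewrite extend_left_off by lra. rewrite Eth. now apply coefA_raw. }
      assert (EB : coefB r theta = - (sin (r * al) / edge al)).
      { unfold coefB. rewrite extend_left_off by lra. rewrite Eth. now apply coefB_raw. }
      rewrite EA, EB.
      eapply Rle_trans; [|exact HA]. apply Req_le. f_equal.
      rewrite !RtoC_mult, RtoC_opp. ring. }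
  exists (BesselK nu y - main)%C, 0. split; [|split].
  - unfold main. ring.
  - rewrite EY4. exact Main.
  - rewrite Cmod_0, Rmult_0_l. lra.
Qed.
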